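(* Let $\rho$, $k_0$, $F$, $a,b,c$ be as in the context and let $F_0:=F/\eta^{2k_0}$. Let $\tau_0\in\mathfrak{H}$ be a point that is not an elliptic point of $\Gamma_0(2)$, let $U_{\tau_0}\subset\mathfrak{H}$ be a connected, simply connected open set containing $\tau_0$ on which $\mathfrak{J}$ is injective, and let $H$ be the (holomorphic) function with $F_0|_{U_{\tau_0}}=H\circ\mathfrak{J}$. Then for all $\tau\in U_{\tau_0}$, $$H''(\mathfrak{J}(\tau))+\frac{7\mathfrak{J}(\tau)-6a\mathfrak{J}(\tau)-3}{6\mathfrak{J}(\tau)(\mathfrak{J}(\tau)-1)}H'(\mathfrak{J}(\tau))+\frac{(b+c)\mathfrak{J}(\tau)+3c}{\mathfrak{J}(\tau)(\mathfrak{J}(\tau)-1)^2}H(\mathfrak{J}(\tau))=0.$$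
   Context: $\Gamma_0(2)=\{\begin{pmatrix}a&b\\c&d\end{pmatrix}\in\mathrm{SL}_2(\mathbf{Z}):2\mid c\}$; its elliptic points in $\mathfrak{H}$ are the $\Gamma_0(2)$-orbit of $\frac{1+i}{2}$. $q=e^{2\pi i\tau}$, $(F|_k\gamma)(\tau)=(c\tau+d)^{-k}F(\frac{a\tau+b}{c\tau+d})$. $M_k(\rho)$ is the space of holomorphic $F:\mathfrak{H}\to\mathbf{C}^2$ with $F|_k\gamma=\rho(\gamma)F$ for $\gamma\in\Gamma_0(2)$, holomorphic at the cusps. $E_2=1-24\sum\sigma(n)q^n$, $E_4=1+240\sum\sigma_3(n)q^n$, $G(\tau)=-E_2(\tau)+2E_2(2\tau)$, $\mathfrak{J}=\frac{3G^2}{E_4-G^2}$ (a Hauptmodul for $\Gamma_0(2)$, with $\mathfrak{J}(\tau_1)=\mathfrak{J}(\tau_2)$ iff $\tau_1,\tau_2$ are $\Gamma_0(2)$-equivalent), $\eta=q^{1/24}\prod(1-q^n)$, $D_kA=\frac{1}{2\pi i}A'-\frac{k}{12}E_2A$. Setting: $\rho:\Gamma_0(2)\to\mathrm{GL}_2(\mathbf{C})$ irreducible, $k_0$ least integer with $M_{k_0}(\rho)\ne0$, $F\neq0$ in $M_{k_0}(\rho)$, and $a,b,c\in\mathbf{C}$ the unique numbers with $D_{k_0+2}(D_{k_0}F)+aG\,D_{k_0}F+(bG^2+cE_4)F=0$. *)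

(* Defs.v *)
From HB Require Import structures.
From mathcomp Require Import all_boot all_order all_algebra.
From mathcomp Require Import complex.
From mathcomp Require Import all_classical all_reals all_analysis.

Set Implicit Arguments.
Unset Strict Implicit.
Unset Printing Implicit Defensive.

Import Order.TTheory GRing.Theory Num.Theory.
Import numFieldNormedType.Exports.

Local Open Scope classical_set_scope.
Local Open Scope ring_scope.

(* Packing [R[i]] as a numFieldType gives it the topology and the normed       *)
(* module structure over itself that every numFieldType has; [derive1 f] and   *)
(* [derivable f z 1] are then about limits of complex difference quotients.    *)
Definition Cx (R : realType) : numFieldType := R[i].

Section complex_analysis.
Context {R : realType}.
Local Notation C := (Cx R).

Definition ofR (x : R) : C := x%:C%C.
Definition im_part (z : C) : R := complex.Im (z : R[i]).
Definition re_part (z : C) : R := complex.Re (z : R[i]).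
Definition imagi : C := 'i%C.

Definition cexp (z : C) : C :=
  ofR (expR (re_part z)) *
  (ofR (cos (im_part z)) + imagi * ofR (sin (im_part z))).

Definition twopii : C := 2 * ofR pi * imagi.

Definition holomorphic_on (V : normedModType C) (A : set C) (f : C -> V) :=
  forall z, A z -> derivable f z 1.

Definition unit_interval : set R := [set x | 0 <= x <= 1].

(* Triviality of the fundamental group: every loop in U contracts inside U,    *)
(* with its base point fixed; connectedness is a separate hypothesis.          *)
Definition simply_connected (U : set C) :=
  forall f : R -> C,
    {within unit_interval, continuous f} ->
    (forall t, unit_interval t -> U (f t)) ->
    f 0 = f 1 ->
    exists h : R * R -> C,
      [/\ {within unit_interval `*` unit_interval, continuous h},
          forall p, (unit_interval `*` unit_interval) p -> U (h p),
          forall t, unit_interval t -> h (0, t) = f t,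
          forall t, unit_interval t -> h (1, t) = f 0 &
          forall s, unit_interval s -> h (s, 0) = f 0 /\ h (s, 1) = f 0].

Definition expmx (A : 'M[C]_2) : 'M[C]_2 :=
  lim (series (fun n => (n`!%:R)^-1 *: A ^+ n) @ \oo).

End complex_analysis.

Definition SL2Z : set 'M[int]_2 := [set g | \det g = 1].

Definition Gamma0_2 : set 'M[int]_2 :=
  [set g | SL2Z g /\ (2 %| g ord_max ord0)%Z].

Definition Tmx (h : nat) : 'M[int]_2 :=
  \matrix_(i, j) (if i == j then 1 else if i == ord0 then h%:Z else 0).

(* Width of the cusp g(oo): the least h > 0 with g T^h g^-1 in Gamma_0(2); the  *)
(* lower left entry of g T^h g^-1 is - h c^2.                                  *)
Definition cusp_width (g : 'M[int]_2) : nat :=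
  if (2 %| g ord_max ord0)%Z then 1%N else 2%N.

Definition cusp_stabilizer (g : 'M[int]_2) : 'M[int]_2 :=
  g *m Tmx (cusp_width g) *m invmx g.

Section modular_forms.
Context {R : realType}.
Local Notation C := (Cx R).

Definition upper_half_plane : set C := [set z | 0 < im_part z].

Definition moebius (g : 'M[int]_2) (tau : C) : C :=
  ((g ord0 ord0)%:~R * tau + (g ord0 ord_max)%:~R) /
  ((g ord_max ord0)%:~R * tau + (g ord_max ord_max)%:~R).

Definition slash (k : int) (F : C -> 'cV[C]_2) (g : 'M[int]_2) (tau : C) :
    'cV[C]_2 :=
  ((g ord_max ord0)%:~R * tau + (g ord_max ord_max)%:~R) ^ (- k) *:
  F (moebius g tau).

Definition elliptic_point (tau : C) :=
  exists2 g, Gamma0_2 g & tau = moebius g ((1 + imagi) / 2).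

(* Only the values of [rho] on Gamma_0(2) are relevant. *)
Definition is_representation (rho : 'M[int]_2 -> 'M[C]_2) :=
  (forall g, Gamma0_2 g -> rho g \in unitmx) /\
  (forall g h, Gamma0_2 g -> Gamma0_2 h -> rho (g *m h) = rho g *m rho h).

Definition is_irreducible (rho : 'M[int]_2 -> 'M[C]_2) :=
  forall W : {vspace 'cV[C]_2},
    (forall g, Gamma0_2 g -> forall v, v \in W -> rho g *m v \in W) ->
    W = 0%VS \/ W = fullv.

(* [F|_k g] is translated by h = cusp_width g through                          *)
(* rho (g T^h g^-1) = e^(2 pi i L), where L has its eigenvalues in the strip   *)
(* 0 <= Re < 1; holomorphy at the cusp g(oo) means that e^(-2 pi i L tau/h)    *)
(* times [F|_k g] is a power series in q^(1/h).  No diagonalizability of       *)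
(* rho (g T^h g^-1) is assumed.                                                *)
Definition holomorphic_at_cusp (rho : 'M[int]_2 -> 'M[C]_2) (k : int)
    (F : C -> 'cV[C]_2) (g : 'M[int]_2) :=
  let h : C := (cusp_width g)%:R in
  exists L : 'M[C]_2,
    [/\ expmx (twopii *: L) = rho (cusp_stabilizer g),
        forall l, eigenvalue L l -> 0 <= re_part l < 1 &
        exists A : nat -> 'cV[C]_2, forall tau, upper_half_plane tau ->
          (fun N => expmx ((twopii * tau / h) *: L) *m
             \sum_(0 <= n < N) cexp (twopii * n%:R * tau / h) *: A n) @ \oo
          --> slash k F g tau].

(* Elements of M_k(rho), as functions of which only the values on the upper    *)
(* half-plane matter.                                                          *)
Definition modular_form (rho : 'M[int]_2 -> 'M[C]_2) (k : int)
    (F : C -> 'cV[C]_2) :=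
  [/\ holomorphic_on upper_half_plane F,
      forall g, Gamma0_2 g -> forall tau, upper_half_plane tau ->
        slash k F g tau = rho g *m F tau &
      forall g, SL2Z g -> holomorphic_at_cusp rho k F g].

Definition nonzero_on_H (F : C -> 'cV[C]_2) :=
  exists2 tau, upper_half_plane tau & F tau != 0.

Definition least_weight (rho : 'M[int]_2 -> 'M[C]_2) (k0 : int) :=
  (exists F, modular_form rho k0 F /\ nonzero_on_H F) /\
  (forall k, (exists F, modular_form rho k F /\ nonzero_on_H F) -> k0 <= k).

Definition sigma (s n : nat) : nat := (\sum_(d <- divisors n) d ^ s)%N.

Definition qpar (tau : C) : C := cexp (twopii * tau).

Definition E2 (tau : C) : C :=
  1 - 24 * lim (series (fun n => (sigma 1 n.+1)%:R * qpar tau ^+ n.+1) @ \oo).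

Definition E4 (tau : C) : C :=
  1 + 240 * lim (series (fun n => (sigma 3 n.+1)%:R * qpar tau ^+ n.+1) @ \oo).

Definition Gfun (tau : C) : C := - E2 tau + 2 * E2 (2 * tau).

Definition Jfun (tau : C) : C :=
  3 * Gfun tau ^+ 2 / (E4 tau - Gfun tau ^+ 2).

Definition eta (tau : C) : C :=
  cexp (twopii * tau / 24) *
  lim ((fun N => \prod_(1 <= n < N.+1) (1 - qpar tau ^+ n)) @ \oo).

Definition Dop (k : int) (A : C -> 'cV[C]_2) (tau : C) : 'cV[C]_2 :=
  twopii^-1 *: derive1 A tau - (k%:~R / 12 * E2 tau) *: A tau.

End modular_forms.

(* Main.v *)
Require Import Defs.
From mathcomp Require Import all_boot all_order all_algebra.
From mathcomp Require Import complex.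
From mathcomp Require Import all_classical all_reals all_analysis.
From mathcomp Require Import ring lra zify.

(** Write D = (2 pi i)^-1 d/dtau. Since D eta = E2 eta / 24, dividing by eta^(2 k0) turns the
    equation of F into D^2 F0 - E2 D F0 / 6 + a G D F0 + (b G^2 + c E4) F0 = 0, and the
    equation for H follows from F0 = H o J by the chain rule, once one knows
      D G = E2 G / 6 + E4 / 6 - G^2 / 3,   D E4 = (E2 E4 + 3 G E4 - 4 G^3) / 3,
    which give D J = G (1 - J).

    These identities are proved on q-expansions. Ramanujan's D E2 = (E2^2 - E4) / 12 and the
    Chazy equation of E2 are convolution identities for sigma_1, obtained by summing
    S_3-invariant polynomials over the solutions of a x + b y = n. They imply that the defects
    5 G^2 - E4 - 4 E4(2 tau), E6 + 8 E6(2 tau) - 15 G^3 + 6 G E4 and E6 - 4 G^3 + 3 G E4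
    satisfy a homogeneous linear system of first order whose only exponents are 0 and 2, so
    that they vanish because two coefficients do.

    E4 - G^2 and 4 G^2 - E4 satisfy homogeneous linear equations of first order: a zero in U
    would make J locally constant. A zero of G would be a double zero of J, near which J takes
    values twice. Hence injectivity of J on U forces J <> 0, 1 and J' <> 0 on U. That F is
    twice differentiable is read off its expansion at the cusp oo. *)

(** Holomorphy here means one complex derivative, and no Cauchy integral is used, so second
    derivatives and the local behaviour of J need arguments of their own. Second derivatives of F
    come from power series; that of H comes from the openness of J, which turns a derivative of H' o
    J into one of H'. Openness, and the two-to-one behaviour at a double zero, rest on minimising |f
    - v| over a closed disc instead of counting zeros. The q-expansion identities use neither
    modularity of the Eisenstein series nor dimensions of spaces of forms: D multiplies the n-th
    coefficient by n, so a differential identity is a statement about convolutions and, modulo q^N,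
    about polynomials. E6 stands for E2 E4 - 3 D E4, and D E6 = (E2 E6 - E4^2) / 2 is then Chazy's
    equation rewritten. The exponent of eta is forced: D(eta^(2 k0)) = (k0 / 12) E2 eta^(2 k0), so
    that dividing by eta^(2 k0) turns D_k0 into D. *)

Set Implicit Arguments.
Unset Strict Implicit.
Unset Printing Implicit Defensive.

Import Order.TTheory GRing.Theory Num.Theory.
Import numFieldNormedType.Exports.

Local Open Scope classical_set_scope.
Local Open Scope ring_scope.

(** * Divisor convolutions *)

Section quadruple_sums.
Variables (K : comRingType) (n : nat).
Local Notation I := 'I_n.+1.
Local Notation quad := ((I * I) * (I * I))%type.
Implicit Types (p : quad) (f g : K -> K -> K -> K -> K).

Definition is_quad p :=
  [&& (0 < p.1.1)%N, (0 < p.1.2)%N, (0 < p.2.1)%N, (0 < p.2.2)%N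
    & (p.1.1 * p.1.2 + p.2.1 * p.2.2 == n)%N].

(** The arguments are passed in the order a, b, x, y, whereas the quadruple ((a, x), (b, y)) groups
    the factors of each product. *)
Definition quad_eval f p : K :=
  f (p.1.1 : nat)%:R (p.2.1 : nat)%:R (p.1.2 : nat)%:R (p.2.2 : nat)%:R.

Definition shear p : quad :=
  ((inord (p.1.1 + p.2.1), p.1.2), (p.2.1, inord (p.2.2 - p.1.2))).

Definition unshear p : quad :=
  ((inord (p.1.1 - p.2.1), p.1.2), (p.2.1, inord (p.2.2 + p.1.2))).

Definition swap_quad p : quad := (p.2, p.1).

(** [inord] returns 0 outside its range, so a positive value certifies that the argument was in
    range. *)
Lemma inord_gt0 k : (0 < (inord k : I))%N -> (inord k : I) = k :> nat.
Proof.
by rewrite /inord /insubd; case: insubP => //= u _ <-.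
Qed.

Lemma shear_eq (a b x y : nat) : (x <= y)%N ->
  ((a + b) * x + b * (y - x) = a * x + b * y)%N.
Proof. by move=> xy; rewrite mulnDl mulnBr -addnA subnKC // leq_mul2l xy orbT. Qed.

Lemma leq_addn_quad (a b x y : nat) : (0 < x)%N -> (0 < y)%N ->
  (a + b <= a * x + b * y)%N.
Proof. by move=> x0 y0; rewrite leq_add // leq_pmulr. Qed.

Lemma quad_sum_shear f :
  \sum_(p | is_quad p && (p.2.1 < p.1.1)%N) quad_eval f p =
  \sum_(p | is_quad p && (p.1.2 < p.2.2)%N)
     quad_eval (fun a b x y => f (a + b) b x (y - x)) p.
Proof.
rewrite (reindex_onto shear unshear) /=; last first.
  case=> -[a x] [b y] /=; rewrite /is_quad /= => /andP[/and5P[a0 x0 b0 y0 /eqP e] ba].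
  have := leq_addn_quad x y a0 b0; rewrite mulnC [(_ * b)%N]mulnC e => h.
  rewrite /shear /unshear /=; congr (_, _, (_, _)); apply: val_inj;
    rewrite /= !inordK; have := ltn_ord a; have := ltn_ord y; lia.
have cond p : (is_quad (shear p) && ((shear p).2.1 < (shear p).1.1)%N &&
     (unshear (shear p) == p)) = is_quad p && (p.1.2 < p.2.2)%N.
  case: p => -[a x] [b y]; rewrite /is_quad /shear /unshear /=; apply/idP/idP.
    move=> /andP[/andP[/and5P[a0 x0 b0 y0 /eqP e] ba] _].
    move: (y0) ba e; rewrite (inord_gt0 a0) (inord_gt0 y0) subn_gt0 => {}y0 ba e.
    rewrite shear_eq ?(ltnW y0) // in e.
    by rewrite y0 x0 b0 e eqxx /= (leq_ltn_trans _ y0) // !andbT; lia.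
  move=> /andP[/and5P[a0 x0 b0 y0 /eqP e] xy].
  (* The new entry is in range: all entries being positive, a + b <= a x + b y = n. *)
  have h1 : (a + b < n.+1)%N by have := leq_addn_quad a b x0 y0; rewrite e.
  have h2 : (y - x < n.+1)%N by have := ltn_ord y; lia.
  have e1 := shear_eq a b (ltnW xy).
  rewrite !inordK // e1 e eqxx b0 x0 subn_gt0 xy.
  rewrite addn_gt0 a0 /= -{1}[b : nat]add0n ltn_add2r a0 /=.
  by apply/eqP; congr (_, _, (_, _)); apply: val_inj; rewrite /= inordK; have := ltn_ord y; have := ltn_ord a; lia.
rewrite (eq_bigl _ _ cond); apply: eq_bigr => -[[a x] [b y]].
rewrite /is_quad /= => /andP[/and5P[a0 x0 b0 y0 /eqP e] xy].
have h1 : (a + b < n.+1)%N by have := leq_addn_quad a b x0 y0; rewrite e.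
have h2 : (y - x < n.+1)%N by have := ltn_ord y; lia.
by rewrite /quad_eval /= !inordK ?natrD ?natrB // ltnW.
Qed.

Lemma is_quad_swap p : is_quad (swap_quad p) = is_quad p.
Proof. by case: p => -[a x] [b y]; rewrite /is_quad /=; lia. Qed.

Lemma quad_sum_swap (P : pred quad) (F : quad -> K) :
  \sum_(p | P p) F p = \sum_(p | P (swap_quad p)) F (swap_quad p).
Proof. by apply: (reindex_inj (can_inj (g := swap_quad) _)); case=> -[a x] [b y]. Qed.

Lemma quad_sum_split (s t : quad -> nat) (F : quad -> K) :
  \sum_(p | is_quad p) F p =
  \sum_(p | is_quad p && (t p < s p)%N) F p + \sum_(p | is_quad p && (s p < t p)%N) F p
  + \sum_(p | is_quad p && (s p == t p)) F p.
Proof.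
rewrite (bigID (fun p => t p < s p)%N) /= -addrA; congr (_ + _).
rewrite (bigID (fun p => s p < t p)%N) /=; congr (_ + _); apply: eq_bigl => p; lia.
Qed.

(* (a, b, x, y) |-> (a + b, b, x, y - x) is a bijection from the quadruples with x < y onto
   those with b < a; together with its mirror image it compares the sums off the diagonals. *)
Lemma quad_sum_invariant f g :
  (forall a b x y, f (a + b) b x (y - x) = g a b x y) ->
  (forall a b x y, f a (a + b) (x - y) y = g a b x y) ->
  \sum_(p | is_quad p) (quad_eval f p - quad_eval g p) =
  \sum_(p | is_quad p && (p.1.1 == p.2.1)) quad_eval f p -
  \sum_(p | is_quad p && (p.1.2 == p.2.2)) quad_eval g p.
Proof.
move=> fg1 fg2; rewrite sumrB.
rewrite (quad_sum_split (fun p => p.1.1) (fun p => p.2.1)).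
rewrite [X in _ - X](quad_sum_split (fun p => p.2.2) (fun p => p.1.2)).
(* The part b < a is sheared directly; in the part a < b the two products are exchanged, sheared,
   and exchanged back. *)
rewrite quad_sum_shear [X in _ + X + _]quad_sum_swap /=.
under [X in _ + X + _]eq_bigl do rewrite is_quad_swap.
rewrite (quad_sum_shear (fun a b x y => f b a y x)).
rewrite [X in _ + X + _]quad_sum_swap /=.
under [X in _ + X + _]eq_bigl do rewrite is_quad_swap.
have e1 : \sum_(p | is_quad p && (p.1.2 < p.2.2)%N)
     quad_eval (fun a b x y => f (a + b) b x (y - x)) p =
   \sum_(p | is_quad p && (p.1.2 < p.2.2)%N) quad_eval g p.
  by apply: eq_bigr => p _; exact: fg1.
have e2 : \sum_(p | is_quad p && (p.2.2 < p.1.2)%N)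
     quad_eval (fun a b x y => f b (a + b) (y - x) x) (swap_quad p) =
   \sum_(p | is_quad p && (p.2.2 < p.1.2)%N) quad_eval g p.
  by apply: eq_bigr => p _; rewrite /quad_eval /= -fg2 [in LHS]addrC.
rewrite e1 e2.
under [X in _ - (_ + _ + X)]eq_bigl do rewrite eq_sym.
by rewrite opprD addrACA subrr add0r.
Qed.

End quadruple_sums.

(** * Divisor sums as sums over quadruples *)

Section divisor_convolutions.
Variable K : numFieldType.
Implicit Types n k : nat.
Local Notation quad n := (('I_n.+1 * 'I_n.+1) * ('I_n.+1 * 'I_n.+1))%type.

Definition conv (u v : nat -> K) n := \sum_(i < n.+1) u i * v (n - i)%N.

(* [divisors 0] is [:: 1], hence the case distinction. *)
Definition sig s n : K := if n is 0%N then 0 else (sigma s n)%:R.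

(** The range [n] is kept apart from the number [k] that is factored: the factorizations of all k <=
    n then live in one finite type and can be paired into quadruples. *)
Definition is_fact n k (p : 'I_n.+1 * 'I_n.+1) :=
  [&& (0 < p.1)%N, (0 < p.2)%N & (p.1 * p.2 == k)%N].

Lemma sig_fact s n k : (0 < k <= n)%N ->
  sig s k = \sum_(p | @is_fact n k p) (p.1 : nat)%:R ^+ s.
Proof.
case: k => // k /andP[k0 kn]; rewrite /sig /sigma natr_sum.
have -> : \sum_(i <- divisors k.+1) ((i ^ s)%N%:R : K) =
    \sum_(d : 'I_n.+1 | (d %| k.+1)%N) (d : nat)%:R ^+ s.
  rewrite (eq_bigl (fun d : 'I_n.+1 => (d : nat) \in divisors k.+1)); last first.
    by move=> d; rewrite dvdn_divisors.
  rewrite -(big_mkord (fun d => d \in divisors k.+1) (fun d => d%:R ^+ s : K)).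
  rewrite -[RHS]big_filter; under [LHS]eq_bigr do rewrite natrX.
  apply: perm_big; apply: uniq_perm; rewrite ?divisors_uniq ?filter_uniq ?iota_uniq //.
  move=> d; rewrite mem_filter mem_index_iota /=; apply/idP/idP => [dk|/andP[]//].
  by rewrite dk /= ltnS (leq_trans _ kn) // dvdn_leq // dvdn_divisors.
rewrite [RHS](eq_bigl (fun p : 'I_n.+1 * 'I_n.+1 => (p.1 %| k.+1)%N && (p.2 == inord (k.+1 %/ p.1)))).
  rewrite -(pair_big_dep (fun d : 'I_n.+1 => d %| k.+1)%N (fun d e => e == inord (k.+1 %/ d))
    (fun d _ => (d : nat)%:R ^+ s)) /=.
  by apply: eq_bigr => d _; rewrite big_pred1_eq.
case=> d e; rewrite /is_fact /=; apply/idP/idP.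
  case/and3P=> d0 e0 /eqP <-; rewrite dvdn_mulr //= mulKn //.
  by apply/eqP; apply: val_inj; rewrite /= inordK.
case/andP=> dk /eqP ->; have d0 : (0 < d)%N by rewrite (dvdn_gt0 _ dk).
rewrite inordK; last by rewrite ltnS (leq_trans (leq_div _ _)).
by rewrite d0 divn_gt0 // dvdn_leq //= mulnC divnK.
Qed.

(** Grouping the quadruples by k = a x splits them into a factorization of k and one of n - k.
    Positivity of the entries excludes k = 0 and k = n, where the convolution vanishes because [u]
    and [v] are 0 at 0. *)
Lemma quad_sum_conv n (f g : nat -> nat -> K) (u v : nat -> K) :
   u 0%N = 0 -> v 0%N = 0 ->
   (forall k, (0 < k <= n)%N -> u k = \sum_(p | @is_fact n k p) f p.1 p.2) ->
   (forall k, (0 < k <= n)%N -> v k = \sum_(p | @is_fact n k p) g p.1 p.2) ->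
   conv u v n = \sum_(p | @is_quad n p) f p.1.1 p.1.2 * g p.2.1 p.2.2.
Proof.
move=> u0 v0 uf vg.
rewrite (partition_big (fun p : ('I_n.+1 * 'I_n.+1) * ('I_n.+1 * 'I_n.+1) =>
  inord (p.1.1 * p.1.2) : 'I_n.+1) predT) //=.
rewrite /conv; apply: eq_bigr => -[k kn] _ /=.
case: (posnP k) => [k0|k0].
  rewrite [in LHS]k0 u0 mul0r big1 // => -[[a x] [b y]] /andP[/and5P[/= a0 x0 b0 y0 /eqP e]].
  move=> /eqP/(congr1 val) /=; rewrite inordK ?k0 => [|]; last by rewrite ltnS -[in leqRHS]e leq_addr.
  by move=> /eqP; rewrite muln_eq0 !gtn_eqF.
case: (ltnP k n) => [kn'|kn']; last first.
  have -> : (n - k = 0)%N by lia.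
  rewrite v0 mulr0 big1 // => -[[a x] [b y]] /andP[/and5P[/= a0 x0 b0 y0 /eqP e]].
  move=> /eqP/(congr1 val) /=; rewrite inordK => [|]; last by rewrite ltnS -[in leqRHS]e leq_addr.
  have := muln_gt0 b y; rewrite b0 y0 /=; lia.
rewrite (uf k); last by rewrite k0 ltnW.
rewrite (vg (n - k)%N); last by rewrite subn_gt0 kn' leq_subr.
rewrite big_distrlr /= pair_big_dep /=; apply: eq_bigl => -[[a x] [b y]].
rewrite /is_fact /is_quad /=.
apply/idP/idP.
  case/andP=> /and3P[a0 x0 /eqP e] /and3P[b0 y0 /eqP e'].
  rewrite a0 x0 b0 y0 e e' subnKC ?(ltnW kn') //= eqxx /=.
  by apply/eqP; apply: val_inj; rewrite /= inordK.
case/andP=> /and5P[a0 x0 b0 y0 /eqP e] /eqP/(congr1 val) /=.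
rewrite inordK => [e'|]; last by rewrite ltnS -[in leqRHS]e leq_addr.
rewrite a0 x0 b0 y0 e' eqxx /=.
by have -> : (b * y = n - k)%N by lia.
Qed.

(** For a = b = d the equation reads d (x + y) = n, hence d m = n with m = x + y and 0 < x < m. *)
Lemma quad_sum_diag1 n (h : nat -> nat -> nat -> K) :
  \sum_(p | @is_quad n p && (p.1.1 == p.2.1)) h p.1.1 p.1.2 p.2.2 =
  \sum_(p | @is_fact n n p) \sum_(1 <= x < p.2) h p.1 x (p.2 - x)%N.
Proof.
have inner (p : 'I_n.+1 * 'I_n.+1) : \sum_(1 <= x < p.2) h p.1 x (p.2 - x)%N =
   \sum_(x : 'I_n.+1 | (0 < x < p.2)%N) h p.1 x (p.2 - x)%N.
  rewrite -(big_mkord (fun x => 0 < x < p.2)%N (fun x => h p.1 x (p.2 - x)%N)).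
  rewrite [RHS](big_cat_nat (n := p.2)) //=; last by rewrite ltnW.
  rewrite [X in _ = _ + X]big_nat_cond [X in _ = _ + X]big_pred0 ?addr0; last by move=> x /=; lia.
  case: (p.2 : nat) => [|m]; first by rewrite !big_geq.
  rewrite [RHS]big_ltn_cond //= [LHS]big_nat_cond [RHS]big_nat_cond.
  by apply: eq_bigl => x; lia.
under [RHS]eq_bigr do rewrite inner.
rewrite pair_big_dep /=.
pose t (p : ('I_n.+1 * 'I_n.+1) * 'I_n.+1) : ('I_n.+1 * 'I_n.+1) * ('I_n.+1 * 'I_n.+1) :=
  ((p.1.1, p.2), (p.1.1, inord (p.1.2 - p.2))).
pose t' (p : ('I_n.+1 * 'I_n.+1) * ('I_n.+1 * 'I_n.+1)) : ('I_n.+1 * 'I_n.+1) * 'I_n.+1 :=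
  ((p.1.1, inord (p.1.2 + p.2.2)), p.1.2).
rewrite (reindex_onto t t') /=; last first.
  case=> -[a x] [b y] /=; rewrite /is_quad /= => /andP[/and5P[a0 x0 b0 y0 /eqP e] /eqP eab].
  rewrite /t /= -eab; congr (_, _, (_, _)); apply: val_inj => /=.
  have xy : (x + y <= n)%N by rewrite -[leqRHS]e leq_add // leq_pmull.
  by rewrite (@inordK _ (x + y)) ?ltnS // addKn inordK.
apply: eq_big => [[[a m] x]|[[a m] x]]; rewrite /is_quad /is_fact /t /t' /=.
  apply/idP/idP.
    move=> /andP[/andP[/and5P[a0 x0 _ y0 /eqP e] _] /eqP[em]].
    move: (y0) e; rewrite (inord_gt0 y0) subn_gt0 => xm.
    by rewrite -mulnDr subnKC ?(ltnW xm) // => ->; rewrite a0 x0 xm eqxx (ltn_trans x0 xm).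
  move=> /andP[/and3P[a0 m0 /eqP e] /andP[x0 xm]].
  have mx : (m - x < n.+1)%N by have := ltn_ord m; lia.
  rewrite inordK // a0 x0 subn_gt0 xm -mulnDr subnKC ?(ltnW xm) // e !eqxx /=.
  by apply/eqP; congr (_, _, _); apply: val_inj; rewrite /= inordK.
move=> /andP[/andP[/and5P[a0 x0 _ y0 /eqP e] _] _].
by rewrite (inord_gt0 y0).
Qed.

(** Transposing each product exchanges (a, b) with (x, y) and reduces this to the other diagonal. *)
Lemma quad_sum_diag2 n (h : nat -> nat -> nat -> K) :
  \sum_(p | @is_quad n p && (p.1.2 == p.2.2)) h p.1.1 p.2.1 p.1.2 =
  \sum_(p | @is_fact n n p) \sum_(1 <= a < p.1) h a (p.1 - a)%N p.2.
Proof.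
pose tr (p : ('I_n.+1 * 'I_n.+1) * ('I_n.+1 * 'I_n.+1)) := ((p.1.2, p.1.1), (p.2.2, p.2.1)).
have tr_inj : injective tr by apply: (can_inj (g := tr)); case=> -[a x] [b y].
pose sw (p : 'I_n.+1 * 'I_n.+1) := (p.2, p.1).
have sw_inj : injective sw by apply: (can_inj (g := sw)); case.
rewrite (reindex_inj tr_inj) [RHS](reindex_inj sw_inj) /=.
rewrite (eq_bigl (fun p => @is_quad n p && (p.1.1 == p.2.1))); last first.
  move=> [[a x] [b y]]; rewrite /is_quad /=.
  by rewrite mulnC [(y * b)%N]mulnC; case: (posnP a); case: (posnP b); case: (posnP x); case: (posnP y).
rewrite (quad_sum_diag1 n (fun x a b => h a b x)).
by apply: eq_bigl => -[d m]; rewrite /is_fact /= mulnC andbCA.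
Qed.

Lemma conv_sig_quad n : conv (sig 1) (sig 1) n =
  \sum_(p | @is_quad n p) (p.1.1 : nat)%:R * (p.2.1 : nat)%:R.
Proof.
apply: (quad_sum_conv (f := fun a _ => a%:R) (g := fun a _ => a%:R)) => // k kn;
  exact: sig_fact.
Qed.

Lemma conv_nsig_quad n : conv (fun k => k%:R * sig 1 k) (fun k => k%:R * sig 1 k) n =
  \sum_(p | @is_quad n p) ((p.1.1 : nat)%:R ^+ 2 * (p.1.2 : nat)%:R) *
    ((p.2.1 : nat)%:R ^+ 2 * (p.2.2 : nat)%:R).
Proof.
have H k : (0 < k <= n)%N -> k%:R * sig 1 k =
    \sum_(p | @is_fact n k p) (p.1 : nat)%:R ^+ 2 * (p.2 : nat)%:R.
  move=> kn; rewrite (sig_fact _ kn) mulr_sumr; apply: eq_bigr => -[d m] /and3P[_ _ /eqP <-] /=.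
  by rewrite natrM; ring.
by apply: (quad_sum_conv (f := fun a x => a%:R ^+ 2 * x%:R)
  (g := fun a x => a%:R ^+ 2 * x%:R)); rewrite ?mul0r.
Qed.

(** Keeping [s] apart from [d] makes the induction on [d] possible; the case used is s = d. *)
Lemma sum_norm_form (s : K) d : (0 < d)%N ->
  \sum_(1 <= a < d) (a%:R ^+ 2 + a%:R * (s - a%:R) + (s - a%:R) ^+ 2) =
  (d%:R - 1) * s ^+ 2 - s * (d%:R * (d%:R - 1)) / 2
  + d%:R * (d%:R - 1) * (2 * d%:R - 1) / 6.
Proof.
elim: d => // -[_ _|d IH _]; first by rewrite big_geq //; field.
by rewrite big_nat_recr //= IH // -!natr1; field.
Qed.

Lemma conv_sigma1 n : 12 * conv (sig 1) (sig 1) n =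
  5 * sig 3 n + (1 - 6 * n%:R) * sig 1 n.
Proof.
case: (posnP n) => [->|n0].
  by rewrite /conv big_ord1 /= !(mulr0, mul0r, addr0).
(* Here f(a, b) = g(a, - b) and f(a + b, b) = g(a, b), while f - g = - 2 a b isolates the
   convolution. *)
pose f (a b x y : K) : K := a ^+ 2 - a * b + b ^+ 2.
pose g (a b x y : K) : K := a ^+ 2 + a * b + b ^+ 2.
have := @quad_sum_invariant K n f g.
have -> : \sum_(p | @is_quad n p) (quad_eval f p - quad_eval g p) = - 2 * conv (sig 1) (sig 1) n.
  rewrite conv_sig_quad mulr_sumr; apply: eq_bigr => p _.
  by rewrite /quad_eval /f /g; ring.
have -> : \sum_(p | @is_quad n p && (p.1.1 == p.2.1)) quad_eval f p =
    \sum_(p | @is_fact n n p) (n%:R * (p.1 : nat)%:R ^+ 1 - (p.1 : nat)%:R ^+ 2).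
  rewrite (eq_bigr (fun p : quad n => (p.1.1 : nat)%:R ^+ 2)); last first.
    by move=> p /andP[_ /eqP e]; rewrite /quad_eval /f e; ring.
  rewrite (quad_sum_diag1 n (fun d _ _ => d%:R ^+ 2)).
  apply: eq_bigr => -[d m] /and3P[/= d0 m0 /eqP/(congr1 (fun k => k%:R : K))].
  by rewrite sumr_const_nat -[_ *+ (m - 1)]mulr_natr natrB // natrM => <-; ring.
have -> : \sum_(p | @is_quad n p && (p.1.2 == p.2.2)) quad_eval g p =
    \sum_(p | @is_fact n n p) (5 / 6 * (p.1 : nat)%:R ^+ 3 - (p.1 : nat)%:R ^+ 2
       + (p.1 : nat)%:R ^+ 1 / 6).
  rewrite (quad_sum_diag2 n (fun a b _ => a%:R ^+ 2 + a%:R * b%:R + b%:R ^+ 2)).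
  apply: eq_bigr => -[d m] /and3P[/= d0 m0 _].
  rewrite big_nat_cond (eq_bigr (fun a => a%:R ^+ 2 + a%:R * (d%:R - a%:R) + (d%:R - a%:R) ^+ 2)).
    by rewrite -big_nat_cond sum_norm_form //; field.
  by move=> a /andP[/andP[_ ad] _]; rewrite natrB ?(ltnW ad).
rewrite !(sumrB, big_split) /= -!mulr_sumr -!mulr_suml -!sig_fact ?n0 ?leqnn // => H.
have {}H := H _ _.
have -> : conv (sig 1) (sig 1) n = - (- 2 * conv (sig 1) (sig 1) n) / 2 by field.
by rewrite H; [field | move=> *; rewrite /f /g; ring..].
Qed.

Lemma conv_nsigma1 n :
  12 * conv (fun k => k%:R * sig 1 k) (fun k => k%:R * sig 1 k) n =
  n%:R ^+ 2 * sig 3 n - n%:R ^+ 3 * sig 1 n.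
Proof.
case: (posnP n) => [->|n0].
  by rewrite /conv big_ord1 /= !(mulr0, mul0r, addr0, subr0).
(* One has g = a^4 x (y - x) + b^4 y (x - y) - (a + b)^4 x y, which is symmetric in a, b and - (a +
   b) when the weights x, y are permuted accordingly; f is g at (a, - b, x, - y). Moreover f - g =
   12 (a^2 x) (b^2 y), and k sigma_1(k) is the sum of a^2 x over a x = k. *)
pose f (a b x y : K) : K := - (a ^+ 4 * x ^+ 2 + b ^+ 4 * y ^+ 2)
  - x * y * (4 * a ^+ 3 * b - 6 * a ^+ 2 * b ^+ 2 + 4 * a * b ^+ 3).
pose g (a b x y : K) : K := - (a ^+ 4 * x ^+ 2 + b ^+ 4 * y ^+ 2)
  - x * y * (4 * a ^+ 3 * b + 6 * a ^+ 2 * b ^+ 2 + 4 * a * b ^+ 3).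
have := @quad_sum_invariant K n f g.
have -> : \sum_(p | @is_quad n p) (quad_eval f p - quad_eval g p) =
    12 * conv (fun k => k%:R * sig 1 k) (fun k => k%:R * sig 1 k) n.
  rewrite conv_nsig_quad mulr_sumr; apply: eq_bigr => p _.
  by rewrite /quad_eval /f /g; ring.
have -> : \sum_(p | @is_quad n p && (p.1.1 == p.2.1)) quad_eval f p =
    \sum_(p | @is_fact n n p) (n%:R ^+ 2 * (p.1 : nat)%:R ^+ 2 - n%:R ^+ 3 * (p.1 : nat)%:R ^+ 1).
  (* For a = b, f collapses to - a^4 (x + y)^2 = - n^2 a^2; likewise, for x = y, g will collapse to
     - x^2 (a + b)^4 = - n^2 (a + b)^2. *)
  rewrite (eq_bigr (fun p : quad n => - n%:R ^+ 2 * (p.1.1 : nat)%:R ^+ 2)); last first.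
    move=> p /andP[/and5P[_ _ _ _ /eqP/(congr1 (fun k => k%:R : K)) e] /eqP e1].
    by rewrite -e /quad_eval /f e1 natrD !natrM; ring.
  rewrite (quad_sum_diag1 n (fun d _ _ => - n%:R ^+ 2 * d%:R ^+ 2)).
  apply: eq_bigr => -[d m] /and3P[/= d0 m0 /eqP/(congr1 (fun k => k%:R : K)) e].
  by rewrite sumr_const_nat -[_ *+ (m - 1)]mulr_natr natrB // -e natrM; ring.
have -> : \sum_(p | @is_quad n p && (p.1.2 == p.2.2)) quad_eval g p =
    \sum_(p | @is_fact n n p) (n%:R ^+ 2 * (p.1 : nat)%:R ^+ 2 - n%:R ^+ 2 * (p.1 : nat)%:R ^+ 3).
  rewrite (eq_bigr (fun p : quad n => - n%:R ^+ 2 * ((p.1.1 : nat)%:R + (p.2.1 : nat)%:R) ^+ 2)); last first.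
    move=> p /andP[/and5P[_ _ _ _ /eqP/(congr1 (fun k => k%:R : K)) e] /eqP e1].
    by rewrite -e /quad_eval /g e1 natrD !natrM; ring.
  rewrite (quad_sum_diag2 n (fun a b _ => - n%:R ^+ 2 * (a%:R + b%:R) ^+ 2)).
  apply: eq_bigr => -[d m] /and3P[/= d0 m0 _].
  rewrite big_nat_cond (eq_bigr (fun=> - n%:R ^+ 2 * d%:R ^+ 2)).
    by rewrite -big_nat_cond sumr_const_nat -[_ *+ (d - 1)]mulr_natr natrB //; ring.
  by move=> a /andP[/andP[_ ad] _]; rewrite -natrD subnKC ?(ltnW ad).
rewrite !sumrB /= -!mulr_sumr -!sig_fact ?n0 ?leqnn // => ->; first by ring.
all: by move=> *; rewrite /f /g; ring.
Qed.

End divisor_convolutions.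

(** * Coefficients of the Eisenstein series *)

Section eisenstein_coefficients.
Variable K : numFieldType.
Implicit Types (n : nat) (u v : nat -> K) (A B : {poly K}).

Definition e2c n : K := (n == 0)%:R - 24 * sig K 1 n.
Definition e4c n : K := (n == 0)%:R + 240 * sig K 3 n.
Definition dil m u n : K := if (m %| n)%N then u (n %/ m)%N else 0.
Definition gc n : K := 2 * dil 2 e2c n - e2c n.

(** This is q d/dq, the form taken by D in the variable q. *)
Definition theta A := \poly_(i < size A) (i%:R * A`_i).

Lemma coef_theta A n : (theta A)`_n = n%:R * A`_n.
Proof. by rewrite coef_poly; case: ltnP => // /leq_sizeP ->; rewrite ?mulr0. Qed.

Lemma thetaE A : theta A = 'X * A^`().
Proof.
apply/polyP => n; rewrite coef_theta coefXM; case: n => [|n] /=; first by rewrite mul0r.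
by rewrite coef_deriv mulr_natl.
Qed.

Lemma thetaM A B : theta (A * B) = theta A * B + A * theta B.
Proof. by rewrite !thetaE derivM; ring. Qed.

Lemma thetaN A : theta (- A) = - theta A.
Proof. by rewrite !thetaE derivN mulrN. Qed.

Lemma thetaD A B : theta (A + B) = theta A + theta B.
Proof. by rewrite !thetaE derivD mulrDr. Qed.

Lemma thetaB A B : theta (A - B) = theta A - theta B.
Proof. by rewrite !thetaE derivB mulrBr. Qed.

Lemma theta_nat n : theta n%:R = 0.
Proof. by rewrite !thetaE -polyC_natr derivC mulr0. Qed.

Lemma coefM_natl k A n : (k%:R * A)`_n = k%:R * A`_n.
Proof. by rewrite mulr_natl coefMn mulr_natl. Qed.

Lemma theta0 : theta 0 = 0.
Proof. exact: (theta_nat 0). Qed.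

Lemma theta_comp A : theta (A \Po 'X^2) = 2 * (theta A \Po 'X^2).
Proof. by rewrite !thetaE deriv_comp derivXn rmorphM /= comp_polyX; ring. Qed.

Section truncation.
Variable N : nat.

(** Divisibility by X^N. Computing with polynomials modulo this ideal, which is stable under [theta]
    and under q -> q^2, replaces power series and keeps [ring] available. *)
Definition small A := forall i, (i < N)%N -> A`_i = 0.

Lemma smallD A B : small A -> small B -> small (A + B).
Proof. by move=> a b i iN; rewrite coefD a ?b ?addr0. Qed.

Lemma smallM A B : small B -> small (A * B).
Proof.
move=> b i iN; rewrite coefM big1 // => j _.
by rewrite b ?mulr0 // (leq_ltn_trans (leq_subr _ _)).
Qed.

Lemma smallB A B : small A -> small B -> small (A - B).
Proof. by move=> a b i iN; rewrite coefB a ?b ?subr0. Qed.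

Lemma small_theta A : small A -> small (theta A).
Proof. by move=> a i iN; rewrite coef_theta a ?mulr0. Qed.

Lemma small_comp A : small A -> small (A \Po 'X^2).
Proof.
move=> a i iN; rewrite coef_comp_poly_Xn //; case: ifP => // _.
by rewrite a // (leq_ltn_trans (leq_div _ _)).
Qed.

Lemma small_nat k A : small (k.+1%:R * A) -> small A.
Proof.
move=> a i /a /eqP; rewrite mulr_natl coefMn mulrn_eq0 /= => /eqP //.
Qed.

Definition trunc u : {poly K} := \poly_(i < N) u i.

Lemma coef_trunc u i : (i < N)%N -> (trunc u)`_i = u i.
Proof. by move=> iN; rewrite coef_poly iN. Qed.

Lemma coef_truncM u v i : (i < N)%N -> (trunc u * trunc v)`_i = conv u v i.
Proof.
move=> iN; rewrite coefM; apply: eq_bigr => j _; rewrite !coef_trunc //.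
  by rewrite (leq_ltn_trans (leq_subr _ _)).
by rewrite (leq_ltn_trans _ iN) // -ltnS.
Qed.

End truncation.

Lemma conv_deltal u n : conv (fun k => (k == 0)%:R) u n = u n.
Proof.
rewrite /conv big_ord_recl /= subn0 mul1r big1 ?addr0 // => i _.
by rewrite /bump /= mul0r.
Qed.

Lemma conv_deltar u n : conv u (fun k => (k == 0)%:R) n = u n.
Proof.
rewrite /conv big_ord_recr /= subnn mulr1 big1 ?add0r // => i _.
have -> : (n - i == 0 :> nat)%N = false by have := ltn_ord i; lia.
by rewrite mulr0.
Qed.

Lemma conv_delta_sig (c : K) n :
  conv (fun k => (k == 0)%:R + c * sig K 1 k) (fun k => (k == 0)%:R + c * sig K 1 k) n =
  (n == 0)%:R + 2 * c * sig K 1 n + c ^+ 2 * conv (sig K 1) (sig K 1) n.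
Proof.
rewrite -(conv_deltal (fun k => (k == 0)%:R) n).
have -> : 2 * c * sig K 1 n = c * conv (fun k => (k == 0)%:R) (sig K 1) n +
    c * conv (sig K 1) (fun k => (k == 0)%:R) n by rewrite conv_deltal conv_deltar; ring.
rewrite /conv !mulr_sumr -!big_split /=; apply: eq_bigr => i _; ring.
Qed.

(** Coefficient form of Ramanujan's E2^2 = 12 D E2 + E4. *)
Lemma conv_e2c n : conv e2c e2c n = 12 * n%:R * e2c n + e4c n.
Proof.
have -> : conv e2c e2c n = conv (fun k => (k == 0)%:R + (- 24) * sig K 1 k)
     (fun k => (k == 0)%:R + (- 24) * sig K 1 k) n.
  by apply: eq_bigr => i _; rewrite /e2c !mulNr.
rewrite conv_delta_sig.
have -> : (- 24 : K) ^+ 2 * conv (sig K 1) (sig K 1) n = 48 * (12 * conv (sig K 1) (sig K 1) n) by ring.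
rewrite conv_sigma1 /e2c /e4c; case: n => [|n] /=; ring.
Qed.

(** Coefficient form of 5 (D E2)^2 = D^2 E4 + 10 D^3 E2, which becomes Chazy's equation once E4 is
    replaced by E2^2 - 12 D E2. *)
Lemma conv_theta_e2c n :
  5 * conv (fun k => k%:R * e2c k) (fun k => k%:R * e2c k) n =
  n%:R ^+ 2 * e4c n + 10 * n%:R ^+ 3 * e2c n.
Proof.
have E k : k%:R * e2c k = - 24 * (k%:R * sig K 1 k).
  by rewrite /e2c; case: k => [|k] /=; ring.
have -> : 5 * conv (fun k => k%:R * e2c k) (fun k => k%:R * e2c k) n =
   240 * (12 * conv (fun k => k%:R * sig K 1 k) (fun k => k%:R * sig K 1 k) n).
  rewrite /conv !mulr_sumr; apply: eq_bigr => i _; rewrite !E; ring.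
rewrite conv_nsigma1 /e2c /e4c; case: n => [|n] /=; ring.
Qed.

(* Here P, Q, R are the truncations of E2, E4, E6, the suffix 2 stands for the substitution
   q := q^2, and the error terms vanish up to the order of truncation. *)
Section defects.
Variables P Q R P2 Q2 R2 G err3 err3' delta : {poly K}.
Hypothesis GE : G = 2 * P2 - P.
Hypothesis dQ : 3 * theta Q = P * Q - R.
Hypothesis dR : 2 * theta R = P * R - Q ^+ 2 + err3.
Hypothesis dQ2 : 3 * theta Q2 = 2 * (P2 * Q2 - R2).
Hypothesis dR2 : theta R2 = P2 * R2 - Q2 ^+ 2 + err3'.
Hypothesis dG : 12 * theta G = 4 * P2 ^+ 2 - 4 * Q2 - P ^+ 2 + Q + delta.

Let X1 := 5 * G ^+ 2 - Q - 4 * Q2.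
Let X2 := R + 8 * R2 - 15 * G ^+ 3 + 6 * G * Q.
Let X3 := R - 4 * G ^+ 3 + 3 * G * Q.

Let PE : P = 2 * P2 - G. Proof. by rewrite GE; ring. Qed.

Lemma theta_defect1 : 6 * theta X1 = (2 * P + 7 * G) * X1 + 2 * X2 + 5 * G * delta.
Proof.
rewrite {1}/X1 expr2 !(thetaD, thetaN, thetaM, theta_nat).
set lhs := LHS.
have -> : lhs = 5 * G * (12 * theta G) - 2 * (3 * theta Q) - 8 * (3 * theta Q2).
  by rewrite /lhs; ring.
by rewrite dG dQ dQ2 /X1 /X2 PE; ring.
Qed.

(** The coefficient of X1 contains X1 itself. This quadratic term does not disturb the recursion on
    coefficients, because X1 has constant term 0. *)
Lemma theta_defect2 : 4 * theta X2 =
  2 * (G + P) * X2 + (5 * G ^+ 2 - 2 * Q - 2 * X1) * X1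
   - 10 * G * X3 + (2 * err3 + 32 * err3' + (2 * Q - 15 * G ^+ 2) * delta).
Proof.
rewrite {1}/X2 !exprS expr0 mulr1 !(thetaN, thetaD, thetaM, theta_nat).
set lhs := LHS.
have -> : lhs = 2 * (2 * theta R) + 32 * theta R2
    + (2 * Q - 15 * G ^+ 2) * (12 * theta G) + 8 * G * (3 * theta Q).
  by rewrite /lhs; ring.
by rewrite dG dQ dR dR2 /X1 /X2 /X3 PE; ring.
Qed.

Lemma theta_defect3 : 4 * theta X3 = 2 * (P - 2 * G) * X3 + (Q - 4 * G ^+ 2) * X1
  + (2 * err3 + (Q - 4 * G ^+ 2) * delta).
Proof.
rewrite {1}/X3 !exprS expr0 mulr1 !(thetaN, thetaD, thetaM, theta_nat).
set lhs := LHS.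
have -> : lhs = 2 * (2 * theta R) + (Q - 4 * G ^+ 2) * (12 * theta G)
    + 4 * G * (3 * theta Q).
  by rewrite /lhs; ring.
by rewrite dG dQ dR /X1 /X2 /X3 PE; ring.
Qed.

End defects.

(** The numbers are the constant terms of the coefficients in the system for the defects, E2, E4 and
    G all having constant term 1. Eliminating x2 and x3 leaves 48 n^2 (n - 2) x1 = 0. *)
Lemma defect_system n (x1 x2 x3 : K) :
  6 * (n%:R * x1) = 9 * x1 + 2 * x2 ->
  4 * (n%:R * x2) = 4 * x2 + 3 * x1 - 10 * x3 ->
  4 * (n%:R * x3) = - 2 * x3 - 3 * x1 ->
  (n \in [:: 0; 2]%N -> x1 = 0) -> [/\ x1 = 0, x2 = 0 & x3 = 0].
Proof.
move=> h1 h2 h3 x102.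
have E2 : x2 = (6 * n%:R - 9) / 2 * x1.
  have -> : x2 = (9 * x1 + 2 * x2 - 9 * x1) / 2 by field.
  by rewrite -h1; field.
have nz : 4 * n%:R + 2 != 0 :> K by rewrite -natrM -natrD pnatr_eq0 addn2.
have E3 : x3 = - 3 / (4 * n%:R + 2) * x1.
  apply: (mulfI nz); have -> : (4 * n%:R + 2) * x3 = 4 * (n%:R * x3) + 2 * x3 by ring.
  by rewrite h3; field.
have x10 : x1 = 0.
  have [/x102 //|n02] := boolP (n \in [:: 0; 2]%N).
  have : 48 * n%:R ^+ 2 * (n%:R - 2) * x1 = 0.
    transitivity ((4 * (n%:R * x2) - (4 * x2 + 3 * x1 - 10 * x3)) * (4 * n%:R + 2)).
      by rewrite E2 E3; field.
    by rewrite h2 subrr mul0r.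
  move/eqP; rewrite !mulf_eq0 subr_eq0 eqr_nat !pnatr_eq0 /=.
  by move: n02; rewrite !inE negb_or => /andP[/negPf -> /negPf ->] /= /eqP.
by rewrite E2 E3 x10 !mulr0.
Qed.

(** * Vanishing of the level 2 defects *)

Section elimination.
Variable N : nat.
Local Notation small := (small N).
Local Notation P := (trunc N e2c).
Local Notation Q := (trunc N e4c).
Local Notation D := theta.

(** This is E6 up to truncation, defined through D E4 = (E2 E4 - E6) / 3. *)
Let R := P * Q - 3 * D Q.
Let P2 := P \Po 'X^2.
Let Q2 := Q \Po 'X^2.
Let R2 := R \Po 'X^2.
Let G := 2 * P2 - P.

Let err1 := 12 * D P - P ^+ 2 + Q.
Let err2 := 5 * D P ^+ 2 - D (D Q) - 10 * D (D (D P)).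
Let err3 := 2 * D R - P * R + Q ^+ 2.

Lemma small_err1 : small err1.
Proof.
move=> i iN; rewrite /err1 coefD coefB mulr_natl coefMn coef_theta expr2 coef_truncM //.
by rewrite !coef_trunc // conv_e2c; ring.
Qed.

Lemma theta_trunc u : theta (trunc N u) = trunc N (fun k => k%:R * u k).
Proof.
by apply/polyP => i; rewrite coef_theta !coef_poly; case: ifP; rewrite ?mulr0.
Qed.

Lemma small_err2 : small err2.
Proof.
move=> i iN; rewrite /err2 !coefB !mulr_natl !coefMn !theta_trunc expr2 coef_truncM //.
rewrite !coef_trunc // -[X in X - _ - _]mulr_natl conv_theta_e2c; ring.
Qed.

(** Ramanujan's equation for D E6 follows from the two convolution identities: twice its error is a
    combination of [err1], [err2] and their derivatives, by an identity valid for arbitrary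
    polynomials P and Q. *)
Lemma small_err3 : small err3.
Proof.
apply: (@small_nat N 1).
have -> : 2 * err3 = 12 * (6 * err2 + 5 * D (D err1)) + 10 * P * D err1
    - 20 * D P * err1 + 2 * Q * err1.
  rewrite /err3 /err2 /err1 /R !expr2 !(thetaD, thetaN, thetaM, theta_nat, theta0).
  ring.
have e1 := small_err1; have e2 := small_err2.
apply: smallD; last exact: smallM.
apply: smallB; last exact: smallM.
apply: smallD; last by apply: smallM; apply: small_theta.
apply: smallM; apply: smallD; first exact: smallM.
by apply: smallM; do 2!apply: small_theta.
Qed.

Let err1' := err1 \Po 'X^2.
Let err3' := err3 \Po 'X^2.

Let dP : 12 * D P = P ^+ 2 - Q + err1.
Proof. by rewrite /err1; ring. Qed.

Let dQ : 3 * D Q = P * Q - R.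
Proof. by rewrite /R; ring. Qed.

Let dR : 2 * D R = P * R - Q ^+ 2 + err3.
Proof. by rewrite /err3; ring. Qed.

Let comp_nat n A : (n%:R * A) \Po 'X^2 = n%:R * (A \Po 'X^2).
Proof. by rewrite rmorphM rmorph_nat. Qed.

Let dP2 : 6 * D P2 = P2 ^+ 2 - Q2 + err1'.
Proof.
rewrite /P2 theta_comp /err1' /err1.
rewrite [in RHS]rmorphD [in RHS]rmorphB /= comp_nat rmorphXn /= -/P2 -/Q2; ring.
Qed.

Let dQ2 : 3 * D Q2 = 2 * (P2 * Q2 - R2).
Proof.
rewrite /Q2 theta_comp /R2 /R [in RHS]rmorphB /= comp_nat rmorphM /= -/P2 -/Q2; ring.
Qed.

Let dR2 : D R2 = P2 * R2 - Q2 ^+ 2 + err3'.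
Proof.
rewrite {1}/R2 theta_comp /err3' /err3 [in RHS]rmorphD [in RHS]rmorphB /=.
rewrite comp_nat rmorphXn rmorphM /= -/P2 -/Q2 -/R2; ring.
Qed.

Let delta := 4 * err1' - err1.

Let dG : 12 * D G = 4 * P2 ^+ 2 - 4 * Q2 - P ^+ 2 + Q + delta.
Proof.
rewrite /G thetaB thetaM theta_nat.
have -> : 12 * (0 * P2 + 2 * D P2 - D P) = 4 * (6 * D P2) - 12 * D P by ring.
by rewrite dP2 dP /delta; ring.
Qed.

Let small_delta : small delta.
Proof.
have e1 := small_err1; have e1' := small_comp small_err1.
by apply: smallB => //; apply: smallM.
Qed.

Let X1 := 5 * G ^+ 2 - Q - 4 * Q2.
Let X2 := R + 8 * R2 - 15 * G ^+ 3 + 6 * G * Q.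
Let X3 := R - 4 * G ^+ 3 + 3 * G * Q.

Let dX1 : 6 * D X1 = (2 * P + 7 * G) * X1 + 2 * X2 + 5 * G * delta.
Proof. exact: theta_defect1 dQ dQ2 dG. Qed.

Let dX2 : 4 * D X2 = 2 * (G + P) * X2 + (5 * G ^+ 2 - 2 * Q - 2 * X1) * X1
   - 10 * G * X3 + (2 * err3 + 32 * err3' + (2 * Q - 15 * G ^+ 2) * delta).
Proof. exact: theta_defect2 dQ dR dR2 dG. Qed.

Let dX3 : 4 * D X3 = 2 * (P - 2 * G) * X3 + (Q - 4 * G ^+ 2) * X1
  + (2 * err3 + (Q - 4 * G ^+ 2) * delta).
Proof. exact: theta_defect3 dQ dR dG. Qed.

(** Only the constant term of [A] meets the first coefficient of [B] that may be nonzero; this turns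
    the differential system into one linear system for each degree. *)
Lemma coefM_low A B n : (forall i, (i < n)%N -> B`_i = 0) -> (A * B)`_n = A`_0 * B`_n.
Proof.
move=> b; rewrite coefM big_ord_recl /= subn0 big1 ?addr0 // => i _.
by rewrite /bump /= b ?mulr0 // add1n; have := ltn_ord i; lia.
Qed.

Let coef0 : (2 < N)%N -> [/\ P`_0 = 1, Q`_0 = 1 & G`_0 = 1].
Proof.
move=> N2; have N0 : (0 < N)%N by apply: leq_trans N2.
have P0 : P`_0 = 1 by rewrite coef_trunc // /e2c /= mulr0 subr0.
have P20 : P2`_0 = 1 by rewrite /P2 coef_comp_poly_Xn // dvdn0 div0n.
split => //; first by rewrite coef_trunc // /e4c /= mulr0 addr0.
by rewrite /G coefB mulr_natl coefMn P20 P0; ring.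
Qed.

Let sigmaE k s : sigma s k = sumn [seq (d ^ s)%N | d <- divisors k].
Proof. by rewrite /sigma sumnE big_map. Qed.

Let X1_low : (2 < N)%N -> X1`_0 = 0 /\ X1`_2 = 0.
Proof.
move=> N2; have [P0 Q0 G0] := coef0 N2.
have N0 : (0 < N)%N by apply: leq_trans N2.
have N1 : (1 < N)%N by apply: leq_trans N2.
(* G = 1 + 24 q + 24 q^2 + ... and E4 = 1 + 240 q + 2160 q^2 + ..., so the coefficient of q^2 in X1
   is 5 (48 + 576) - 2160 - 960 = 0. *)
have G1 : G`_1 = 24.
  by rewrite /G coefB mulr_natl coefMn coef_comp_poly_Xn //= coef_trunc //= /e2c /= sigmaE /=; ring.
have G2 : G`_2 = 24.
  by rewrite /G coefB mulr_natl coefMn coef_comp_poly_Xn //= !coef_trunc //= /e2c /= !sigmaE /=; ring.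
have Q20 : Q2`_0 = 1 by rewrite /Q2 coef_comp_poly_Xn // dvdn0 div0n.
have Q22 : Q2`_2 = 240.
  by rewrite /Q2 coef_comp_poly_Xn //= coef_trunc //= /e4c /= sigmaE /=; ring.
have QQ2 : Q`_2 = 2160 by rewrite coef_trunc //= /e4c /= sigmaE /=; ring.
rewrite /X1 !coefB !mulr_natl !coefMn expr2 !coefM !big_ord_recl !big_ord0 /= /bump /=.
by rewrite G0 G1 G2 Q20 Q22 Q0 QQ2; split; ring.
Qed.

Lemma defects_eq0 n : (2 < N)%N -> (n < N)%N -> [/\ X1`_n = 0, X2`_n = 0 & X3`_n = 0].
Proof.
move=> N2; have [P0 Q0 G0] := coef0 N2; have [x10 x12] := X1_low N2.
elim/ltn_ind: n => n IH nN.
have Z1 i : (i < n)%N -> X1`_i = 0 by move=> iN; have [] := IH _ iN (ltn_trans iN nN).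
have Z2 i : (i < n)%N -> X2`_i = 0 by move=> iN; have [] := IH _ iN (ltn_trans iN nN).
have Z3 i : (i < n)%N -> X3`_i = 0 by move=> iN; have [] := IH _ iN (ltn_trans iN nN).
have s1 : small (5 * G * delta) by apply: smallM.
have e1 := small_err1; have e3 := small_err3; have e3' := small_comp e3.
have s2 : small (2 * err3 + 32 * err3' + (2 * Q - 15 * G ^+ 2) * delta).
  by apply: smallD; [apply: smallD|]; apply: smallM.
have s3 : small (2 * err3 + (Q - 4 * G ^+ 2) * delta) by apply: smallD; apply: smallM.
have c0M A B : (A * B)`_0 = A`_0 * B`_0 by rewrite coefM_low.
have c0X A k : (A ^+ k)`_0 = A`_0 ^+ k.
  by elim: k => [|k IHk]; rewrite ?expr0 ?coef1 // !exprS c0M IHk.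
have cn k A : (k%:R * A)`_n = k%:R * A`_n by rewrite coefM_natl.
have h1 : 6 * (n%:R * X1`_n) = 9 * X1`_n + 2 * X2`_n.
  rewrite -coef_theta -cn dX1 coefD s1 // addr0 coefD (coefM_low _ Z1) coefM_natl.
  by rewrite coefD !coefM_natl P0 G0; ring.
have h2 : 4 * (n%:R * X2`_n) = 4 * X2`_n + 3 * X1`_n - 10 * X3`_n.
  rewrite -coef_theta -cn dX2 coefD s2 // addr0 coefB coefD (coefM_low _ Z1) (coefM_low _ Z2) (coefM_low _ Z3).
  have -> : (2 * (G + P))`_0 = 4 by rewrite coefM_natl coefD G0 P0; ring.
  have -> : (5 * G ^+ 2 - 2 * Q - 2 * X1)`_0 = 3.
    by rewrite coefB coefB !coefM_natl c0X G0 Q0 x10; ring.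
  by rewrite coefM_natl G0; ring.
have h3 : 4 * (n%:R * X3`_n) = - 2 * X3`_n - 3 * X1`_n.
  rewrite -coef_theta -cn dX3 coefD s3 // addr0 coefD (coefM_low _ Z1) (coefM_low _ Z3).
  have -> : (2 * (P - 2 * G))`_0 = - 2 by rewrite coefM_natl coefB coefM_natl G0 P0; ring.
  by rewrite coefB coefM_natl c0X G0 Q0; ring.
by apply: (defect_system h1 h2 h3); rewrite !inE => /pred2P[->|->].
Qed.

End elimination.

Lemma trunc_dil N u : trunc N u \Po 'X^2 = trunc (N * 2)%N (dil 2 u).
Proof.
apply/polyP => i; rewrite coef_comp_poly_Xn // !coef_poly /dil.
by case: ifP => d2; rewrite ?ltn_divLR //; case: ifP.
Qed.

Lemma coef_trunc_dil N u i : (i < N)%N -> (trunc N u \Po 'X^2)`_i = dil 2 u i.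
Proof.
by move=> iN; rewrite trunc_dil coef_trunc // (leq_trans iN) // leq_pmulr.
Qed.

Lemma coefM_low_eq N A B u v i : (i < N)%N ->
  (forall j, (j < N)%N -> A`_j = u j) -> (forall j, (j < N)%N -> B`_j = v j) ->
  (A * B)`_i = conv u v i.
Proof.
move=> iN Au Bv; rewrite coefM; apply: eq_bigr => j _.
by rewrite Au ?Bv ?(leq_ltn_trans (leq_subr _ _) iN) // (leq_ltn_trans _ iN) // -ltnS.
Qed.

Section level2.
Variable n : nat.
(** Large enough for the degree n and for the two coefficients computed by hand, which require 2 <
    N. *)
Let N := n.+3.
Let P := trunc N e2c.
Let Q := trunc N e4c.
Let Q2 := Q \Po 'X^2.
Let G := 2 * (P \Po 'X^2) - P.

Let coefG i : (i < N)%N -> G`_i = gc i.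
Proof.
by move=> iN; rewrite /G coefB mulr_natl coefMn coef_trunc_dil // coef_trunc // -mulr_natl.
Qed.

Let G2E i : (i < N)%N -> 5 * (G ^+ 2)`_i = e4c i + 4 * dil 2 e4c i.
Proof.
move=> iN; have [+ _ _] := @defects_eq0 N i isT iN.
rewrite -/P -/Q -/G -/Q2 !coefB !coefM_natl => /eqP.
by rewrite subr_eq0 subr_eq coef_trunc // coef_trunc_dil // => /eqP ->; rewrite addrC.
Qed.

Lemma conv_gc : 5 * conv gc gc n = e4c n + 4 * dil 2 e4c n.
Proof.
have nN : (n < N)%N by rewrite /N; lia.
by rewrite -G2E // expr2 (@coefM_low_eq N _ _ gc gc).
Qed.

(** This is 5 X3 = 0, where 5 G^3 is written as G times 5 G^2 = E4 + 4 E4(2 tau) in order to avoid a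
    triple convolution. *)
Lemma conv_e2c_e4c : 5 * conv e2c e4c n - 15 * n%:R * e4c n =
  4 * conv gc (fun k => e4c k + 4 * dil 2 e4c k) n - 15 * conv gc e4c n.
Proof.
have nN : (n < N)%N by rewrite /N; lia.
have [_ _] := @defects_eq0 N n isT nN.
rewrite -/P -/Q -/G -/Q2 => /(congr1 (fun x => 5 * x)); rewrite mulr0.
have -> : 4 * G ^+ 3 = 4 * (G * G ^+ 2) by rewrite -exprS.
have -> : 3 * G * Q = 3 * (G * Q) by rewrite mulrA.
rewrite coefD coefB coefB !coefM_natl coef_theta (coef_trunc e4c) //.
rewrite (@coef_truncM N) // (@coefM_low_eq N G Q gc e4c) //; last by move=> j jN; exact: coef_trunc.
have <- : 5 * (G * G ^+ 2)`_n = conv gc (fun k => e4c k + 4 * dil 2 e4c k) n.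
  rewrite -coefM_natl mulrCA (@coefM_low_eq N _ _ gc (fun k => e4c k + 4 * dil 2 e4c k)) //.
  by move=> j jN; rewrite coefM_natl G2E.
by move=> H; apply/eqP; rewrite -subr_eq0 -[X in _ == X]H; apply/eqP; ring.
Qed.

End level2.

End eisenstein_coefficients.

(** * Complex derivatives and power series *)

Section complex_norm.
Context {R : realType}.
Local Notation C := (Cx R).
Implicit Types (z w : C) (x y : R).

(* The norm of [Cx R] takes its values in [Cx R]; [nr] is its real-valued version. *)
Definition nr (z : C) : R := re_part `|z|.

Lemma normE z : `|z| = ofR (nr z).
Proof. by rewrite /nr /re_part /ofR; case: z => a b; rewrite normc_def. Qed.

Lemma nrE z : nr z = Num.sqrt (re_part z ^+ 2 + im_part z ^+ 2).
Proof. by rewrite /nr /re_part /im_part normc_def. Qed.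

Lemma ofR_inj : injective (@ofR R).
Proof. by move=> x y []. Qed.

Lemma ler_ofR x y : (ofR x <= ofR y) = (x <= y).
Proof. exact: lecR. Qed.

Lemma ltr_ofR x y : (ofR x < ofR y) = (x < y).
Proof. exact: ltcR. Qed.

Lemma ofRD x y : ofR (x + y) = ofR x + ofR y.
Proof. exact: rmorphD. Qed.

Lemma ofRM x y : ofR (x * y) = ofR x * ofR y.
Proof. exact: rmorphM. Qed.

Lemma nrM z w : nr (z * w) = nr z * nr w.
Proof. by apply: ofR_inj; rewrite ofRM -!normE normrM. Qed.

Lemma nrD z w : nr (z + w) <= nr z + nr w.
Proof. by rewrite -ler_ofR ofRD -!normE ler_normD. Qed.

Lemma nrN z : nr (- z) = nr z.
Proof. by rewrite /nr normrN. Qed.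

Lemma nrB z w : nr (z - w) = nr (w - z).
Proof. by rewrite /nr distrC. Qed.

Lemma nr_ge0 z : 0 <= nr z.
Proof. by rewrite nrE sqrtr_ge0. Qed.

Lemma nr0 : nr 0 = 0.
Proof. by rewrite /nr normr0. Qed.

Lemma nr1 : nr 1 = 1.
Proof. by rewrite /nr normr1. Qed.

Lemma nr_eq0 z : (nr z == 0) = (z == 0).
Proof. by rewrite -[RHS]normr_eq0 normE -(inj_eq ofR_inj). Qed.

Lemma nr_gt0 z : (0 < nr z) = (z != 0).
Proof. by rewrite lt_def nr_ge0 andbT nr_eq0. Qed.

Lemma nrX z n : nr (z ^+ n) = nr z ^+ n.
Proof. by elim: n => [|n IH]; rewrite ?expr0 ?nr1 // !exprS nrM IH. Qed.

Lemma nrV z : nr z^-1 = (nr z)^-1.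
Proof.
have [->|z0] := eqVneq z 0; first by rewrite invr0 nr0 invr0.
have nz : nr z != 0 by rewrite nr_eq0.
by apply: (mulfI nz); rewrite -nrM !divff // nr1.
Qed.

Lemma nr_ofR x : nr (ofR x) = `|x|.
Proof. by rewrite nrE /re_part /im_part /= expr0n addr0 sqrtr_sqr. Qed.

Lemma nr_nat n : nr n%:R = n%:R.
Proof. by rewrite -[X in nr X](rmorph_nat (real_complex R)) nr_ofR normr_nat. Qed.

Lemma nr_imagi : nr imagi = 1.
Proof. by rewrite nrE /re_part /im_part /= expr0n add0r expr1n sqrtr1. Qed.

Lemma nrD_le z w : nr z - nr w <= nr (z + w).
Proof. by have := nrD (z + w) (- w); rewrite addrK nrN; lra. Qed.

Lemma nr_sum I (r : seq I) (P : pred I) (F : I -> C) :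
  nr (\sum_(i <- r | P i) F i) <= \sum_(i <- r | P i) nr (F i).
Proof.
elim/big_rec2: _ => [|i y x _ h]; first by rewrite nr0.
by apply: (le_trans (nrD _ _)); rewrite lerD2l.
Qed.

Lemma re_le_nr z : `|re_part z| <= nr z.
Proof.
by rewrite nrE -sqrtr_sqr ler_wsqrtr // lerDl sqr_ge0.
Qed.

Lemma im_le_nr z : `|im_part z| <= nr z.
Proof.
by rewrite nrE -sqrtr_sqr ler_wsqrtr // lerDr sqr_ge0.
Qed.

Lemma CE z : z = ofR (re_part z) + imagi * ofR (im_part z).
Proof. by rewrite [LHS]complexE. Qed.

Lemma nr_le_reim z : nr z <= `|re_part z| + `|im_part z|.
Proof. by rewrite {1}[z]CE (le_trans (nrD _ _)) // nrM nr_imagi mul1r !nr_ofR. Qed.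

Lemma ofR_gt0 (e : C) : 0 < e -> exists2 x : R, 0 < x & e = ofR x.
Proof.
move=> e0; exists (re_part e).
  by move: e0; rewrite ltcE /re_part => /andP[].
by move: e0; rewrite ltcE /= => /andP[/eqP h _]; rewrite [LHS]CE /im_part h /ofR /= mulr0 addr0.
Qed.

Lemma re_partD z w : re_part (z + w) = re_part z + re_part w.
Proof. by case: z w => a b []. Qed.
Lemma im_partD z w : im_part (z + w) = im_part z + im_part w.
Proof. by case: z w => a b []. Qed.
Lemma re_partM z w : re_part (z * w) = re_part z * re_part w - im_part z * im_part w.
Proof. by case: z w => a b []. Qed.
Lemma im_partM z w : im_part (z * w) = re_part z * im_part w + im_part z * re_part w.
Proof. by case: z w => a b []. Qed.
Lemma re_partN z : re_part (- z) = - re_part z.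
Proof. by case: z. Qed.
Lemma im_partN z : im_part (- z) = - im_part z.
Proof. by case: z. Qed.

Lemma re_ofR x : re_part (ofR x) = x. Proof. by []. Qed.
Lemma im_ofR x : im_part (ofR x) = 0. Proof. by []. Qed.
Lemma re_imagi : re_part (imagi : C) = 0. Proof. by []. Qed.
Lemma im_imagi : im_part (imagi : C) = 1. Proof. by []. Qed.

Lemma cvgCP (T : Type) (F : set_system T) {FF : Filter F} (f : T -> C) (l : C) :
  f @ F --> l <-> forall e : R, 0 < e -> \forall x \near F, nr (l - f x) < e.
Proof.
split=> [/cvgrPdist_lt h e e0|h].
  have e0' : 0 < ofR e by rewrite -[0]/(ofR 0) ltr_ofR.
  by apply: filterS (h _ e0') => x; rewrite normE ltr_ofR.
apply/cvgrPdist_lt => _ /ofR_gt0[e e0 ->].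
by apply: filterS (h _ e0) => x; rewrite normE ltr_ofR.
Qed.

Lemma cvgCPle (T : Type) (F : set_system T) {FF : Filter F} (f : T -> C) (l : C) :
  f @ F --> l <-> forall e : R, 0 < e -> \forall x \near F, nr (l - f x) <= e.
Proof.
split=> [/cvgCP h e e0|h]; first by apply: filterS (h _ e0) => x /ltW.
apply/cvgCP => e e0; have e2 : 0 < e / 2 by rewrite divr_gt0.
by apply: filterS (h _ e2) => x /le_lt_trans; apply; lra.
Qed.

Lemma nbhsCP z (A : set C) :
  nbhs z A <-> exists2 d : R, 0 < d & forall w, nr (w - z) < d -> A w.
Proof.
split=> [/nbhs_ballP[e /= /ofR_gt0[d d0 ->] h]|[d d0 h]].
  exists d => // w wd; apply: h; rewrite -ball_normE /ball_ /= distrC normE ltr_ofR //.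
apply/nbhs_ballP; exists (ofR d) => /=; first by rewrite -[0]/(ofR 0) ltr_ofR.
by move=> w; rewrite -ball_normE /ball_ /= distrC normE ltr_ofR; apply: h.
Qed.

End complex_norm.

Section complex_derivative.
Context {R : realType}.
Local Notation C := (Cx R).
Implicit Types (f g : C -> C) (z w l h : C).

Definition CD f z l := is_derive (z : C) (1 : C) f l.

(** Multiplying out the difference quotient removes the division, so that h = 0 needs no separate
    treatment later. *)
Lemma CDP f z l : CD f z l <-> forall e : R, 0 < e -> exists2 d : R, 0 < d &
  forall h, nr h < d -> nr (f (z + h) - f z - l * h) <= e * nr h.
Proof.
pose q h := h^-1 *: ((f \o shift z) (h *: (1 : C)) - f z).
have qE h : h != 0 -> nr (l - q h) * nr h = nr (f (z + h) - f z - l * h).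
  move=> h0; rewrite -nrM -[RHS]nrN; congr (nr _); rewrite /q /=.
  rewrite mulrBl /GRing.scale /= mulr1 [h + z]addrC mulrAC mulVf // mul1r; ring.
have aux : q @ 0^' --> l <-> forall e : R, 0 < e -> exists2 d : R, 0 < d &
  forall h, nr h < d -> nr (f (z + h) - f z - l * h) <= e * nr h.
  split=> [/cvgCPle H e e0|H].
    have /nbhsCP[d d0 hd] := H e e0; exists d => // h hhd.
    have [->|h0] := eqVneq h 0; first by rewrite addr0 subrr mulr0 subr0 nr0 mulr0.
    by rewrite -qE // ler_wpM2r ?nr_ge0 // hd // subr0.
  apply/cvgCPle => e e0; have [d d0 hd] := H e e0.
  apply/nbhsCP; exists d => // h; rewrite subr0 => hhd h0.
  have := hd _ hhd; rewrite -qE // ler_pM2r //; by rewrite nr_gt0.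
split=> [[df dv]|H].
  by apply/aux; rewrite -dv; exact: df.
have ql : q @ 0^' --> l by apply/aux.
by split; [apply: cvgP ql | apply: cvg_lim ql].
Qed.

Lemma CD_quadratic f z l (M d : R) : 0 < d ->
  (forall h, nr h < d -> nr (f (z + h) - f z - l * h) <= M * nr h ^+ 2) -> CD f z l.
Proof.
move=> d0 H; apply/CDP => e e0.
pose M' := `|M| + 1.
have M0 : 0 < M' by rewrite /M' ltr_wpDl.
exists (Num.min d (e / M')); first by rewrite lt_min d0 divr_gt0.
move=> h; rewrite lt_min => /andP[hd he]; apply: (le_trans (H _ hd)).
rewrite expr2 mulrA ler_wpM2r ?nr_ge0 //.
apply: le_trans (_ : M' * nr h <= _).
  by rewrite ler_wpM2r ?nr_ge0 // (le_trans (ler_norm _)) // lerDl.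
by rewrite mulrC -ler_pdivlMr // ltW.
Qed.

Lemma CD_unique f z l l' : CD f z l -> CD f z l' -> l = l'.
Proof. by move=> [_ <-] [_ <-]. Qed.

Lemma CD_eq f z l l' : CD f z l -> l = l' -> CD f z l'.
Proof. by move=> ? <-. Qed.

Lemma CD_cst z (c : C) : CD (fun=> c) z 0.
Proof. exact: is_derive_cst. Qed.

Lemma CD_id z : CD (fun x => x) z 1.
Proof. exact: is_derive_id. Qed.

Lemma CD_add f g z l l' : CD f z l -> CD g z l' -> CD (fun x => f x + g x) z (l + l').
Proof. exact: is_deriveD. Qed.

Lemma CD_opp f z l : CD f z l -> CD (fun x => - f x) z (- l).
Proof. exact: is_deriveN. Qed.

Lemma CD_sub f g z l l' : CD f z l -> CD g z l' -> CD (fun x => f x - g x) z (l - l').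
Proof. by move=> ? /CD_opp; apply: CD_add. Qed.

Lemma CD_mul f g z l l' : CD f z l -> CD g z l' ->
  CD (fun x => f x * g x) z (l * g z + f z * l').
Proof.
move=> df dg; have H := @is_deriveM C C f g z 1 l l' df dg.
by apply: (CD_eq H); rewrite /GRing.scale /= addrC [g z * _]mulrC.
Qed.

Lemma CD_scale (c : C) f z l : CD f z l -> CD (fun x => c * f x) z (c * l).
Proof. by move=> /(CD_mul (CD_cst z c)) H; apply: (CD_eq H); rewrite mul0r add0r. Qed.

Lemma CD_near f g z l : (\near z, f z = g z) -> CD f z l -> CD g z l.
Proof. exact: near_eq_is_derive. Qed.

Lemma CD_cvg f z l : CD f z l -> f @ z --> f z.
Proof. by move=> [/derivable1_diffP/differentiable_continuous]. Qed.

Lemma CD_comp f g z l l' : CD f z l -> CD g (f z) l' -> CD (fun x => g (f x)) z (l' * l).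
Proof.
move=> /CDP df /CDP dg; apply/CDP => e e0.
have L0 := nr_ge0 l; have L0' := nr_ge0 l'.
(* [e1] and [e2] make each of the two remainders e1 |k| and |l'| e2 |h| at most e |h| / 2; adding 1
   keeps the denominators positive. *)
pose e1 := e / (2 * (nr l + 1)); have e10 : 0 < e1 by rewrite divr_gt0 // mulr_gt0 //; lra.
pose e2 := Num.min 1 (e / (2 * (nr l' + 1))).
have e20 : 0 < e2 by rewrite lt_min ltr01 /= divr_gt0 // mulr_gt0 //; lra.
have [d1 d10 H1] := dg _ e10; have [d2 d20 H2] := df _ e20.
exists (Num.min d2 (d1 / (nr l + 1))); first by rewrite lt_min d20 /= divr_gt0 //; lra.
move=> h; rewrite lt_min => /andP[/H2 hf hd].
pose k := f (z + h) - f z.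
have kh : nr k <= (nr l + 1) * nr h.
  have -> : k = l * h + (k - l * h) by rewrite addrC subrK.
  apply: (le_trans (nrD _ _)); rewrite nrM mulrDl lerD2l (le_trans hf) // ler_wpM2r ?nr_ge0 //.
  by rewrite /e2 ge_min lexx.
have kd : nr k < d1.
  by apply: (le_lt_trans kh); rewrite mulrC -ltr_pdivlMr //; lra.
have fk : f z + k = f (z + h) by rewrite /k addrC subrK.
have := H1 _ kd; rewrite fk => hg.
have -> : g (f (z + h)) - g (f z) - l' * l * h =
   (g (f (z + h)) - g (f z) - l' * k) + l' * (k - l * h) by ring.
apply: (le_trans (nrD _ _)); rewrite nrM.
have h1 : e1 * nr k <= e / 2 * nr h.
  apply: (le_trans (ler_wpM2l (ltW e10) kh)); rewrite mulrA ler_wpM2r ?nr_ge0 //.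
  rewrite /e1 -mulrA invfM -[X in _ * X]mulrA mulVf ?mulr1 //.
  by rewrite gt_eqF //; lra.
have h2 : nr l' * nr (k - l * h) <= e / 2 * nr h.
  apply: (le_trans (ler_wpM2l L0' hf)); rewrite mulrA ler_wpM2r ?nr_ge0 //.
  apply: le_trans (_ : (nr l' + 1) * (e / (2 * (nr l' + 1))) <= _).
    apply: ler_pM => //; [exact: ltW | by rewrite lerDl | by rewrite /e2 ge_min lexx orbT].
  rewrite invfM mulrCA [_ * (_ / _)]mulrCA divff ?mulr1 //.
  by rewrite gt_eqF //; lra.
lra.
Qed.

Lemma CD_inv f z l : CD f z l -> f z != 0 -> CD (fun x => (f x)^-1) z (- l / f z ^+ 2).
Proof.
move=> [df <-] fz; split; first exact: derivableV.
rewrite [LHS](deriveV fz df) /GRing.scale /= mulNr mulNr mulrC //.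
Qed.

Lemma CD_exp f z l n : CD f z l -> CD (fun x => f x ^+ n) z (n%:R * f z ^+ n.-1 * l).
Proof.
move=> df; elim: n => [|n IH].
  by apply: (CD_eq (CD_cst z 1)); rewrite !mul0r.
have := CD_mul df IH; rewrite (_ : (fun _ => _) = (fun x => f x ^+ n.+1)); last first.
  by apply/funext => x; rewrite exprS.
move=> H; apply: (CD_eq H); rewrite /= -natr1; case: n {IH H} => [|n] /=; rewrite ?exprS; ring.
Qed.

End complex_derivative.

(** * Geometric bounds and termwise differentiation *)

Section series.
Context {R : realType}.
Local Notation C := (Cx R).
Implicit Types (u v : nat -> C) (z w : C) (r s : R).

(** Bernoulli's inequality gives rho^(-n) >= 1 + n d with d = 1 / rho - 1, hence n rho^n <= 1 /
    d. *)
Lemma nat_geom_bounded (rho : R) : 0 <= rho < 1 -> exists K : R, forall n, n%:R * rho ^+ n <= K.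
Proof.
case/andP=> r0 r1; have [->|rn0] := eqVneq rho 0.
  by exists 1 => -[|n]; rewrite ?mul0r // expr0n mulr0.
have rp : 0 < rho by rewrite lt_def rn0.
pose d := rho^-1 - 1; have d0 : 0 < d by rewrite subr_gt0 invf_gt1.
have bern n : 1 + n%:R * d <= (rho^-1) ^+ n.
  have -> : rho^-1 = 1 + d by rewrite /d; ring.
  elim: n => [|n IH]; first by rewrite mul0r addr0 expr0.
  rewrite exprS -natr1; have : 0 <= n%:R * d * d by rewrite !mulr_ge0 ?(ltW d0).
  have : (1 + d) * (1 + n%:R * d) <= (1 + d) * (1 + d) ^+ n by rewrite ler_wpM2l //; lra.
  lra.
exists d^-1 => n; have := bern n; rewrite exprVn => h.
have rn : 0 < rho ^+ n by rewrite exprn_gt0.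
have := ler_wpM2r (ltW rn) h; rewrite mulVf ?gt_eqF // => h'.
by rewrite -[d^-1]mul1r ler_pdivlMr //; lra.
Qed.

(** Any ratio strictly between rho and 1 absorbs the factor n; the midpoint is taken. *)
Lemma nat_geom_geom (rho : R) : 0 <= rho < 1 -> exists (K sg : R),
  [/\ 0 <= K, 0 <= sg < 1 & forall n, n%:R * rho ^+ n <= K * sg ^+ n].
Proof.
case/andP=> r0 r1; pose sg := (1 + rho) / 2.
have s0 : 0 < sg by rewrite /sg; lra.
have s1 : sg < 1 by rewrite /sg; lra.
have [|K HK] := @nat_geom_bounded (rho / sg).
  by rewrite divr_ge0 ?(ltW s0) //= ltr_pdivrMr // mul1r /sg; lra.
exists K, sg; split; last 1 first.
- by move=> n; rewrite -ler_pdivrMr ?exprn_gt0 // -mulrA -expr_div_n.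
- by have := HK 0; rewrite mul0r.
- by rewrite (ltW s0).
Qed.

Lemma geom_cvg0 (K sg e : R) : 0 <= sg < 1 -> 0 < e -> \forall n \near \oo, K * sg ^+ n <= e.
Proof.
case/andP=> s0 s1 e0.
have : geometric K sg @ \oo --> (0 : R) by apply: cvg_geometric; rewrite ger0_norm.
move/cvgrPdist_le => /(_ _ e0); apply: filterS => n; rewrite sub0r normrN.
exact: le_trans (ler_norm _).
Qed.

Lemma cvg_reim u (a b : R) : (fun n => re_part (u n)) @ \oo --> a ->
  (fun n => im_part (u n)) @ \oo --> b -> u @ \oo --> (ofR a + imagi * ofR b : C).
Proof.
move=> ua ub; apply/cvgCP => e e0; have e2 : 0 < e / 2 by lra.
move/cvgrPdist_lt : ua => /(_ _ e2) ua; move/cvgrPdist_lt : ub => /(_ _ e2) ub.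
near=> n; apply: (le_lt_trans (nr_le_reim _)).
rewrite re_partD im_partD re_partN im_partN !re_partD !im_partD re_partM im_partM.
rewrite !(re_ofR, im_ofR, re_imagi, im_imagi, mul0r, mul1r, mulr0, add0r, addr0, subr0).
have h1 : `|a - re_part (u n)| < e / 2 by near: n.
have h2 : `|b - im_part (u n)| < e / 2 by near: n.
lra.
Unshelve. all: by end_near. Qed.

Definition geom_bounded u := exists (K rho : R),
  [/\ 0 <= K, 0 <= rho < 1 & forall n, nr (u n) <= K * rho ^+ n].

Lemma geom_series_cvg u : geom_bounded u -> cvg (series u @ \oo).
Proof.
move=> [K [rho [K0 /andP[r0 r1] H]]].
have real_cvg (a : nat -> R) : (forall n, `|a n| <= K * rho ^+ n) -> cvgn (series a).
  move=> Ha; apply: normed_cvg; apply: (@series_le_cvg _ _ (geometric K rho)) => [n||n|].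
  - exact: normr_ge0.
  - by move=> n; rewrite geometric_ge0.
  - exact: Ha.
  - by apply: is_cvg_geometric_series; rewrite ger0_norm.
have /cvg_ex[a ha] := real_cvg (fun n => re_part (u n)) (fun n => le_trans (re_le_nr _) (H n)).
have /cvg_ex[b hb] := real_cvg (fun n => im_part (u n)) (fun n => le_trans (im_le_nr _) (H n)).
have reS n : re_part (series u n) = series (fun n => re_part (u n)) n.
  by rewrite /series /=; elim/big_rec2: _ => // i x y _ <-; rewrite re_partD.
have imS n : im_part (series u n) = series (fun n => im_part (u n)) n.
  by rewrite /series /=; elim/big_rec2: _ => // i x y _ <-; rewrite im_partD.
apply: (cvgP _ (@cvg_reim _ a b _ _)).
  by rewrite (_ : (fun _ => _) = series (fun n => re_part (u n))) //; apply/funext.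
by rewrite (_ : (fun _ => _) = series (fun n => im_part (u n))) //; apply/funext.
Qed.

Lemma nr_lim_le u l (M : R) : u @ \oo --> l -> (forall n, nr (u n) <= M) -> nr l <= M.
Proof.
move=> /cvgCPle ul uM; apply/ler_addgt0Pr => e e0.
have [n _ hn] := ul _ e0; have := hn n (leqnn _) => h.
have -> : l = (l - u n) + u n by rewrite subrK.
by rewrite (le_trans (nrD _ _)) // addrC lerD.
Qed.

Lemma geom_series_bounded u : geom_bounded u -> exists M : R,
  forall n, \sum_(0 <= k < n) nr (u k) <= M.
Proof.
move=> [K [rho [K0 /andP[r0 r1] H]]]; exists (K / (1 - rho)) => n.
apply: le_trans (_ : \sum_(0 <= k < n) K * rho ^+ k <= _); first exact: ler_sum.
have -> : \sum_(0 <= k < n) K * rho ^+ k = K * (1 - rho ^+ n) / (1 - rho).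
  by have := @geometric_seriesE R K rho; rewrite lt_eqF // => /(_ isT) /(congr1 (fun f => f n)).
rewrite ler_pdivrMr ?subr_gt0 // divfK ?gt_eqF ?subr_gt0 //.
by rewrite ler_piMr // gerBl exprn_ge0.
Qed.

(* The power series with coefficients [u] has radius of convergence at least [r]. *)
Definition rad r u := forall s, 0 <= s < r -> exists K : R, forall n, nr (u n) * s ^+ n <= K.

Definition psum u z : C := lim (series (fun n => u n * z ^+ n) @ \oo).

Lemma rad_geom r u z : rad r u -> nr z < r -> geom_bounded (fun n => u n * z ^+ n).
Proof.
move=> ru zr; pose s := (nr z + r) / 2.
have zs : nr z < s by rewrite /s; lra.
have s0 : 0 < s by apply: le_lt_trans zs; exact: nr_ge0.
have [|K HK] := ru s; first by rewrite (ltW s0) /s; lra.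
exists K, (nr z / s); split.
- by have := HK 0; rewrite expr0 mulr1; apply: le_trans; exact: nr_ge0.
- by rewrite divr_ge0 ?nr_ge0 ?(ltW s0) //= ltr_pdivrMr // mul1r.
- move=> n; rewrite nrM nrX expr_div_n mulrA ler_pdivlMr ?exprn_gt0 //.
  by rewrite mulrAC ler_wpM2r // exprn_ge0 // nr_ge0.
Qed.

Lemma psum_cvg r u z : rad r u -> nr z < r ->
  series (fun n => u n * z ^+ n) @ \oo --> psum u z.
Proof. by move=> ru zr; exact: geom_series_cvg (rad_geom ru zr). Qed.

Lemma rad_nat r u : rad r u -> rad r (fun n => n%:R * u n).
Proof.
move=> ru s /andP[s0 sr]; have [t st tr] : exists2 t, s < t & t < r.
  by exists ((s + r) / 2); lra.
have t0 : 0 < t by apply: le_lt_trans st.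
have [|K HK] := ru t; first by rewrite (ltW t0).
have [|L HL] := @nat_geom_bounded (s / t).
  by rewrite divr_ge0 ?(ltW t0) //= ltr_pdivrMr // mul1r.
have K0 : 0 <= K by have := HK 0; rewrite expr0 mulr1; apply: le_trans; exact: nr_ge0.
exists (K * L) => n; rewrite nrM nr_nat.
have -> : n%:R * nr (u n) * s ^+ n = (nr (u n) * t ^+ n) * (n%:R * (s / t) ^+ n).
  have tn : t ^+ n != 0 by rewrite expf_neq0 // gt_eqF.
  by rewrite expr_div_n; move: (t ^+ n) (s ^+ n) tn => a b tn; field.
apply: ler_pM => //; first by rewrite mulr_ge0 ?nr_ge0 ?exprn_ge0 // ltW.
by rewrite mulr_ge0 // exprn_ge0 // divr_ge0 // ltW.
Qed.

Lemma rad_shift r u : rad r u -> rad r (fun n => u n.+1).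
Proof.
move=> ru s /andP[s0 sr]; pose t := (s + r) / 2.
have st : s < t by rewrite /t; lra.
have t0 : 0 < t by apply: le_lt_trans st.
have [|K HK] := ru t; first by rewrite (ltW t0) /t; lra.
exists (K / t) => n; rewrite ler_pdivlMr // (le_trans _ (HK n.+1)) //.
by rewrite exprSr mulrA ler_wpM2r ?(ltW t0) // ler_wpM2l ?nr_ge0 // lerXn2r ?nnegrE // ltW.
Qed.

Lemma rad_le r u v (c : R) : rad r v -> 0 <= c -> (forall n, nr (u n) <= c * nr (v n)) -> rad r u.
Proof.
move=> rv c0 uv s sr; have [K HK] := rv s sr; exists (c * K) => n.
case/andP: sr => s0 _; apply: le_trans (_ : c * nr (v n) * s ^+ n <= _).
  by rewrite ler_wpM2r ?exprn_ge0.
by rewrite -mulrA ler_wpM2l.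
Qed.

Lemma rad_add r u v : rad r u -> rad r v -> rad r (fun n => u n + v n).
Proof.
move=> ru rv s sr; have [K HK] := ru s sr; have [L HL] := rv s sr.
exists (K + L) => n; case/andP: sr => s0 _.
apply: le_trans (_ : (nr (u n) + nr (v n)) * s ^+ n <= _).
  by rewrite ler_wpM2r ?exprn_ge0 // nrD.
by rewrite mulrDl lerD.
Qed.

Lemma rad_scale r u (c : C) : rad r u -> rad r (fun n => c * u n).
Proof. by move=> ru; apply: (rad_le ru (nr_ge0 c)) => n; rewrite nrM. Qed.

Definition der u n := n.+1%:R * u n.+1.

Lemma rad_der r u : rad r u -> rad r (der u).
Proof. by move=> /rad_nat/rad_shift. Qed.

Lemma psumD r u v z : rad r u -> rad r v -> nr z < r ->
  psum (fun n => u n + v n) z = psum u z + psum v z.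
Proof.
move=> ru rv zr; apply: cvg_lim => //.
rewrite (_ : series _ = series (fun n => u n * z ^+ n) + series (fun n => v n * z ^+ n)).
  by apply: cvgD; exact: psum_cvg zr.
by rewrite -seriesD; congr series; apply/funext => n; rewrite mulrDl.
Qed.

Lemma psumZ r u (c : C) z : rad r u -> nr z < r ->
  psum (fun n => c * u n) z = c * psum u z.
Proof.
move=> ru zr; apply: cvg_lim => //.
rewrite (_ : series _ = c *: series (fun n => u n * z ^+ n)).
  by apply: cvgZl_tmp; exact: psum_cvg zr.
by rewrite -seriesZ; congr series; apply/funext => n; rewrite -mulrA.
Qed.

(** The factor s^2 on the left replaces the s^(n - 2) of the usual remainder and avoids negative
    exponents; n^2 is a rough constant for which the induction only needs n^2 + n <= (n + 1)^2. *)
Lemma pow_taylor z h (s : R) n : 0 < s -> nr z <= s -> nr (z + h) <= s ->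
  s ^+ 2 * nr ((z + h) ^+ n - z ^+ n - n%:R * z ^+ n.-1 * h) <= n%:R ^+ 2 * s ^+ n * nr h ^+ 2.
Proof.
move=> s0 zs zhs; elim: n => [|n IH].
  by rewrite expr0n /= !mul0r !expr0 subrr subr0 nr0 mulr0.
have -> : (z + h) ^+ n.+1 - z ^+ n.+1 - n.+1%:R * z ^+ n * h =
    (z + h) * ((z + h) ^+ n - z ^+ n - n%:R * z ^+ n.-1 * h) + n%:R * z ^+ n.-1 * h ^+ 2.
  by case: n {IH} => [|n] /=; rewrite ?exprS -?natr1; ring.
set E := (X in (z + h) * X); rewrite -/E in IH.
have h1 : s ^+ 2 * nr ((z + h) * E) <= s * (n%:R ^+ 2 * s ^+ n * nr h ^+ 2).
  rewrite nrM mulrCA; apply: ler_pM; [exact: nr_ge0 | | exact: zhs | exact: IH].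
  by rewrite mulr_ge0 ?nr_ge0 // exprn_ge0 // ltW.
have h2 : s ^+ 2 * nr (n%:R * z ^+ n.-1 * h ^+ 2) <= n%:R * s ^+ n.+1 * nr h ^+ 2.
  rewrite nrM nrX nrM nrX nr_nat mulrA ler_wpM2r ?exprn_ge0 ?nr_ge0 //.
  case: n {IH E h1} => [|n] /=; first by rewrite !mul0r mulr0.
  rewrite mulrCA ler_wpM2l // -[n.+2]addn2 exprD mulrC ler_wpM2r ?exprn_ge0 ?(ltW s0) //.
  by rewrite lerXn2r ?nnegrE ?nr_ge0 // ltW.
apply: le_trans (_ : s ^+ 2 * (nr ((z + h) * E) + nr (n%:R * z ^+ n.-1 * h ^+ 2)) <= _).
  by rewrite ler_wpM2l ?nrD // exprn_ge0 // ltW.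
rewrite mulrDr; apply: (le_trans (lerD h1 h2)).
have : 0 <= (n%:R + 1) * (s ^+ n.+1 * nr h ^+ 2).
  by rewrite !mulr_ge0 ?exprn_ge0 ?nr_ge0 ?addr_ge0 // ltW.
rewrite -natr1 exprS; lra.
Qed.

Lemma psum_CD r u z : rad r u -> nr z < r -> CD (psum u) z (psum (der u) z).
Proof.
move=> ru zr; pose s := (nr z + r) / 2.
have zs : nr z < s by rewrite /s; lra.
have s0 : 0 < s by apply: le_lt_trans zs; exact: nr_ge0.
have sr : s < r by rewrite /s; lra.
have rs : nr (ofR s) < r by rewrite nr_ofR ger0_norm // ltW.
(* [M] bounds the sum of n^2 |u_n| s^n, so the Taylor remainders of all terms add up to at most M
   |h|^2 / s^2. *)
have [M HM] := geom_series_bounded (rad_geom (rad_nat (rad_nat ru)) rs).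
apply: (@CD_quadratic _ _ _ _ (M / s ^+ 2) (s - nr z)); first by rewrite subr_gt0.
move=> h hs; have zhs : nr (z + h) < s by have := nrD z h; lra.
pose E n := (z + h) ^+ n - z ^+ n - n%:R * z ^+ n.-1 * h.
(* The derived series is shifted by one: its N-th partial sum goes with the partial sums of order N
   + 1 of the other two. *)
have cE : (fun N => series (fun n => u n * (z + h) ^+ n) N.+1 - series (fun n => u n * z ^+ n) N.+1
    - series (fun n => der u n * z ^+ n) N * h) @ \oo
    --> psum u (z + h) - psum u z - psum (der u) z * h.
  apply: cvgB; first apply: cvgB.
  - have := psum_cvg ru (lt_trans zhs sr).
    by rewrite -cvg_shiftS.
  - have := psum_cvg ru zr.
    by rewrite -cvg_shiftS.
  - by apply: cvgMr_tmp; exact: psum_cvg (rad_der ru) zr.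
apply: (nr_lim_le cE) => N.
have -> : series (fun n => u n * (z + h) ^+ n) N.+1 - series (fun n => u n * z ^+ n) N.+1
    - series (fun n => der u n * z ^+ n) N * h = \sum_(0 <= n < N.+1) u n * E n.
  have -> : series (fun n => der u n * z ^+ n) N = \sum_(0 <= n < N.+1) n%:R * u n * z ^+ n.-1.
    by rewrite big_nat_recl //= !mul0r add0r.
  rewrite /series /= mulr_suml -sumrB -sumrB; apply: eq_bigr => n _.
  by rewrite /E; ring.
apply: (le_trans (nr_sum _ _ _)).
rewrite mulrAC ler_pdivlMr ?exprn_gt0 // mulr_suml.
apply: le_trans (_ : \sum_(0 <= k < N.+1) nr (k%:R * (k%:R * u k) * ofR s ^+ k) * nr h ^+ 2 <= _).
  apply: ler_sum => n _; rewrite !nrM !nrX !nr_nat nr_ofR (ger0_norm (ltW s0)).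
  have := pow_taylor n s0 (ltW zs) (ltW zhs).
  rewrite -/(E n) => /(ler_wpM2l (nr_ge0 (u n))); lra.
by rewrite -mulr_suml ler_wpM2r ?exprn_ge0 ?nr_ge0.
Qed.

End series.

(** * Products of power series and the substitution of z^m for z *)

Section cauchy_product.
Context {R : realType}.
Local Notation C := (Cx R).
Implicit Types (u v : nat -> C) (z w : C) (r s : R).

Lemma geom_bounded_max u v : geom_bounded u -> geom_bounded v -> exists (K rho : R),
  [/\ 0 <= K, 0 <= rho < 1, forall n, nr (u n) <= K * rho ^+ n & forall n, nr (v n) <= K * rho ^+ n].
Proof.
move=> [K [a [K0 /andP[a0 a1] Ha]]] [L [b [L0 /andP[b0 b1] Hb]]].
exists (K + L), (Num.max a b); split.
- exact: addr_ge0.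
- by rewrite le_max a0 gt_max a1 b1.
- move=> n; apply: (le_trans (Ha n)); apply: ler_pM; rewrite ?exprn_ge0 ?lerDl //.
  by rewrite lerXn2r ?nnegrE ?le_max ?lexx ?a0.
- move=> n; apply: (le_trans (Hb n)); apply: ler_pM; rewrite ?exprn_ge0 ?lerDr //.
  by rewrite lerXn2r ?nnegrE ?le_max ?lexx ?a0 ?orbT.
Qed.

(** The product of two partial sums is the value at 1 of a product of polynomials. Its coefficients
    below N are those of the convolution; the N others are at most 2 N K^2 rho^N each, and two uses
    of [nat_geom_geom] absorb the factor N^2. *)
Lemma cauchy_product u v : geom_bounded u -> geom_bounded v ->
  series (conv u v) @ \oo --> lim (series u @ \oo) * lim (series v @ \oo).
Proof.
move=> gu gv; have cu := geom_series_cvg gu; have cv := geom_series_cvg gv.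
have cuv : (fun n => series u n * series v n) @ \oo --> lim (series u @ \oo) * lim (series v @ \oo).
  exact: cvgM cu cv.
have [K [rho [K0 r01 Hu Hv]]] := geom_bounded_max gu gv.
have [A [sg [A0 s01 HA]]] := nat_geom_geom r01.
have [B [t [B0 t01 HB]]] := nat_geom_geom s01.
have [r0 r1] := andP r01.
have tail N : nr (series u N * series v N - series (conv u v) N) <= 2 * K ^+ 2 * A * B * t ^+ N.
  pose P := \poly_(i < N) u i; pose Q := \poly_(i < N) v i.
  have sE (w : nat -> C) : series w N = (\poly_(i < N) w i : {poly C}).[1].
    rewrite horner_poly /series /= big_mkord; apply: eq_bigr => i _.
    by rewrite expr1n mulr1.
  have coefPQ n : (n < N)%N -> (P * Q)`_n = conv u v n.
    move=> nN; rewrite coefM; apply: eq_bigr => j _; rewrite !coef_poly.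
    by rewrite (leq_ltn_trans (leq_subr _ _) nN) (leq_ltn_trans _ nN) // -ltnS.
  have szPQ : (size (P * Q)%R <= N + N)%N.
    apply: (leq_trans (size_polyMleq _ _)); rewrite (leq_trans (leq_pred _)) //.
    by rewrite leq_add // size_poly.
  rewrite (sE u) (sE v) -hornerM (horner_coef_wide _ szPQ).
  under eq_bigr do rewrite expr1n mulr1.
  rewrite -(big_mkord xpredT (fun i => (P * Q)`_i)) (big_cat_nat (n := N)) ?leq_addr //=.
  have -> : \sum_(0 <= i < N) (P * Q)`_i = series (conv u v) N.
    by rewrite /series /= !big_mkord; apply: eq_bigr => i _; rewrite coefPQ.
  rewrite addrAC subrr add0r; apply: (le_trans (nr_sum _ _ _)).
  have term n : (N <= n < N + N)%N -> nr (P * Q)`_n <= (N + N)%:R * (K ^+ 2 * rho ^+ N).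
    move=> /andP[Nn nN]; rewrite coefM; apply: (le_trans (nr_sum _ _ _)).
    apply: le_trans (_ : \sum_(i < n.+1) K ^+ 2 * rho ^+ N <= _); last first.
      rewrite sumr_const card_ord -[_ *+ n.+1]mulr_natl ler_wpM2r ?ler_nat //.
      by rewrite mulr_ge0 ?exprn_ge0.
    apply: ler_sum => i _; rewrite nrM !coef_poly.
    have in' : (i <= n)%N by rewrite -ltnS.
    apply: le_trans (_ : (K * rho ^+ i) * (K * rho ^+ (n - i)) <= _).
      apply: ler_pM; rewrite ?nr_ge0 //; case: ifP => _; rewrite ?nr0 ?mulr_ge0 ?exprn_ge0 //.
    rewrite mulrACA -exprD subnKC // -expr2 ler_wpM2l ?exprn_ge0 //.
    by rewrite ler_wiXn2l // ltW.
  apply: le_trans (_ : \sum_(N <= n < N + N) (N + N)%:R * (K ^+ 2 * rho ^+ N) <= _).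
    by rewrite big_nat_cond [leRHS]big_nat_cond; apply: ler_sum => n /andP[h _]; exact: term.
  rewrite sumr_const_nat addnK -[_ *+ N]mulr_natl natrD.
  have -> : N%:R * ((N%:R + N%:R) * (K ^+ 2 * rho ^+ N)) =
     2 * K ^+ 2 * (N%:R * (N%:R * rho ^+ N)) by ring.
  rewrite -!mulrA ler_wpM2l // ler_wpM2l // ler_wpM2l //.
  apply: (le_trans (ler_wpM2l (ler0n _ _) (HA N))).
  by rewrite mulrCA ler_wpM2l.
apply/cvgCP => e e0; have e2 : 0 < e / 2 by lra.
move/cvgCP : cuv => /(_ _ e2) cuv.
have cvt := geom_cvg0 (2 * K ^+ 2 * A * B) t01 e2.
near=> n.
rewrite -(subrK (series u n * series v n) (_ * _)) -addrA.
apply: (le_lt_trans (nrD _ _)).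
have h1 : nr (lim (series u @ \oo) * lim (series v @ \oo) - series u n * series v n) < e / 2.
  by near: n.
have h2 : 2 * K ^+ 2 * A * B * t ^+ n <= e / 2 by near: n.
have := tail n; lra.
Unshelve. all: by end_near. Qed.

Lemma psumM r u v z : rad r u -> rad r v -> nr z < r ->
  psum u z * psum v z = psum (conv u v) z.
Proof.
move=> ru rv zr; apply/esym/cvg_lim => //.
rewrite (_ : (fun _ => _) = conv (fun n => u n * z ^+ n) (fun n => v n * z ^+ n)).
  by apply: cauchy_product; exact: rad_geom zr.
apply/funext => n; rewrite /conv mulr_suml; apply: eq_bigr => i _.
by rewrite mulrACA -exprD subnKC // -ltnS.
Qed.

Lemma rad_conv r u v : rad r u -> rad r v -> rad r (conv u v).
Proof.
move=> ru rv s /andP[s0 sr].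
have zr : nr (ofR s) < r by rewrite nr_ofR ger0_norm.
have [K [rho [K0 r01 Hu Hv]]] := geom_bounded_max (rad_geom ru zr) (rad_geom rv zr).
have [L HL] := nat_geom_bounded r01; case/andP: r01 => r0 r1.
exists (K ^+ 2 * (L + 1)) => n.
apply: le_trans (_ : \sum_(i < n.+1) K ^+ 2 * rho ^+ n <= _).
  rewrite /conv; apply: (le_trans (ler_wpM2r (exprn_ge0 _ s0) (nr_sum _ _ _))).
  rewrite mulr_suml; apply: ler_sum => i _.
  have in' : (i <= n)%N by rewrite -ltnS.
  have := Hu i; have := Hv (n - i)%N; rewrite !nrM !nrX nr_ofR (ger0_norm s0) => hv hu.
  have ex (x : R) : x ^+ n = x ^+ i * x ^+ (n - i) by rewrite -exprD subnKC.
  rewrite !ex expr2 mulrACA [leRHS]mulrACA.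
  by apply: ler_pM => //; rewrite mulr_ge0 ?nr_ge0 ?exprn_ge0.
rewrite sumr_const card_ord -[_ *+ n.+1]mulr_natl mulrCA ler_wpM2l ?exprn_ge0 //.
by rewrite -natr1 mulrDl mul1r lerD // exprn_ile1 // ltW.
Qed.

Lemma rad_dil (m : nat) u : (0 < m)%N -> rad 1 u -> rad 1 (dil m u).
Proof.
move=> m0 ru s /andP[s0 s1].
have [|K HK] := ru (s ^+ m); first by rewrite exprn_ge0 //= exprn_ilt1 // -lt0n.
have K0 : 0 <= K by have := HK 0; rewrite expr0 mulr1; apply: le_trans; exact: nr_ge0.
exists K => n; rewrite /dil; case: ifP => [d|_]; last by rewrite nr0 mul0r.
by rewrite -{2}(divnK d) mulnC exprM.
Qed.

Lemma psum_dil (m : nat) u z : (0 < m)%N -> rad 1 u -> nr z < 1 ->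
  psum (dil m u) z = psum u (z ^+ m).
Proof.
move=> m0 ru z1.
have zm1 : nr (z ^+ m) < 1 by rewrite nrX exprn_ilt1 ?nr_ge0 // -lt0n.
have cd := psum_cvg (rad_dil m0 ru) z1; have cu := psum_cvg ru zm1.
(* Among m consecutive indices only the multiple of m contributes, so partial sums are compared
   along the multiples of m. *)
have sE N : series (fun n => dil m u n * z ^+ n) (m * N)%N =
    series (fun n => u n * (z ^+ m) ^+ n) N.
  elim: N => [|N IH]; first by rewrite muln0 /series /= !big_geq.
  rewrite /series /= [RHS]big_nat_recr //= -[X in _ = X + _]IH.
  rewrite (big_cat_nat (n := (m * N)%N)) ?leq_mul //= mulnS addnC; congr (_ + _).
  rewrite big_ltn; last by rewrite -addn1 leq_add2l.
  rewrite /dil dvdn_mulr // mulKn // exprM big_nat_cond big1 ?addr0 // => i /andP[/andP[h1 h2] _].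
  case: ifP; rewrite ?mul0r // => /dvdnP[q e]; exfalso.
  move: h1 h2; rewrite e [(q * m)%N]mulnC -mulnSr !ltn_pmul2l //; lia.
have cd' : series (fun n => u n * (z ^+ m) ^+ n) @ \oo --> psum (dil m u) z.
  apply/cvgCP => e e0; move/cvgCP : cd => /(_ e e0)[N0 _ h]; exists N0 => // N /= hN.
  by rewrite -sE; apply: h => /=; exact: leq_trans hN (leq_pmull _ m0).
by rewrite -(cvg_lim _ cd') // (cvg_lim _ cu).
Qed.

End cauchy_product.

(** * The complex exponential and the mean value inequality *)

Section complex_exponential.
Context {R : realType}.
Local Notation C := (Cx R).
Implicit Types (z w : C) (x y : R).

Lemma RDP (f : R -> R) x l : is_derive x 1 f l <-> forall e, 0 < e -> exists2 d, 0 < d &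
  forall h, `|h| < d -> `|f (x + h) - f x - l * h| <= e * `|h|.
Proof.
pose q (h : R) := h^-1 *: ((f \o shift x) (h *: (1 : R)) - f x).
have qE h : h != 0 -> `|l - q h| * `|h| = `|f (x + h) - f x - l * h|.
  move=> h0; rewrite -normrM -[RHS]normrN; congr (`| _ |); rewrite /q /=.
  rewrite mulrBl /GRing.scale /= mulr1 [h + x]addrC mulrAC mulVf // mul1r; ring.
have aux : q @ 0^' --> l <-> forall e : R, 0 < e -> exists2 d : R, 0 < d &
  forall h, `|h| < d -> `|f (x + h) - f x - l * h| <= e * `|h|.
  split=> [/cvgrPdist_le H e e0|H].
    have /nbhs_ballP[d /= d0 hd] := H e e0; exists d => // h hhd.
    have [->|h0] := eqVneq h 0; first by rewrite addr0 subrr mulr0 subr0 normr0 mulr0.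
    rewrite -qE // ler_wpM2r //; apply: hd => //.
    by rewrite -ball_normE /ball_ /= sub0r normrN.
  apply/cvgrPdist_le => e e0; have [d d0 hd] := H e e0.
  apply/nbhs_ballP; exists d => // h; rewrite -ball_normE /ball_ /= sub0r normrN => hhd h0.
  by have := hd _ hhd; rewrite -qE // ler_pM2r // normr_gt0.
split=> [[df dv]|H].
  by apply/aux; rewrite -dv; exact: df.
have ql : q @ 0^' --> l by apply/aux.
by split; [apply: cvgP ql | apply: cvg_lim ql].
Qed.

Lemma C_eq z w : re_part z = re_part w -> im_part z = im_part w -> z = w.
Proof. by move=> a b; rewrite [z]CE [w]CE a b. Qed.

Lemma re_cexp z : re_part (cexp z) = expR (re_part z) * cos (im_part z).
Proof.
by rewrite /cexp re_partM re_partD re_partM im_partD !(re_ofR, im_ofR, re_imagi, im_imagi);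
   rewrite !(mul0r, mulr0, subr0, addr0).
Qed.

Lemma im_cexp z : im_part (cexp z) = expR (re_part z) * sin (im_part z).
Proof.
by rewrite /cexp im_partM im_partD im_partM re_partD !(re_ofR, im_ofR, re_imagi, im_imagi);
   rewrite !(mul0r, mulr0, add0r, addr0, mul1r).
Qed.

Lemma cexpD z w : cexp (z + w) = cexp z * cexp w.
Proof.
apply: C_eq.
  by rewrite [LHS]re_cexp re_partD im_partD expRD cosD [RHS]re_partM !re_cexp !im_cexp; ring.
by rewrite [LHS]im_cexp re_partD im_partD expRD sinD [RHS]im_partM !re_cexp !im_cexp; ring.
Qed.

Lemma cexp0 : cexp (0 : C) = 1.
Proof. by apply: C_eq; rewrite ?re_cexp ?im_cexp /= expR0 mul1r ?cos0 ?sin0. Qed.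

Lemma nr_cexp z : nr (cexp z) = expR (re_part z).
Proof.
rewrite nrE re_cexp im_cexp !exprMn -mulrDr cos2Dsin2 mulr1 sqrtr_sqr ger0_norm // expR_ge0.
Qed.

Lemma cexp_neq0 z : cexp z != 0.
Proof. by rewrite -nr_eq0 nr_cexp gt_eqF // expR_gt0. Qed.

Lemma cexpN z : cexp (- z) = (cexp z)^-1.
Proof. by apply: (mulfI (cexp_neq0 z)); rewrite -cexpD subrr cexp0 divff // cexp_neq0. Qed.

Lemma cexp_natM z n : cexp (n%:R * z) = cexp z ^+ n.
Proof. by elim: n => [|n IH]; rewrite ?mul0r ?cexp0 // -natr1 mulrDl mul1r cexpD IH exprSr. Qed.

Lemma cexp_sum (I : Type) (r : seq I) (P : pred I) (F : I -> C) :
  cexp (\sum_(i <- r | P i) F i) = \prod_(i <- r | P i) cexp (F i).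
Proof. by elim/big_rec2: _ => [|i y x _ <-]; rewrite ?cexp0 ?cexpD. Qed.

Lemma cexp_CD0 : CD cexp (0 : C) 1.
Proof.
apply/CDP => e e0.
(* With h = a + i b and e^a <= 3, the total error is at most e1 |a| + 6 e1 |b| + 2 |a| |b|, and 7 /
   14 + 2 / 4 = 1. *)
pose e1 := Num.min 1 (e / 14); have e10 : 0 < e1 by rewrite lt_min ltr01 /=; lra.
have e11 : e1 <= 1 by rewrite ge_min lexx.
have e12 : e1 <= e / 14 by rewrite ge_min lexx orbT.
have /RDP/(_ _ e10)[d1 d10 H1] := is_derive_expR (0 : R).
have /RDP/(_ _ e10)[d2 d20 H2] := is_derive_cos (0 : R).
have /RDP/(_ _ e10)[d3 d30 H3] := is_derive_sin (0 : R).
exists (Num.min (Num.min 1 (e / 4)) (Num.min d1 (Num.min d2 d3))).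
  by rewrite !lt_min ltr01 d10 d20 d30 /= andbT; lra.
move=> h; rewrite !lt_min => /andP[/andP[hh1 he] /and3P[hd1 hd2 hd3]].
have ra := re_le_nr h; have ib := im_le_nr h.
have := H1 _ (le_lt_trans ra hd1); have := H2 _ (le_lt_trans ib hd2).
have := H3 _ (le_lt_trans ib hd3).
rewrite !(add0r, expR0, cos0, sin0, cexp0, oppr0, mul0r, mul1r, subr0).
set a := re_part h; set b := im_part h => h3 h2 h1.
apply: (le_trans (nr_le_reim _)).
rewrite !re_partD !im_partD !re_partN !im_partN re_cexp im_cexp -/a -/b.
have -> : re_part (1 : C) = 1 by []. have -> : im_part (1 : C) = 0 by [].
have na := normr_ge0 a; have nb := normr_ge0 b.
have E3 : expR a <= 3.
  have : `|expR a - 1 - a| <= 1 by apply: (le_trans h1); rewrite -[leRHS]mulr1; apply: ler_pM => //; lra.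
  have a1 : a <= 1 by apply: (le_trans (ler_norm _)); exact: le_trans ra (ltW hh1).
  by rewrite ler_norml => /andP[_ ?]; lra.
have E0 := expR_ge0 a.
have p1 : `|expR a * cos b - 1 - a| <= e1 * `|a| + 3 * (e1 * `|b|).
  have -> : expR a * cos b - 1 - a = (expR a - 1 - a) + expR a * (cos b - 1) by ring.
  apply: (le_trans (ler_normD _ _)); rewrite lerD // normrM (ger0_norm E0).
  by apply: ler_pM.
have p2 : `|expR a * sin b - 0 - b| <= 3 * (e1 * `|b|) + 2 * `|a| * `|b|.
  have -> : expR a * sin b - 0 - b = expR a * (sin b - b) + (expR a - 1) * b by ring.
  apply: (le_trans (ler_normD _ _)); rewrite !normrM (ger0_norm E0) lerD //.
    by apply: ler_pM.
  rewrite ler_wpM2r // (_ : expR a - 1 = (expR a - 1 - a) + a); last by ring.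
  apply: (le_trans (ler_normD _ _)).
  have : e1 * `|a| <= 1 * `|a| by rewrite ler_wpM2r.
  lra.
apply: (le_trans (lerD p1 p2)).
have q1 : e1 * `|a| <= e / 14 * nr h by apply: ler_pM => //; exact: ltW.
have q2 : e1 * `|b| <= e / 14 * nr h by apply: ler_pM => //; exact: ltW.
have q3 : `|a| * `|b| <= e / 4 * nr h by apply: ler_pM => //; apply: (le_trans ra); exact: ltW.
rewrite -/a -/b in q1 q2 q3 *; lra.
Qed.

Lemma cexp_CD z : CD cexp z (cexp z).
Proof.
have : CD (fun w => cexp z * cexp (w - z)) z (cexp z * (1 * 1)).
  apply: CD_scale; apply: CD_comp.
    by apply: (CD_eq (CD_sub (CD_id z) (CD_cst z z))); rewrite subr0.
  by rewrite subrr; exact: cexp_CD0.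
rewrite !mulr1 (_ : (fun _ => _) = cexp) //.
by apply/funext => w; rewrite -cexpD addrC subrK.
Qed.

(** The real mean value theorem is applied to the component of f along D = f w - f z, that is to t
    |-> Re(conj(D) f(z + t (w - z))), whose increment over [0, 1] is |D|^2. *)
Lemma mvi (f df : C -> C) z w (M : R) :
  (forall t : R, 0 <= t <= 1 -> CD f (z + ofR t * (w - z)) (df (z + ofR t * (w - z)))) ->
  (forall t : R, 0 <= t <= 1 -> nr (df (z + ofR t * (w - z))) <= M) ->
  nr (f w - f z) <= M * nr (w - z).
Proof.
move=> dfd dfM; set D := f w - f z.
pose p (x : C) := re_part D * re_part x + im_part D * im_part x.
have pD (x y : C) : p (x + y) = p x + p y by rewrite /p re_partD im_partD; ring.
have pN (x : C) : p (- x) = - p x by rewrite /p re_partN im_partN; ring.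
have pZ (t : R) (x : C) : p (ofR t * x) = t * p x.
  by rewrite /p re_partM im_partM re_ofR im_ofR; ring.
have p_le (x : C) : `|p x| <= nr D * nr x.
  pose D' : C := ofR (re_part D) - imagi * ofR (im_part D).
  have -> : nr D = nr D'.
    rewrite !nrE /D' re_partD im_partD re_partN im_partN re_partM im_partM.
    by rewrite !(re_ofR, im_ofR, re_imagi, im_imagi) !(mul0r, mulr0, mul1r, subr0, add0r, addr0, oppr0) sqrrN.
  rewrite -nrM (_ : p x = re_part (D' * x)) ?re_le_nr //.
  rewrite re_partM /D' re_partD im_partD re_partN im_partN re_partM im_partM.
  by rewrite !(re_ofR, im_ofR, re_imagi, im_imagi) /p; ring.
have pDD : p D = nr D ^+ 2.
  by rewrite nrE sqr_sqrtr ?addr_ge0 ?sqr_ge0 // /p -!expr2.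
pose g (t : R) := p (f (z + ofR t * (w - z))).
pose dg (t : R) := p (df (z + ofR t * (w - z)) * (w - z)).
have dgP (t : R) : 0 <= t <= 1 -> is_derive t 1 g (dg t).
  move=> t01; apply/RDP => e e0; set zt := z + ofR t * (w - z).
  pose c := nr D * nr (w - z) + 1; have c0 : 0 < c by rewrite ltr_wpDl // mulr_ge0 ?nr_ge0.
  have /CDP/(_ (e / c))[|d d0 H] := dfd _ t01; first exact: divr_gt0.
  exists (d / (nr (w - z) + 1)); first by rewrite divr_gt0 // ltr_wpDl ?nr_ge0.
  move=> k kd; pose h := ofR k * (w - z).
  have nh : nr h = `|k| * nr (w - z) by rewrite nrM nr_ofR.
  have hd : nr h < d.
    rewrite nh; apply: le_lt_trans (_ : `|k| * (nr (w - z) + 1) < _).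
      by rewrite ler_wpM2l // lerDl.
    by rewrite -ltr_pdivlMr // ltr_wpDl ?nr_ge0.
  have := H _ hd; rewrite -/zt => Hh.
  have -> : g (t + k) - g t - dg t * k = p (f (zt + h) - f zt - df zt * h).
    rewrite !pD !pN /g /dg -/zt ofRD mulrDl addrA -/h -/zt; congr (_ - _ - _).
    by rewrite /h mulrCA pZ mulrC.
  apply: (le_trans (p_le _)); apply: (le_trans (ler_wpM2l (nr_ge0 D) Hh)).
  rewrite nh; have -> : nr D * (e / c * (`|k| * nr (w - z))) = e * `|k| * ((nr D * nr (w - z)) / c) by ring.
  by rewrite ler_piMr ?mulr_ge0 ?(ltW e0) // ler_pdivrMr // mul1r lerDl.
have [t] : exists2 t, t \in `]0, 1[%R & g 1 - g 0 = dg t * (1 - 0).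
  apply: MVT => //.
    by move=> x; rewrite in_itv /= => /andP[x0 x1]; apply: dgP; rewrite !ltW.
  apply: derivable_within_continuous => x; rewrite in_itv /= => x01.
  by have [] := dgP _ x01.
rewrite in_itv /= subr0 mulr1 => /andP[t0 t1].
have -> : g 1 - g 0 = p D.
  rewrite /g -pN -pD; congr p; rewrite /D (_ : ofR 1 = 1) // (_ : ofR 0 = 0) // mul1r mul0r addr0.
  by rewrite [z + _]addrC subrK.
rewrite pDD => e; have t01 : 0 <= t <= 1 by rewrite !ltW.
have le : nr D ^+ 2 <= nr D * (M * nr (w - z)).
  rewrite e; apply: (le_trans (ler_norm _)); apply: (le_trans (p_le _)).
  by rewrite ler_wpM2l ?nr_ge0 // nrM ler_wpM2r ?nr_ge0 // dfM.
have [D0|D0] := eqVneq D 0.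
  rewrite D0 nr0 mulr_ge0 ?nr_ge0 //.
  by apply: le_trans (dfM 0 _); rewrite ?nr_ge0 // lexx ler01.
by rewrite -(@ler_pM2l _ (nr D)) ?nr_gt0 // -expr2.
Qed.

End complex_exponential.

(** * Minima of |f - v| and open mapping *)

Section minimum_principle.
Context {R : realType}.
Local Notation C := (Cx R).
Implicit Types (z w c v : C).

Lemma cvgR_C (phi : C -> R) z (l : R) :
  (forall e : R, 0 < e -> exists2 d : R, 0 < d & forall w, nr (w - z) < d -> `|l - phi w| < e) ->
  phi @ z --> l.
Proof.
move=> H; apply/(@cvgrPdist_lt _ _ _ (nbhs z) (nbhs_filter z)) => e e0.
exact/nbhsCP/H.
Qed.

(** Compactness comes from a closed part of a rectangle in the real plane, carried to the disc by
    T(x, y) = x + i y. *)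
Lemma ball_min c (r : R) (phi : C -> R) : 0 <= r ->
  (forall z, nr (z - c) <= r -> phi @ z --> phi z) ->
  exists2 z0, nr (z0 - c) <= r & forall z, nr (z - c) <= r -> phi z0 <= phi z.
Proof.
move=> r0 cphi.
pose T (p : R * R) : C := ofR p.1 + imagi * ofR p.2.
have cofR : continuous (ofR : R -> C).
  move=> x; apply/cvgCP => e e0.
  have : (fun y : R => y) @ x --> x by exact: cvg_id.
  move/cvgrPdist_lt => /(_ _ e0); apply: filterS => y.
  by rewrite -rmorphB nr_ofR.
have cT : continuous T.
  move=> p; apply: cvgD.
    by apply: (cvg_comp fst ofR); [exact: cvg_fst | exact: cofR].
  by apply: cvgMl_tmp; apply: (cvg_comp snd ofR); [exact: cvg_snd | exact: cofR].
pose sq : set (R * R) := `[re_part c - r, re_part c + r]%classic `*` `[im_part c - r, im_part c + r]%classic.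
pose nrc z := nr (z - c).
have cnrc : continuous nrc.
  move=> z; apply: cvgR_C => e e0; exists e => // w wz.
  have e1 := nrD (w - z) (z - c); have e2 := nrD (z - w) (w - c).
  by move: e1 e2; rewrite (nrB z w) !addrA !subrK /nrc ltr_norml => e1 e2; lra.
pose A : set (R * R) := sq `&` [set p | nr (T p - c) <= r].
have clA : closed [set p | nr (T p - c) <= r].
  apply: (@closed_comp _ _ (nrc \o T) [set x | x <= r]); last exact: closed_le.
  by move=> p _; apply: (cvg_comp T nrc); [exact: cT | exact: cnrc].
have cptA : compact A.
  by apply: compact_closedI => //; apply: compact_setX; exact: segment_compact.
have TK z : T (re_part z, im_part z) = z by rewrite /T /= -CE.
have AT z : nr (z - c) <= r -> A (re_part z, im_part z).
  move=> zc; split; last by rewrite /= TK.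
  have := re_le_nr (z - c); have := im_le_nr (z - c).
  rewrite re_partD im_partD re_partN im_partN !ler_norml => /andP[i1 i2] /andP[r1 r2].
  by split; rewrite /= in_itv /=; apply/andP; split; lra.
have [] := @compact_EVT_min _ R (phi \o T) A.
- by exists (re_part c, im_part c); apply: AT; rewrite subrr nr0.
- exact: cptA.
- apply: continuous_in_subspaceT => p; rewrite inE => -[_ Ap].
  by apply: (cvg_comp T phi); [exact: cT | exact: cphi].
move=> p; rewrite inE => -[_ Ap] pmin; exists (T p) => // z zc.
have := pmin (re_part z, im_part z); rewrite /= TK; apply; rewrite inE; exact: AT.
Qed.

Lemma CD_nr_cvg (f : C -> C) z l v : CD f z l -> (fun w => nr (f w - v)) @ z --> nr (f z - v).
Proof.
move=> /CD_cvg /cvgCP H; apply: cvgR_C => e e0.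
have /nbhsCP[d d0 hd] := H e e0; exists d => // w /hd wz; rewrite ltr_norml.
have := nrD (f z - f w) (f w - v); have := nrD (f w - f z) (f z - v).
by rewrite (nrB (f w) (f z)) !addrA !subrK => *; lra.
Qed.

(* An interior minimum of |f - v| is a zero, since f' <> 0 allows to decrease
   |f - v| by moving in the direction of - (f - v) / f'. *)
Lemma min_zero (f : C -> C) c (r : R) v : 0 < r ->
  (forall z, nr (z - c) <= r -> exists l, CD f z l) ->
  (forall z, nr (z - c) < r -> exists2 l, l != 0 & CD f z l) ->
  (forall z, nr (z - c) = r -> nr (f c - v) < nr (f z - v)) ->
  exists2 z, nr (z - c) < r & f z = v.
Proof.
move=> r0 fd fd0 fb.
have [z0 z0r zmin] := @ball_min c r (fun z => nr (f z - v)) (ltW r0)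
   (fun z zr => let: ex_intro l h := fd z zr in @CD_nr_cvg f z l v h).
have cc : nr (c - c) <= r by rewrite subrr nr0 ltW.
have z0lt : nr (z0 - c) < r.
  rewrite lt_neqAle z0r andbT; apply/eqP => e.
  by have := fb _ e; rewrite ltNge zmin.
exists z0 => //; apply/eqP; rewrite -subr_eq0; apply/negPn/negP => D0.
have [l l0 /CDP dl] := fd0 _ z0lt.
set D := f z0 - v in D0 zmin.
have nD : 0 < nr D by rewrite nr_gt0.
have nl : 0 < nr l by rewrite nr_gt0.
have l20 : 0 < nr l / 2 by rewrite divr_gt0.
have [d d0 H] := dl _ l20.
pose k := nr D / nr l; have k0 : 0 < k by rewrite divr_gt0.
pose rr := r - nr (z0 - c); have rr0 : 0 < rr by rewrite subr_gt0.
(* For h = - t D / l one gets |f(z0 + h) - v| <= (1 - t) |D| + t |D| / 2 < |D|. The bounds on t keep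
   h where the derivative estimate holds and z0 + h in the closed disc. *)
pose t := Num.min 1 (Num.min (d / (2 * k)) (rr / k)).
have t0 : 0 < t by rewrite !lt_min ltr01 !divr_gt0 // mulr_gt0.
have t1 : t <= 1 by rewrite ge_min lexx.
have td : t * k < d.
  have : t <= d / (2 * k) by rewrite !ge_min lexx ?orbT.
  move=> /(ler_wpM2r (ltW k0)); have -> : d / (2 * k) * k = d / 2 by field; rewrite gt_eqF.
  lra.
have trr : t * k <= rr.
  have : t <= rr / k by rewrite !ge_min lexx ?orbT.
  by rewrite ler_pdivlMr.
pose h : C := - (ofR t * (D / l)).
have nh : nr h = t * k by rewrite nrN nrM nr_ofR ger0_norm ?(ltW t0) // nrM nrV.
have hd : nr h < d by rewrite nh.
have := H _ hd.
have -> : l * h = - (ofR t * D) by rewrite /h; field.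
move=> Hh.
have zhr : nr (z0 + h - c) <= r.
  rewrite addrAC; apply: (le_trans (nrD _ _)); rewrite nh.
  by move: trr; rewrite /rr; lra.
have := zmin _ zhr; apply/negP; rewrite -ltNge.
have -> : f (z0 + h) - v = (ofR (1 - t)) * D + (f (z0 + h) - f z0 - - (ofR t * D)).
  by rewrite /D (_ : ofR (1 - t) = 1 - ofR t); [ring | exact: rmorphB].
apply: (le_lt_trans (nrD _ _)); rewrite nrM nr_ofR ger0_norm; last by rewrite subr_ge0.
have : nr l / 2 * nr h = t * nr D / 2 by rewrite nh /k; field; rewrite gt_eqF.
have : 0 < t * nr D by rewrite mulr_gt0.
move: Hh; lra.
Qed.

Lemma open_mapping (f : C -> C) z (d : R) : 0 < d ->
  (forall w, nr (w - z) < d -> exists2 l, l != 0 & CD f w l) -> 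
  exists2 m : R, 0 < m & forall v, nr (v - f z) < m -> exists2 w, nr (w - z) < d & f w = v.
Proof.
move=> d0 fd.
have [l' l0 /CDP dl] : exists2 l, l != 0 & CD f z l by apply: fd; rewrite subrr nr0.
have nl : 0 < nr l' by rewrite nr_gt0.
have l20 : 0 < nr l' / 2 by rewrite divr_gt0.
have [d' d'0 H] := dl _ l20.
pose r := Num.min d d' / 2.
have r0 : 0 < r by rewrite divr_gt0 // lt_min d0 d'0.
have rd : r < d.
  have : Num.min d d' <= d by rewrite ge_min lexx.
  by rewrite /r; lra.
have rd' : r < d'.
  have : Num.min d d' <= d' by rewrite ge_min lexx orbT.
  by rewrite /r; lra.
(* On the circle |w - z| = r one has |f w - f z| >= |l'| r / 2, which is twice this bound; hence |f
   - v| is smaller at the centre than on the circle. *)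
exists (nr l' / 2 * r / 2); first by rewrite divr_gt0 // mulr_gt0.
move=> v vm.
have [||| w wr fw] := @min_zero f z r v r0.
- by move=> w wr; have [|l1 _ h1] := fd w; [exact: le_lt_trans rd | exists l1].
- by move=> w wr; apply: fd; exact: lt_trans rd.
- move=> w wr; have := H (w - z); rewrite wr => /(_ rd').
  rewrite [z + _]addrC subrK => h.
  have h1 : nr l' * r = nr (l' * (w - z)) by rewrite nrM wr.
  have := nrD_le (l' * (w - z)) (f w - f z - l' * (w - z)).
  rewrite [l' * _ + (_ - _)]addrC subrK -h1 => h2.
  have := nrD (f w - v) (v - f z); rewrite addrA subrK (nrB (f z) v).
  move: h vm; lra.
by exists w => //; exact: lt_trans rd.
Qed.

End minimum_principle.

(** * Eisenstein series and eta *)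

Section q_series.
Context {R : realType}.
Local Notation C := (Cx R).
Implicit Types (u v : nat -> C) (z w tau : C) (r s : R).

Lemma psum_recl r u z : rad r u -> nr z < r ->
  psum u z = u 0%N + lim (series (fun n => u n.+1 * z ^+ n.+1) @ \oo).
Proof.
move=> ru zr; have := psum_cvg ru zr; rewrite -cvg_shiftS => H.
have : (fun N => series (fun n => u n * z ^+ n) N.+1 - u 0%N) @ \oo --> psum u z - u 0%N.
  by apply: cvgB H _; exact: cvg_cst.
rewrite (_ : (fun _ => _) = series (fun n => u n.+1 * z ^+ n.+1)); last first.
  apply/funext => N; rewrite /series /= big_nat_recl //= expr0 mulr1 addrAC subrr add0r.
  by [].
by move=> /cvg_lim -> //; rewrite addrC subrK.
Qed.

Lemma psum_recl_cvg r u z : rad r u -> nr z < r ->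
  cvg (series (fun n => u n.+1 * z ^+ n.+1) @ \oo).
Proof.
move=> ru zr; rewrite (_ : (fun n => _) = (fun n => (fun n => z * u n.+1) n * z ^+ n)).
  exact: (cvgP _ (psum_cvg (rad_scale z (rad_shift ru)) zr)).
by apply/funext => n; rewrite exprS mulrA [u n.+1 * z]mulrC.
Qed.

Lemma psum_ext u v z : u =1 v -> psum u z = psum v z.
Proof. by move=> /funext ->. Qed.

Lemma psum0 u : psum u 0 = u 0%N.
Proof.
apply: cvg_lim => //; rewrite -cvg_shiftS.
rewrite (_ : (fun _ => _) = (fun=> u 0%N)); first exact: cvg_cst.
apply/funext => N; rewrite /series /= big_nat_recl //= expr0 mulr1 big1 ?addr0 // => i _.
by rewrite exprS mul0r mulr0.
Qed.

Lemma psum_theta r u z : rad r u -> nr z < r ->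
  z * psum (der u) z = psum (fun n => n%:R * u n) z.
Proof.
move=> ru zr; rewrite (psum_recl (rad_nat ru) zr) mul0r add0r.
rewrite -(psumZ z (rad_der ru) zr) /psum; congr (lim (series _ @ \oo)).
by apply/funext => n; rewrite exprS /der; ring.
Qed.

Lemma rad_cst (c : C) : rad 1 (fun=> c).
Proof.
move=> s /andP[s0 s1]; exists (nr c) => n.
by rewrite ler_piMr ?nr_ge0 // exprn_ile1 // ltW.
Qed.

Lemma rad_natX (k : nat) : rad 1 (fun n => n%:R ^+ k : C).
Proof.
elim: k => [|k IH]; first exact: rad_cst.
by rewrite (_ : (fun n => _) = (fun n => n%:R * n%:R ^+ k)); [exact: rad_nat | apply/funext => n; rewrite exprS].
Qed.

(** There are at most n divisors, each with s-th power at most n^s; polynomial growth suffices for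
    convergence when |q| < 1. *)
Lemma sigma_le (s n : nat) : (0 < n)%N -> (sigma s n <= n ^ s.+1)%N.
Proof.
move=> n0; rewrite /sigma.
apply: (@leq_trans (\sum_(d <- divisors n) n ^ s)).
  rewrite !big_seq; apply: leq_sum => d; rewrite -dvdn_divisors // => dn.
  by case: s => [|s] //; rewrite leq_exp2r // dvdn_leq.
rewrite big_const_seq count_predT iter_addn_0 mulnC expnS leq_mul2r; apply/orP; right.
rewrite -[leqRHS](size_iota 1 n); apply: uniq_leq_size; first exact: divisors_uniq.
move=> d; rewrite -dvdn_divisors // => dn; rewrite mem_iota add1n ltnS.
by rewrite (dvdn_gt0 n0 dn) dvdn_leq.
Qed.

Lemma rad_sig (s : nat) : rad 1 (sig C s).
Proof.
apply: (rad_le (rad_natX s.+1) ler01) => -[|n]; first by rewrite nr0 mul1r nr_ge0.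
by rewrite /sig nrX !nr_nat mul1r -natrX ler_nat sigma_le.
Qed.

Lemma rad_e2c : rad 1 (e2c C).
Proof.
apply: rad_add; last by rewrite (_ : (fun n => _) = (fun n => (- 24) * sig C 1 n));
  [exact: rad_scale (rad_sig 1) | apply/funext => n; rewrite mulNr].
apply: (rad_le (rad_cst 1) ler01) => n; rewrite nr1 mul1r.
by case: (n == _); rewrite ?nr1 ?nr0.
Qed.

Lemma rad_e4c : rad 1 (e4c C).
Proof.
apply: rad_add; last exact: rad_scale (rad_sig 3).
apply: (rad_le (rad_cst 1) ler01) => n; rewrite nr1 mul1r.
by case: (n == _); rewrite ?nr1 ?nr0.
Qed.

Lemma rad_gc : rad 1 (gc C).
Proof.
apply: rad_add; first by apply: rad_scale; apply: rad_dil => //; exact: rad_e2c.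
rewrite (_ : (fun n => _) = (fun n => (- 1) * e2c C n)); last by apply/funext => n; rewrite mulN1r.
exact: rad_scale rad_e2c.
Qed.

Lemma lim_seriesM (c : C) (a : nat -> C) : cvg (series a @ \oo) ->
  lim (series (fun n => c * a n) @ \oo) = c * lim (series a @ \oo).
Proof. exact: lim_seriesZ. Qed.

Lemma psum_e2c z : nr z < 1 -> psum (e2c C) z = 1 - 24 * psum (sig C 1) z.
Proof.
move=> z1; rewrite (psum_recl rad_e2c z1) (psum_recl (rad_sig 1) z1) /e2c /= !mulr0 subr0 add0r.
rewrite -mulNr -(lim_seriesM _ (psum_recl_cvg (rad_sig 1) z1)).
rewrite (_ : (fun n => (0 - _) * _) = (fun n => - 24 * ((sigma 1 n.+1)%:R * z ^+ n.+1))) //.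
by apply/funext => n; rewrite sub0r mulrA mulNr.
Qed.

Lemma psum_e4c z : nr z < 1 -> psum (e4c C) z = 1 + 240 * psum (sig C 3) z.
Proof.
move=> z1; rewrite (psum_recl rad_e4c z1) (psum_recl (rad_sig 3) z1) /e4c /= !mulr0 addr0 add0r.
rewrite -(lim_seriesM _ (psum_recl_cvg (rad_sig 3) z1)).
rewrite (_ : (fun n => (0 + _) * _) = (fun n => 240 * ((sigma 3 n.+1)%:R * z ^+ n.+1))) //.
by apply/funext => n; rewrite add0r mulrA.
Qed.

Lemma ofR_nat n : ofR n%:R = n%:R :> C.
Proof. by rewrite /ofR rmorph_nat. Qed.

Lemma twopiiE : re_part (twopii : C) = 0 /\ im_part (twopii : C) = 2 * pi.
Proof.
have -> : twopii = imagi * ofR (2 * pi) :> C by rewrite ofRM ofR_nat mulrC.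
by rewrite re_partM im_partM !(re_ofR, im_ofR, re_imagi, im_imagi); split; ring.
Qed.

Lemma twopii_neq0 : (twopii : C) != 0.
Proof.
apply/eqP => h; have := twopiiE.2; rewrite h => /esym/eqP.
by rewrite mulf_eq0 gt_eqF //= gt_eqF // pi_gt0.
Qed.

Lemma nr_qpar tau : nr (qpar tau) = expR (- (2 * pi * im_part tau)).
Proof. by rewrite nr_cexp re_partM !twopiiE.1 twopiiE.2 mul0r sub0r. Qed.

Lemma qpar_lt1 tau : upper_half_plane tau -> nr (qpar tau) < 1.
Proof.
by move=> h; rewrite nr_qpar expR_lt1 oppr_lt0 !mulr_gt0 // pi_gt0.
Qed.

Lemma near_H tau : upper_half_plane tau -> \near tau, upper_half_plane tau.
Proof.
move=> h; apply/nbhsCP; exists (im_part tau) => // w wt.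
rewrite /upper_half_plane /=; have := im_le_nr (w - tau).
by rewrite im_partD im_partN ler_norml => /andP[? _]; lra.
Qed.

Lemma qpar_CD tau : CD qpar tau (twopii * qpar tau).
Proof.
rewrite mulrC; apply: CD_comp (cexp_CD _).
by apply: (CD_eq (CD_scale twopii (CD_id tau))); rewrite mulr1.
Qed.

Lemma psum_qpar_CD u tau : rad 1 u -> upper_half_plane tau ->
  CD (fun t => psum u (qpar t)) tau (twopii * psum (fun n => n%:R * u n) (qpar tau)).
Proof.
move=> ru h; have q1 := qpar_lt1 h.
apply: (CD_eq (CD_comp (qpar_CD tau) (psum_CD ru q1))).
by rewrite -(psum_theta ru q1); ring.
Qed.

Lemma E2E tau : upper_half_plane tau -> E2 tau = psum (e2c C) (qpar tau).
Proof.
by move=> /qpar_lt1 q1; rewrite psum_e2c // (psum_recl (rad_sig 1) q1) add0r.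
Qed.

Lemma E4E tau : upper_half_plane tau -> E4 tau = psum (e4c C) (qpar tau).
Proof.
by move=> /qpar_lt1 q1; rewrite psum_e4c // (psum_recl (rad_sig 3) q1) add0r.
Qed.

Lemma H_double tau : upper_half_plane tau -> upper_half_plane (2 * tau).
Proof.
rewrite /upper_half_plane /= im_partM (_ : (2 : C) = ofR 2); last by rewrite /ofR rmorph_nat.
by rewrite re_ofR im_ofR mul0r addr0 => h; rewrite mulr_gt0.
Qed.

Lemma qpar_double tau : qpar (2 * tau) = qpar tau ^+ 2.
Proof. by rewrite /qpar mulrCA cexp_natM. Qed.

Lemma E2_double tau : upper_half_plane tau -> E2 (2 * tau) = psum (dil 2 (e2c C)) (qpar tau).
Proof.
move=> h; rewrite E2E ?qpar_double; last exact: H_double.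
by rewrite psum_dil //; [exact: rad_e2c | exact: qpar_lt1].
Qed.

Lemma E4_double tau : upper_half_plane tau -> E4 (2 * tau) = psum (dil 2 (e4c C)) (qpar tau).
Proof.
move=> h; rewrite E4E ?qpar_double; last exact: H_double.
by rewrite psum_dil //; [exact: rad_e4c | exact: qpar_lt1].
Qed.

Lemma GfunE tau : upper_half_plane tau -> Gfun tau = psum (gc C) (qpar tau).
Proof.
move=> h; have q1 := qpar_lt1 h; have rd : rad 1 (dil 2 (e2c C)) by apply: rad_dil => //; exact: rad_e2c.
rewrite /Gfun E2_double // E2E //.
rewrite (psum_ext (u := gc C) (v := fun n => 2 * dil 2 (e2c C) n + (- 1) * e2c C n)); last first.
  by move=> n; rewrite /gc mulN1r.
rewrite (psumD (rad_scale _ rd) (rad_scale _ rad_e2c) q1).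
by rewrite (psumZ _ rd q1) (psumZ _ rad_e2c q1) mulN1r addrC.
Qed.

Lemma Gfun_sqr tau : upper_half_plane tau -> 5 * Gfun tau ^+ 2 = E4 tau + 4 * E4 (2 * tau).
Proof.
move=> h; have q1 := qpar_lt1 h; have rd : rad 1 (dil 2 (e4c C)) by apply: rad_dil => //; exact: rad_e4c.
rewrite GfunE // E4_double // E4E // expr2 (psumM rad_gc rad_gc q1).
rewrite -(psumZ _ rd q1) -(psumD rad_e4c (rad_scale _ rd) q1).
have rc := rad_conv rad_gc rad_gc.
by rewrite -(psumZ _ rc q1); apply: psum_ext => n; rewrite conv_gc.
Qed.

Lemma E2_CD tau : upper_half_plane tau ->
  CD E2 tau (twopii * ((E2 tau ^+ 2 - E4 tau) / 12)).
Proof.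
move=> h; have q1 := qpar_lt1 h; have := psum_qpar_CD rad_e2c h.
set D := psum _ (qpar tau) => H.
have eD : E2 tau ^+ 2 = 12 * D + E4 tau.
  rewrite E2E // E4E // expr2 (psumM rad_e2c rad_e2c q1) /D.
  rewrite -(psumZ _ (rad_nat rad_e2c) q1) -(psumD (rad_scale _ (rad_nat rad_e2c)) rad_e4c q1).
  by apply: psum_ext => n; rewrite conv_e2c mulrA.
apply: (CD_near (f := fun t => psum (e2c C) (qpar t))).
  by apply: filterS (near_H h) => t ht; rewrite E2E.
by apply: (CD_eq H); rewrite eD; field.
Qed.

Lemma E4_CD tau : upper_half_plane tau ->
  CD E4 tau (twopii * ((E2 tau * E4 tau + 3 * Gfun tau * E4 tau - 4 * Gfun tau ^+ 3) / 3)).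
Proof.
move=> h; have q1 := qpar_lt1 h; have := psum_qpar_CD rad_e4c h.
have rd : rad 1 (dil 2 (e4c C)) by apply: rad_dil => //; exact: rad_e4c.
set D := psum _ (qpar tau) => H.
have r4 := rad_add rad_e4c (rad_scale 4 rd).
have eD : 5 * (E2 tau * E4 tau) + 15 * (Gfun tau * E4 tau) =
    4 * (Gfun tau * (E4 tau + 4 * E4 (2 * tau))) + 15 * D.
  rewrite E2E // E4_double // E4E // GfunE //.
  rewrite -(psumZ _ rd q1) -(psumD rad_e4c (rad_scale _ rd) q1).
  rewrite (psumM rad_e2c rad_e4c q1) (psumM rad_gc rad_e4c q1) (psumM rad_gc r4 q1).
  have c1 := rad_conv rad_e2c rad_e4c; have c2 := rad_conv rad_gc rad_e4c.
  have c3 := rad_conv rad_gc r4; have c4 := rad_nat rad_e4c.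
  rewrite -(psumZ _ c1 q1) -(psumZ _ c2 q1) -(psumZ _ c3 q1) /D -(psumZ _ c4 q1).
  rewrite -(psumD (rad_scale _ c1) (rad_scale _ c2) q1).
  rewrite -(psumD (rad_scale _ c3) (rad_scale _ c4) q1).
  apply: psum_ext => n; have := conv_e2c_e4c C n => e.
  move/eqP : e; rewrite -subr_eq0 => /eqP e.
  by apply/eqP; rewrite -subr_eq0 -[X in _ == X]e; apply/eqP; ring.
apply: (CD_near (f := fun t => psum (e4c C) (qpar t))).
  by apply: filterS (near_H h) => t ht; rewrite E4E.
apply: (CD_eq H); congr (_ * _).
have -> : D = (5 * (E2 tau * E4 tau) + 15 * (Gfun tau * E4 tau)
    - 4 * (Gfun tau * (E4 tau + 4 * E4 (2 * tau)))) / 15.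
  by rewrite eD addrAC subrr add0r mulrC mulKf // pnatr_eq0.
by rewrite -Gfun_sqr //; move: (E2 tau) (E4 tau) (Gfun tau) => x y g; field.
Qed.

Lemma Gfun_CD tau : upper_half_plane tau ->
  CD Gfun tau (twopii * (E2 tau * Gfun tau / 6 + E4 tau / 6 - Gfun tau ^+ 2 / 3)).
Proof.
move=> h; have h2 := H_double h.
have d2 : CD (fun t : C => 2 * t) tau 2.
  by apply: (CD_eq (CD_scale 2 (CD_id tau))); rewrite mulr1.
have := CD_add (CD_opp (E2_CD h)) (CD_scale 2 (CD_comp d2 (E2_CD h2))).
move=> H; apply: (CD_eq H).
(* The values at 2 tau are eliminated through the definition of G and through 5 G^2 = E4 + 4 E4(2
   tau), which leaves a polynomial in E2, E4 and G. *)
have -> : E2 (2 * tau) = (Gfun tau + E2 tau) / 2.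
  by rewrite /Gfun; move: (E2 tau) (E2 (2 * tau)) => x y; field.
have -> : E4 (2 * tau) = (5 * Gfun tau ^+ 2 - E4 tau) / 4.
  by rewrite Gfun_sqr //; move: (E4 tau) (E4 (2 * tau)) => x y; field.
by move: (E2 tau) (E4 tau) (Gfun tau) twopii => x y g p; field.
Qed.

End q_series.

(** * Logarithm of the eta product *)

Section eta_function.
Context {R : realType}.
Local Notation C := (Cx R).
Implicit Types (z w tau : C).

(* The coefficients of - log (1 - z), including the junk value 0^-1 = 0 at n = 0. *)
Definition log1c (n : nat) : C := n%:R^-1.

Lemma rad_log1c : rad 1 log1c.
Proof.
apply: (rad_le (rad_cst 1) ler01) => -[|n]; rewrite nr1 mul1r /log1c ?invr0 ?nr0 //.
by rewrite nrV nr_nat invf_le1 // ler1n.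
Qed.

Lemma psum_geom z : nr z < 1 -> psum (fun=> 1) z * (1 - z) = 1.
Proof.
move=> z1; have r1 := @rad_cst R 1.
have : psum (fun=> 1) z = 1 + z * psum (fun=> 1) z.
  rewrite {1}(psum_recl r1 z1); congr (_ + _); rewrite -(psumZ z r1 z1) /psum.
  rewrite (_ : (fun n => 1 * _) = (fun n => z * 1 * z ^+ n)) //.
  by apply/funext => n; rewrite mul1r mulr1 exprS.
move: (psum _ z) => x e; rewrite mulrBr mulr1 [x * z]mulrC {1}e; ring.
Qed.

(** The product of 1 - w with the exponential of the series has derivative 0, the derived series
    being geometric, so it keeps its value 1 at w = 0. No branch of the logarithm has to be
    chosen. *)
Lemma cexp_log1 z : nr z < 1 -> 1 - z = cexp (- psum log1c z).
Proof.
move=> z1; pose f w := cexp (psum log1c w) * (1 - w).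
have fCD w : nr w < 1 -> CD f w 0.
  move=> w1; have d1 := psum_CD rad_log1c w1.
  have d2 := CD_comp d1 (cexp_CD _).
  have d3 := CD_mul d2 (CD_sub (CD_cst w 1) (CD_id w)).
  apply: (CD_eq d3).
  rewrite (psum_ext (u := der log1c) (v := fun=> 1)); last by move=> n; rewrite /der /log1c divff // pnatr_eq0.
  rewrite -mulrA psum_geom //; ring.
have : nr (f z - f 0) <= 0 * nr (z - 0).
  apply: (@mvi R f (fun=> 0)) => t /andP[t0 t1]; last by rewrite nr0.
  apply: fCD; rewrite add0r subr0 nrM nr_ofR ger0_norm //.
  by apply: le_lt_trans z1; rewrite ler_piMl ?nr_ge0.
rewrite mul0r => h.
have /eqP : nr (f z - f 0) == 0 by rewrite eq_le h nr_ge0.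
move=> /eqP; rewrite nr_eq0 subr_eq0 => /eqP.
rewrite /f psum0 /log1c invr0 cexp0 subr0 mulr1 => e.
by rewrite cexpN; apply: (mulfI (cexp_neq0 (psum log1c z))); rewrite e divff // cexp_neq0.
Qed.

(** For m > 0 this is m times the coefficient of z^m in - log of the product of 1 - z^n over 1 <= n
    <= N: a divisor n = m / k contributes 1 / k = n / m. *)
Definition part (N m : nat) : nat := (\sum_(1 <= n < N.+1 | n %| m) n)%N.

Lemma sigma1_part m : (0 < m)%N -> sigma 1 m = part m m.
Proof.
move=> m0; rewrite /sigma /part; under eq_bigr do rewrite expn1.
rewrite -[RHS]big_filter; apply: perm_big; apply: uniq_perm.
- exact: divisors_uniq.
- by rewrite filter_uniq // iota_uniq.
move=> d; rewrite mem_filter mem_index_iota -dvdn_divisors // ltnS.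
by case: (boolP (d %| m)%N) => //= dm; rewrite (dvdn_gt0 m0 dm) dvdn_leq.
Qed.

Lemma part_ge N m : (0 < m <= N)%N -> part N m = sigma 1 m.
Proof.
move=> /andP[m0 mN]; rewrite sigma1_part // /part (big_cat_nat (n := m.+1)) //=.
rewrite [X in (_ + X)%N]big_nat_cond [X in (_ + X)%N]big_pred0 ?addn0 // => n.
by apply/negP => /andP[/andP[mn _] nm]; have := dvdn_leq m0 nm; lia.
Qed.

Lemma part_le N m : (0 < m)%N -> (part N m <= sigma 1 m)%N.
Proof.
move=> m0; have [mN|Nm] := leqP m N; first by rewrite part_ge ?m0.
rewrite sigma1_part // /part [leqRHS](big_cat_nat (n := N.+1)) //=; last by rewrite ltnW.
exact: leq_addr.
Qed.

(* - log of the Euler product: prod (1 - q^n) = exp (- sum_n etac n q^n). *)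
Definition etac (n : nat) : C := sig C 1 n / n%:R.

Lemma rad_etac : rad 1 etac.
Proof.
apply: (rad_le (rad_sig 1) ler01) => -[|n]; first by rewrite /etac mul0r nr0 mul1r.
by rewrite /etac nrM nrV mul1r ler_piMr ?nr_ge0 // nr_nat invf_le1 ?ltr0n // ler1n.
Qed.

(** The radius belongs to the conclusion because the induction step adds two power series. *)
Lemma sum_log1 N z : nr z < 1 ->
  \sum_(1 <= n < N.+1) psum log1c (z ^+ n) = psum (fun m => (part N m)%:R / m%:R) z /\
  rad 1 (fun m => (part N m)%:R / m%:R : C).
Proof.
move=> z1; elim: N => [|N [IH IHr]].
  have e : (fun m => (part 0 m)%:R / m%:R : C) = (fun m => 0 * 1).
    by apply/funext => m; rewrite /part big_geq // !mul0r.
  by rewrite e (psumZ _ (rad_cst 1) z1) mul0r big_geq //; split => //; exact: rad_scale (rad_cst 1).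
have rd := rad_dil (ltn0Sn N) rad_log1c.
have e : (fun m => (part N.+1 m)%:R / m%:R : C) =
    (fun m => (part N m)%:R / m%:R + dil N.+1 log1c m).
  apply/funext => m; rewrite /part big_mkcond big_nat_recr //= -big_mkcond natrD mulrDl.
  congr (_ + _); rewrite /dil /log1c; case: ifP => [/dvdnP[k ->]|_]; last by rewrite mul0r.
  rewrite mulnK // natrM; have [->|k0] := eqVneq k 0%N; first by rewrite mul0r !invr0 mulr0.
  by field; rewrite pnatr_eq0 k0 /= -[1 + _]/(1 + N%:R) addrC natr1 pnatr_eq0.
split; last by rewrite e; exact: rad_add.
rewrite big_nat_recr; last exact: ltn0Sn.
by rewrite /= IH e (psumD IHr rd z1) (psum_dil (ltn0Sn N) rad_log1c z1).
Qed.

Lemma geom_sum_le (s : R) n : 0 <= s < 1 -> \sum_(0 <= k < n) s ^+ k <= (1 - s)^-1.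
Proof.
move=> /andP[s0 s1]; have s10 : 0 < 1 - s by rewrite subr_gt0.
have : \sum_(0 <= k < n) s ^+ k = (1 - s ^+ n) / (1 - s).
  have := @geometric_seriesE R 1 s; rewrite lt_eqF // => /(_ isT) /(congr1 (fun f => f n)).
  by rewrite /series /= mul1r => <-; apply: eq_bigr => i _; rewrite mul1r.
by move=> ->; rewrite ler_pdivrMr // mulVf ?gt_eqF // gerBl exprn_ge0.
Qed.

Lemma sum_log1_cvg z : nr z < 1 ->
  (fun N => \sum_(1 <= n < N.+1) psum log1c (z ^+ n)) @ \oo --> psum etac z.
Proof.
move=> z1; have [K [rho [K0 /andP[r0 r1] HK]]] := rad_geom rad_etac z1.
(* For m > N the bound rho^m = s^m s^m is at most s^N s^m, where s^N tends to 0 and s^m is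
   summable. *)
pose s := Num.sqrt rho.
have s0 : 0 <= s by exact: sqrtr_ge0.
have ss : s ^+ 2 = rho by rewrite sqr_sqrtr.
have s1 : s < 1 by rewrite -(@expr_lt1 _ 2) // ss.
have s01 : 0 <= s < 1 by rewrite s0.
apply/cvgCPle => e e0; apply: filterS (geom_cvg0 (K / (1 - s)) s01 e0) => N; apply: le_trans.
have [-> rp] := sum_log1 N z1.
pose w m := etac m + (- 1) * ((part N m)%:R / m%:R).
have rw : rad 1 w by apply: rad_add rad_etac (rad_scale _ rp).
have -> : psum etac z - psum (fun m => (part N m)%:R / m%:R) z = psum w z.
  by rewrite (psumD rad_etac (rad_scale _ rp) z1) (psumZ _ rp z1) mulN1r.
apply: (nr_lim_le (psum_cvg rw z1)) => n; rewrite /series /=.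
apply: (le_trans (nr_sum _ _ _)).
(* The coefficient [w m] vanishes for m <= N, and for m > N it is dominated by [etac m], since
   [part N m] lies between 0 and sigma_1(m). *)
have term m : nr (w m * z ^+ m) <= K * s ^+ N * s ^+ m.
  have B0 : 0 <= K * s ^+ N * s ^+ m by rewrite !mulr_ge0 ?exprn_ge0.
  case: m B0 => [|m] B0; first by rewrite /w /etac !invr0 !mulr0 addr0 mul0r nr0.
  have wE : w m.+1 = (sigma 1 m.+1 - part N m.+1)%N%:R / m.+1%:R.
    by rewrite natrB ?part_le // /w /etac /=; field; rewrite -[1 + _]/(1 + m%:R) addrC natr1 pnatr_eq0.
  have [mN|Nm] := leqP m.+1 N.
    by rewrite wE part_ge // subnn !mul0r nr0.
  apply: le_trans (_ : nr (etac m.+1 * z ^+ m.+1) <= _).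
    rewrite !nrM ler_wpM2r ?nr_ge0 // wE /etac !nrM ler_wpM2r ?nr_ge0 // !nr_nat ler_nat.
    exact: leq_subr.
  apply: (le_trans (HK _)); rewrite -mulrA ler_wpM2l // -ss -exprM mulnC exprM expr2.
  by rewrite ler_wpM2r ?exprn_ge0 // (ler_wiXn2l s0 (ltW s1)) // ltnW.
apply: le_trans (_ : \sum_(0 <= m < n) K * s ^+ N * s ^+ m <= _); first exact: ler_sum.
rewrite -mulr_sumr [leRHS]mulrAC ler_wpM2l ?mulr_ge0 ?exprn_ge0 //.
exact: geom_sum_le.
Qed.

Lemma etaE tau : upper_half_plane tau ->
  eta tau = cexp (twopii * tau / 24 - psum etac (qpar tau)).
Proof.
move=> h; have q1 := qpar_lt1 h; rewrite cexpD; congr (_ * _).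
have pE N : \prod_(1 <= n < N.+1) (1 - qpar tau ^+ n) =
    cexp (- \sum_(1 <= n < N.+1) psum log1c (qpar tau ^+ n)).
  rewrite -sumrN cexp_sum big_nat_cond [RHS]big_nat_cond; apply: eq_bigr => n /andP[/andP[n0 _] _].
  by apply: cexp_log1; rewrite nrX exprn_ilt1 ?nr_ge0 // -lt0n.
apply: cvg_lim => //; rewrite (_ : (fun N => _) = (fun N =>
   cexp (- \sum_(1 <= n < N.+1) psum log1c (qpar tau ^+ n)))); last exact/funext.
apply: (@cvg_comp _ _ _ (fun N => - \sum_(1 <= n < N.+1) psum log1c (qpar tau ^+ n)) cexp).
  by apply: cvgN; exact: sum_log1_cvg.
exact: CD_cvg (cexp_CD _).
Qed.

Lemma eta_neq0 tau : upper_half_plane tau -> eta tau != 0.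
Proof. by move=> h; rewrite etaE // cexp_neq0. Qed.

Lemma eta_CD tau : upper_half_plane tau -> CD eta tau (eta tau * (twopii * E2 tau / 24)).
Proof.
move=> h; have q1 := qpar_lt1 h.
apply: (CD_near (f := fun t => cexp (twopii * t / 24 - psum etac (qpar t)))).
  by apply: filterS (near_H h) => t ht; rewrite etaE.
have d1 : CD (fun t : C => twopii * t / 24) tau (twopii / 24).
  rewrite (_ : (fun t => _) = (fun t => twopii / 24 * t)); last by apply/funext => t; rewrite mulrAC.
  by apply: (CD_eq (CD_scale _ (CD_id tau))); rewrite mulr1.
have d2 := CD_comp (CD_sub d1 (psum_qpar_CD rad_etac h)) (cexp_CD _).
apply: (CD_eq d2); rewrite etaE //; congr (_ * _).
rewrite E2E // psum_e2c // (psum_ext (u := fun n => n%:R * etac n) (v := sig C 1)).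
  by move: (psum _ _) twopii => x p; field.
move=> [|n]; first by rewrite mul0r.
by rewrite /etac mulrCA divff ?mulr1 // pnatr_eq0.
Qed.

(** Writing f' as f a makes the formula uniform in the sign of k, which decides whether a power or
    its inverse is differentiated. *)
Lemma CD_exprz_inv (f : C -> C) z a (k : int) : f z != 0 -> CD f z (f z * a) ->
  CD (fun x => (f x ^ k)^-1) z (- (k%:~R) * a * (f z ^ k)^-1).
Proof.
move=> f0 df; case: k => n.
  have dn := CD_inv (CD_exp n df) (expf_neq0 n f0).
  apply: (CD_eq dn); rewrite /exprz -pmulrn; case: n {dn} => [|n]; first by rewrite !mul0r oppr0 !mul0r.
  rewrite -[n.+1.-1]/n [f z ^+ n.+1]exprS; move: (expf_neq0 n f0); move: (f z ^+ n) => y y0.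
  by rewrite -[1 *- n.+1]/(- n.+1%:R); move: (n.+1%:R : C) => m; field; rewrite f0 y0.
rewrite (_ : (fun x => _) = (fun x => f x ^+ n.+1)); last first.
  by apply/funext => x; rewrite /exprz invrK.
apply: (CD_eq (CD_exp n.+1 df)); rewrite /exprz invrK NegzE mulrNz opprK -pmulrn /= exprS.
by move: (f z ^+ n) => y; ring.
Qed.

End eta_function.

(** * Regularity of modular forms *)

Section vector_derivative.
Context {R : realType}.
Local Notation C := (Cx R).

Lemma mx_cvgP (m n : nat) (T : Type) (F : set_system T) {FF : Filter F}
    (f : T -> 'M[C]_(m, n)) (M : 'M[C]_(m, n)) :
  f @ F --> M <-> forall i j, (fun x => f x i j) @ F --> M i j.
Proof.
split=> [fM i j|fM].
  by apply: (@cvg_comp _ _ _ f (fun N : 'M[C]_(m, n) => N i j) F (nbhs M)) => //; exact: coord_continuous.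
apply/cvg_ballP => e e0.
have : \forall x \near F, forall (ij : 'I_m * 'I_n), ball (M ij.1 ij.2) e (f x ij.1 ij.2).
  apply: filter_forall => -[i j] /=.
  by have /cvg_ballP/(_ e e0) := fM i j.
by apply: filterS => x H; split => // i j; exact: (H (i, j)).
Qed.

Lemma CD_colP (F : C -> 'cV[C]_2) z (l : 'cV[C]_2) :
  is_derive (z : C) (1 : C) F l <-> forall i, CD (fun x => F x i 0) z (l i 0).
Proof.
pose q (h : C) := h^-1 *: ((F \o shift z) (h *: (1 : C)) - F z).
pose qi (i : 'I_2) (h : C) := h^-1 *: (((fun x => F x i 0) \o shift z) (h *: (1 : C)) - F z i 0).
have qE i h : q h i 0 = qi i h by rewrite /q /qi !mxE.
split=> [[dF dl] i|H].
  have ql : q @ 0^' --> l by rewrite -dl; exact: dF.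
  have qil : qi i @ 0^' --> l i 0.
    have /mx_cvgP/(_ i 0) := ql.
    by rewrite (_ : (fun x => q x i 0) = qi i) //; apply/funext => h; exact: qE.
  by split; [apply: cvgP qil | apply: cvg_lim qil].
have ql : q @ 0^' --> l.
  apply/mx_cvgP => i j; rewrite ord1; have [di dl] := H i.
  rewrite (_ : (fun x => q x i 0) = qi i); last by apply/funext => h; exact: qE.
  by rewrite -dl; exact: di.
by split; [apply: cvgP ql | apply: cvg_lim ql].
Qed.

Lemma derivable_col (F : C -> 'cV[C]_2) z i :
  derivable F z 1 -> CD (fun x => F x i 0) z (derive1 F z i 0).
Proof.
move=> dF; apply: (iffLR (CD_colP F z (derive1 F z))).
by split; [exact: dF | rewrite derive1E].
Qed.

Lemma derive1_col (F : C -> 'cV[C]_2) z (l : 'I_2 -> C) i :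
  (forall i, CD (fun x => F x i 0) z (l i)) -> derive1 F z i 0 = l i.
Proof.
move=> H; have : is_derive z 1 F (\col_i l i) by apply/CD_colP => j; rewrite mxE.
by rewrite derive1E => -[_ ->]; rewrite mxE.
Qed.

End vector_derivative.

Lemma sum2E (V : nmodType) (F : 'I_2 -> V) : \sum_k F k = F 0 + F 1.
Proof. by rewrite big_ord_recl big_ord1; congr (_ + F _); exact: val_inj. Qed.

Lemma ord2P (j : 'I_2) : j = 0 \/ j = 1.
Proof. by case: j => -[|[|//]] h; [left|right]; exact: val_inj. Qed.

(** * Entries of exp(t L) as entire series *)

Section matrix_exponential.
Context {R : realType}.
Local Notation C := (Cx R).
Variable L : 'M[C]_2.

Definition expmx_coef (i j : 'I_2) (n : nat) : C := (L ^+ n) i j / n`!%:R.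

Lemma pow_fact_bounded (x : R) : 0 <= x -> exists K : R, forall n, x ^+ n / n`!%:R <= K.
Proof.
move=> x0; have := cvg_series_bounded (is_cvg_series_exp_coeff x).
move=> /bounded_fun_has_ubound[K HK]; exists K => n; apply: HK; exists n => //.
Qed.

Lemma rad_expmx i j r : rad r (expmx_coef i j).
Proof.
(* The factor 2 in [B] is the size of the matrices: each entry of L^(n+1) is a sum of two
   products. *)
move=> s /andP[s0 _]; pose M := \sum_i \sum_j nr (L i j); pose B := 2 * M.
have LM k l : nr (L k l) <= M.
  rewrite /M (bigD1 k) //= (bigD1 l) //= -addrA lerDl addr_ge0 //.
    by apply: sumr_ge0 => *; exact: nr_ge0.
  by apply: sumr_ge0 => *; apply: sumr_ge0 => *; exact: nr_ge0.
have M0 : 0 <= M by apply: le_trans (LM 0 0); exact: nr_ge0.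
have LB n k l : nr ((L ^+ n) k l) <= B ^+ n.
  elim: n k l => [|n IH] k l.
    rewrite !expr0 mxE; case: (k == l); by rewrite ?nr1 ?nr0.
  rewrite !exprS mxE; apply: (le_trans (nr_sum _ _ _)).
  apply: le_trans (_ : \sum_(p < 2) M * B ^+ n <= _).
    by apply: ler_sum => p _; rewrite nrM; apply: ler_pM; rewrite ?nr_ge0 ?LM ?IH.
  by rewrite sumr_const card_ord -[_ *+ 2]mulr_natl mulrA.
have [|K HK] := @pow_fact_bounded (B * s); first by rewrite !mulr_ge0.
exists K => n; apply: le_trans (HK n); rewrite /expmx_coef nrM nrV nr_nat exprMn mulrAC.
by rewrite ler_wpM2r ?invr_ge0 // ler_wpM2r ?exprn_ge0.
Qed.

Lemma expmxE (t : C) i j : expmx (t *: L) i j = psum (expmx_coef i j) t.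
Proof.
have ent N k l : series (fun n => (n`!%:R)^-1 *: (t *: L) ^+ n) N k l =
    series (fun n => expmx_coef k l n * t ^+ n) N.
  rewrite /series /= summxE; apply: eq_bigr => n _.
  rewrite exprZn !mxE /expmx_coef; ring.
have H : series (fun n => (n`!%:R)^-1 *: (t *: L) ^+ n) @ \oo -->
    \matrix_(i, j) psum (expmx_coef i j) t.
  apply/mx_cvgP => k l; rewrite mxE.
  rewrite (_ : (fun N => _) = series (fun n => expmx_coef k l n * t ^+ n)).
    by apply: (@psum_cvg _ (nr t + 1)); [exact: rad_expmx | rewrite ltrDl].
  by apply/funext => N; exact: ent.
by rewrite /expmx (cvg_lim _ H) // mxE.
Qed.

Let P (t : C) := expmx (t *: L).

Let psumS u (t : C) : (forall r, rad r u) -> forall c, psum (fun n => u n * c) t = psum u t * c.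
Proof.
move=> ru c; rewrite (psum_ext (v := fun n => c * u n)); last by move=> n; rewrite mulrC.
by rewrite (@psumZ _ (nr t + 1)) 1?mulrC //; rewrite ltrDl.
Qed.

Lemma expmx_der_coef i j n :
  der (expmx_coef i j) n = \sum_k expmx_coef i k n * L k j /\
  der (expmx_coef i j) n = \sum_k expmx_coef k j n * L i k.
Proof.
have f0 : n.+1%:R * (n.+1)`!%:R^-1 = n`!%:R^-1 :> C.
  by rewrite factS natrM invfM mulrA divff ?mul1r // pnatr_eq0.
have E : der (expmx_coef i j) n = (L ^+ n.+1) i j * n`!%:R^-1.
  by rewrite /der /expmx_coef mulrCA f0.
split; rewrite E; [rewrite exprSr | rewrite exprS]; rewrite mxE mulr_suml.
  by apply: eq_bigr => k _; rewrite /expmx_coef mulrAC.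
by apply: eq_bigr => k _; rewrite /expmx_coef -mulrA mulrC.
Qed.

Lemma expmx_CD t i j : CD (fun t => P t i j) t ((P t *m L) i j).
Proof.
rewrite (_ : (fun t => _) = psum (expmx_coef i j)); last by apply/funext => s; rewrite /P expmxE.
have t1 : nr t < nr t + 1 by rewrite ltrDl.
apply: (CD_eq (psum_CD (@rad_expmx i j _) t1)).
rewrite (psum_ext (v := fun n => expmx_coef i 0 n * L 0 j + expmx_coef i 1 n * L 1 j)); last first.
  by move=> n; rewrite (expmx_der_coef i j n).1 sum2E.
have rs k : forall r, rad r (fun n => expmx_coef i k n * L k j).
  move=> r; rewrite (_ : (fun n => _) = (fun n => L k j * expmx_coef i k n)).
    exact: rad_scale (@rad_expmx i k r).
  by apply/funext => n; rewrite mulrC.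
rewrite (psumD (rs 0 _) (rs 1 _) t1) !psumS; [| exact: rad_expmx ..].
by rewrite mxE sum2E /P !expmxE.
Qed.

(** Both sides are the derivative of exp(t L), read off from L^(n+1) = L^n L and from L^(n+1) = L
    L^n. *)
Lemma expmx_comm t : P t *m L = L *m P t.
Proof.
apply/matrixP => i j; have t1 : nr t < nr t + 1 by rewrite ltrDl.
have rs k : forall r, rad r (fun n => expmx_coef k j n * L i k).
  move=> r; rewrite (_ : (fun n => _) = (fun n => L i k * expmx_coef k j n)).
    exact: rad_scale (@rad_expmx k j r).
  by apply/funext => n; rewrite mulrC.
have e : psum (der (expmx_coef i j)) t = (L *m P t) i j.
  rewrite (psum_ext (v := fun n => expmx_coef 0 j n * L i 0 + expmx_coef 1 j n * L i 1)); last first.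
    by move=> n; rewrite (expmx_der_coef i j n).2 sum2E.
  rewrite (psumD (rs 0 _) (rs 1 _) t1) !psumS; [| exact: rad_expmx ..].
  by rewrite mxE sum2E /P !expmxE [L i 0 * _]mulrC [L i 1 * _]mulrC.
rewrite -e; apply: CD_unique (expmx_CD t i j) _.
rewrite (_ : (fun t => _) = psum (expmx_coef i j)); last by apply/funext => s; rewrite /P expmxE.
exact: psum_CD (@rad_expmx i j _) t1.
Qed.

Lemma expmx0 : P 0 = 1.
Proof.
by apply/matrixP => i j; rewrite /P expmxE psum0 /expmx_coef expr0 fact0 divr1.
Qed.

(** The entries of exp(- s L) exp(s L) have derivative 0, since L commutes with exp(s L). *)
Lemma expmx_inv t : P (- t) *m P t = 1.
Proof.
pose Q s := P (- s) *m P s.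
have dN (s : C) : CD (fun s : C => - s) s (- 1) := CD_opp (CD_id s).
have dQ s i j : CD (fun s => Q s i j) s 0.
  have term k : CD (fun s => P (- s) i k * P s k j) s
     ((P (- s) *m L) i k * (- 1) * P s k j + P (- s) i k * (P s *m L) k j).
    exact: CD_mul (CD_comp (dN s) (expmx_CD (- s) i k)) (expmx_CD s k j).
  have := CD_add (term 0) (term 1).
  rewrite (_ : (fun x => _) = (fun s => Q s i j)); last first.
    by apply/funext => x; rewrite /Q mxE sum2E.
  move=> H; apply: (CD_eq H).
  have : (P (- s) *m L *m P s) i j = (P (- s) *m (P s *m L)) i j.
    by rewrite -mulmxA -(expmx_comm s).
  rewrite [LHS]mxE [RHS]mxE !sum2E => e.
  move/eqP : e; rewrite -subr_eq0 => /eqP e; apply/eqP.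
  by rewrite -oppr_eq0 -[X in _ == X]e; apply/eqP; ring.
have Qt i j : Q t i j = Q 0 i j.
  apply/eqP; rewrite -subr_eq0 -nr_eq0 eq_le nr_ge0 andbT -[leRHS](mul0r (nr (t - 0))).
  by apply: (@mvi R (fun s => Q s i j) (fun=> 0)) => s _; rewrite ?nr0.
have -> : P (- t) *m P t = Q 0 by apply/matrixP => i j; exact: Qt.
by rewrite /Q oppr0 expmx0 mulmx1.
Qed.

End matrix_exponential.

(** * Second derivatives of modular forms *)

Section twice_derivable.
Context {R : realType}.
Local Notation C := (Cx R).
Implicit Types (f g : C -> C).

Definition CD2 f := exists f1 f2 : C -> C,
  forall tau, upper_half_plane tau -> CD f tau (f1 tau) /\ CD f1 tau (f2 tau).

Lemma CD2_eq f g : (forall tau, upper_half_plane tau -> f tau = g tau) -> CD2 f -> CD2 g.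
Proof.
move=> fg [f1 [f2 H]]; exists f1, f2 => tau h; have [d1 d2] := H _ h; split => //.
by apply: (CD_near _ d1); apply: filterS (near_H h) => t ht; exact: fg.
Qed.

Lemma CD2_add f g : CD2 f -> CD2 g -> CD2 (fun t => f t + g t).
Proof.
move=> [f1 [f2 H]] [g1 [g2 H']].
exists (fun t => f1 t + g1 t), (fun t => f2 t + g2 t) => tau h.
by have [? ?] := H _ h; have [? ?] := H' _ h; split; exact: CD_add.
Qed.

Lemma CD2_mul f g : CD2 f -> CD2 g -> CD2 (fun t => f t * g t).
Proof.
move=> [f1 [f2 H]] [g1 [g2 H']].
exists (fun t => f1 t * g t + f t * g1 t),
  (fun t => f2 t * g t + f1 t * g1 t + (f1 t * g1 t + f t * g2 t)) => tau h.
have [a1 a2] := H _ h; have [b1 b2] := H' _ h; split; first exact: CD_mul.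
by apply: CD_add; exact: CD_mul.
Qed.

Lemma CD2_psum_qpar (u : nat -> C) : rad 1 u -> CD2 (fun t => psum u (qpar t)).
Proof.
move=> ru; pose u1 n := n%:R * u n; pose u2 n := n%:R * u1 n.
exists (fun t => twopii * psum u1 (qpar t)), (fun t => twopii * (twopii * psum u2 (qpar t))) => tau h.
split; first exact: psum_qpar_CD.
by apply: CD_scale; apply: psum_qpar_CD => //; exact: rad_nat.
Qed.

Lemma CD2_psum_lin (u : nat -> C) (c : C) : (forall r, rad r u) -> CD2 (fun t => psum u (c * t)).
Proof.
move=> ru.
have d (v : nat -> C) (t : C) : (forall r, rad r v) ->
    CD (fun t => psum v (c * t)) t (psum (der v) (c * t) * c).
  move=> rv; apply: CD_comp.
    by apply: (CD_eq (CD_scale c (CD_id t))); rewrite mulr1.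
  by apply: (@psum_CD _ (nr (c * t) + 1)) => //; rewrite ltrDl.
exists (fun t => c * psum (der u) (c * t)), (fun t => c * (psum (der (der u)) (c * t) * c)) => tau h.
split; first by rewrite mulrC; exact: d.
by apply: CD_scale; apply: d => r; exact: rad_der.
Qed.

Lemma cvg_eqfun (f g : nat -> C) (l : C) : f =1 g -> f @ \oo --> l -> g @ \oo --> l.
Proof. by move=> /funext ->. Qed.

Lemma cvg0_bounded (u : nat -> C) : u @ \oo --> 0 -> exists K : R, forall n, nr (u n) <= K.
Proof.
move=> /cvgCPle/(_ 1 ltr01)[N _ H]; exists (1 + \sum_(k < N) nr (u k)) => n.
have S0 (P : pred 'I_N) : 0 <= \sum_(k < N | P k) nr (u k) by apply: sumr_ge0 => *; exact: nr_ge0.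
have [Nn|nN] := leqP N n.
  by have := H n Nn; rewrite sub0r nrN => /le_trans; apply; rewrite lerDl.
by rewrite (bigD1 (Ordinal nN)) //= addrCA lerDl addr_ge0.
Qed.

Lemma exists_nr_qpar (s : R) : 0 < s < 1 ->
  exists2 tau : C, upper_half_plane tau & nr (qpar tau) = s.
Proof.
move=> /andP[s0 s1]; have p0 : 0 < 2 * pi :> R by rewrite mulr_gt0 // pi_gt0.
have im : im_part (imagi * ofR (- ln s / (2 * pi)) : C) = - ln s / (2 * pi).
  by rewrite im_partM re_imagi im_imagi re_ofR im_ofR mul0r add0r mul1r.
exists (imagi * ofR (- ln s / (2 * pi))).
  change (0 < im_part (imagi * ofR (- ln s / (2 * pi)) : C)).
  by rewrite im divr_gt0 // oppr_gt0 ln_lt0 // s0.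
by rewrite nr_qpar im mulrC divfK ?gt_eqF // opprK lnK.
Qed.

(** The cusp oo has width 1, so F = exp(2 pi i tau L) times a power series in q with vector
    coefficients [A]. Entries of both factors are power series, which can be differentiated
    repeatedly. *)
Lemma modular_form_CD2 rho k (F : C -> 'cV[C]_2) i :
  modular_form rho k F -> CD2 (fun t => F t i 0).
Proof.
move=> [_ _ /(_ 1%:M)]; case; first by rewrite /SL2Z /= det1.
move=> L [_ _ [A HA]].
pose P (t : C) := expmx (t *: L).
pose S (tau : C) (j : 'I_2) := series (fun n => A n j 0 * qpar tau ^+ n).
have slash1 tau : slash k F 1%:M tau = F tau.
  by rewrite /slash /moebius !mxE /= mul0r add0r exp1rz scale1r mul1r addr0 divr1.
have cw : (cusp_width 1%:M)%:R = 1 :> C by rewrite /cusp_width !mxE.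
have HS tau : upper_half_plane tau -> forall j,
    (fun N => P (twopii * tau) j 0 * S tau 0 N + P (twopii * tau) j 1 * S tau 1 N) @ \oo --> F tau j 0.
  move=> h j; have := HA _ h; rewrite cw slash1 => /mx_cvgP/(_ j 0).
  apply: cvg_eqfun => N; rewrite mxE sum2E divr1 -/(P _).
  have sE l : (\sum_(0 <= n < N) cexp (twopii * n%:R * tau / 1) *: A n) l 0 = S tau l N.
    rewrite summxE /S /series /=; apply: eq_bigr => n _.
    by rewrite mxE divr1 mulrC -cexp_natM; congr (_ * cexp _); ring.
  by rewrite !sE.
(* Convergence is known only after multiplication by exp(2 pi i tau L); the inverse matrix isolates
   the two scalar series. *)
have cS tau j : upper_half_plane tau -> cvg (S tau j @ \oo).
  move=> h; have h0 := HS _ h 0; have h1 := HS _ h 1.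
  have inv l m : P (- (twopii * tau)) l 0 * P (twopii * tau) 0 m +
     P (- (twopii * tau)) l 1 * P (twopii * tau) 1 m = (l == m)%:R.
    have := expmx_inv L (twopii * tau) => /(congr1 (fun M : 'M[C]_2 => M l m)).
    by rewrite mxE sum2E mxE.
  apply: (cvgP (P (- (twopii * tau)) j 0 * F tau 0 0 + P (- (twopii * tau)) j 1 * F tau 1 0)).
  apply: (cvg_eqfun _ (cvgD (cvgMl_tmp (a := P (- (twopii * tau)) j 0) h0)
    (cvgMl_tmp (a := P (- (twopii * tau)) j 1) h1))) => N.
  rewrite -[LHS]/(P (- (twopii * tau)) j 0 *
     (P (twopii * tau) 0 0 * S tau 0 N + P (twopii * tau) 0 1 * S tau 1 N) +
     P (- (twopii * tau)) j 1 *
     (P (twopii * tau) 1 0 * S tau 0 N + P (twopii * tau) 1 1 * S tau 1 N)).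
  transitivity ((P (- (twopii * tau)) j 0 * P (twopii * tau) 0 0 +
     P (- (twopii * tau)) j 1 * P (twopii * tau) 1 0) * S tau 0 N +
    (P (- (twopii * tau)) j 0 * P (twopii * tau) 0 1 +
     P (- (twopii * tau)) j 1 * P (twopii * tau) 1 1) * S tau 1 N); first by rewrite /=; ring.
  rewrite !inv; case: (ord2P j) => ->; rewrite /= ?mul1r ?mul0r ?addr0 ?add0r //.
(* For s < 1 the series converges at some point with |q| = t > s, so its terms there are bounded. *)
have rA j : rad 1 (fun n => A n j 0).
  move=> s /andP[s0 s1]; pose t := (s + 1) / 2.
  have [tau h qt] : exists2 tau : C, upper_half_plane tau & nr (qpar tau) = t.
    by apply: exists_nr_qpar; rewrite /t; apply/andP; split; lra.
  have [K HK] := cvg0_bounded (cvg_series_cvg_0 (cS _ j h)).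
  exists K => n; apply: le_trans (HK n); rewrite nrM nrX qt ler_wpM2l ?nr_ge0 //.
  by rewrite lerXn2r ?nnegrE // /t; lra.
apply: (@CD2_eq (fun t => psum (expmx_coef L i 0) (twopii * t) * psum (fun n => A n 0 0) (qpar t) +
   psum (expmx_coef L i 1) (twopii * t) * psum (fun n => A n 1 0) (qpar t))).
  move=> tau h; have q1 := qpar_lt1 h; rewrite -!expmxE -/(P _).
  apply: (cvg_unique _ (cvgD (cvgMl_tmp (a := P (twopii * tau) i 0) (psum_cvg (rA 0) q1))
     (cvgMl_tmp (a := P (twopii * tau) i 1) (psum_cvg (rA 1) q1))) (HS _ h i)).
  exact: norm_hausdorff.
apply: CD2_add; apply: CD2_mul.
- by apply: CD2_psum_lin => r; exact: rad_expmx.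
- exact: CD2_psum_qpar.
- by apply: CD2_psum_lin => r; exact: rad_expmx.
- exact: CD2_psum_qpar.
Qed.

End twice_derivable.

(** * The Hauptmodul *)

Section local_theory.
Context {R : realType}.
Local Notation C := (Cx R).
Implicit Types (f g J : C -> C) (z w v : C).

(* The maximum of |Y| on a small disc around a zero is at most half of itself,
   by the mean value inequality. *)
Lemma linear_ode_zero (Y al : C -> C) z (d M : R) : 0 < d ->
  (forall w, nr (w - z) < d -> CD Y w (al w * Y w)) ->
  (forall w, nr (w - z) < d -> nr (al w) <= M) ->
  Y z = 0 -> \near z, Y z = 0.
Proof.
move=> d0 dY alM Y0.
have M0 : 0 <= M by apply: le_trans (alM z _); rewrite ?nr_ge0 // subrr nr0.
pose r := Num.min (d / 2) (1 / (2 * (M + 1))).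
have M1 : 0 < 2 * (M + 1) by lra.
have r0 : 0 < r by rewrite lt_min !divr_gt0.
have rd : r < d by apply: (@le_lt_trans _ _ (d / 2)); [rewrite ge_min lexx | lra].
have rM : M * r <= 1 / 2.
  apply: le_trans (_ : (M + 1) * (1 / (2 * (M + 1))) <= _); last first.
    by rewrite invfM mul1r mulrCA divff ?mulr1 ?mul1r // gt_eqF //; lra.
  by apply: ler_pM => //; rewrite ?(ltW r0) ?ge_min ?lexx ?orbT // lerDl.
have [w0 w0r wmax] := @ball_min R z r (fun w => - nr (Y w - 0)) (ltW r0)
  (fun w wr => cvgN (CD_nr_cvg (v := 0) (dY w (le_lt_trans wr rd)))).
have K0 : nr (Y w0) <= 1 / 2 * nr (Y w0).
  have := @mvi R Y (fun w => al w * Y w) z w0 (M * nr (Y w0)).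
  rewrite Y0 subr0 => H; apply: le_trans (H _ _) _.
  - move=> t /andP[t0 t1]; apply: dY; rewrite addrAC subrr add0r nrM nr_ofR ger0_norm //.
    by apply: le_lt_trans rd; apply: le_trans w0r; rewrite ler_piMl ?nr_ge0.
  - move=> t /andP[t0 t1].
    have tr : nr (z + ofR t * (w0 - z) - z) <= r.
      rewrite addrAC subrr add0r nrM nr_ofR ger0_norm //.
      by apply: le_trans w0r; rewrite ler_piMl ?nr_ge0.
    rewrite nrM; apply: ler_pM; rewrite ?nr_ge0 //; first exact/alM/(le_lt_trans tr).
    by have := wmax _ tr; rewrite !subr0 lerN2.
  - rewrite mulrAC ler_wpM2r ?nr_ge0 //; apply: le_trans rM.
    by rewrite ler_wpM2l.
have Yw0 : nr (Y w0) = 0 by have := nr_ge0 (Y w0); lra.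
apply/nbhsCP; exists r => // w /ltW/wmax; rewrite !subr0 lerN2 Yw0 => h.
by apply/eqP; rewrite -nr_eq0 eq_le h nr_ge0.
Qed.

Lemma CD_bounded f z l : CD f z l -> exists M d : R, 0 < d /\ forall w, nr (w - z) < d -> nr (f w) <= M.
Proof.
move=> /CD_cvg/cvgCP/(_ 1 ltr01)/nbhsCP[d d0 H]; exists (nr (f z) + 1), d; split => // w /H h.
have := nrD (f w - f z) (f z); rewrite subrK nrB; lra.
Qed.

(** By openness every v near J z has a preimage w near z, and |w - z| <= 2 |v - J z| / |l|. The
    expansion of [kp] at z thus becomes one of [g] at J z. *)
Lemma CD_inverse J g kp (U : set C) z l m : nbhs z U ->
  (forall w, U w -> exists2 l, l != 0 & CD J w l) ->
  (forall w, U w -> g (J w) = kp w) ->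
  CD J z l -> l != 0 -> CD kp z m -> CD g (J z) (m / l).
Proof.
move=> /nbhsCP[dU dU0 HU] JU gJ /CDP dJ l0 /CDP dk; apply/CDP => e e0.
have nl : 0 < nr l by rewrite nr_gt0.
pose q := nr (m / l) + 1; have q0 : 0 < q by rewrite ltr_wpDl ?nr_ge0.
pose e1 := e * nr l / 4; have e10 : 0 < e1 by rewrite divr_gt0 // mulr_gt0.
pose e2 := Num.min (nr l / 2) (e * nr l / 4 / q).
have e20 : 0 < e2 by rewrite lt_min !divr_gt0 // mulr_gt0.
have [d1 d10 H1] := dk _ e10; have [d2 d20 H2] := dJ _ e20.
pose d := Num.min dU (Num.min d1 d2).
have d0 : 0 < d by rewrite !lt_min dU0 d10 d20.
have [n n0 Hn] : exists2 n : R, 0 < n & forall v, nr (v - J z) < n -> exists2 w, nr (w - z) < d & J w = v.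
  apply: open_mapping => // w wd; apply: JU; apply: HU; apply: lt_le_trans wd _.
  by rewrite ge_min lexx.
have Uz : U z by apply: HU; rewrite subrr nr0.
exists n => // h hn; have [|w wd Jw] := Hn (J z + h); first by rewrite addrAC subrr add0r.
move: wd; rewrite !lt_min => /and3P[wU w1 w2].
rewrite -Jw !gJ //; last exact: HU.
have := H1 _ w1; have := H2 _ w2; rewrite ![z + _]addrC !subrK => h2 h1.
have he : h = J w - J z by rewrite Jw addrAC subrr add0r.
rewrite he; set x := w - z in h1 h2 *.
have e2l : e2 <= nr l / 2 by rewrite ge_min lexx.
have e2q : nr (m / l) * e2 <= e * nr l / 4.
  apply: le_trans (_ : q * (e * nr l / 4 / q) <= _).
    apply: ler_pM; rewrite ?nr_ge0 ?(ltW e20) // ?lerDl // ge_min lexx orbT //.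
  by rewrite mulrC divfK // gt_eqF.
have low : nr l / 2 * nr x <= nr (J w - J z).
  have := nrD_le (l * x) (J w - J z - l * x); rewrite [_ + (_ - _)]addrC subrK nrM.
  have : e2 * nr x <= nr l / 2 * nr x by rewrite ler_wpM2r ?nr_ge0.
  lra.
have -> : kp w - kp z - m / l * (J w - J z) =
   (kp w - kp z - m * x) - m / l * (J w - J z - l * x).
  by move: (kp w) (kp z) (J w) (J z) => A B C' D'; field.
apply: (le_trans (nrD _ _)); rewrite nrN nrM.
have : nr (m / l) * nr (J w - J z - l * x) <= e * nr l / 4 * nr x.
  apply: le_trans (ler_wpM2l (nr_ge0 _) h2) _.
  by rewrite mulrA ler_wpM2r ?nr_ge0.
have : e * (nr l / 2 * nr x) <= e * nr (J w - J z) by rewrite ler_wpM2l ?(ltW e0).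
by move: h1; rewrite /e1; lra.
Qed.

(* At a double zero z of J = A G^2, the point z + h has a second preimage close
   to z - h. *)
Lemma double_zero_not_injective J G A z (g1 : C) (U : set C) : nbhs z U ->
  (forall w, U w -> J w = A w * G w ^+ 2) ->
  (forall w, U w -> exists l, CD J w l) ->
  (forall w, U w -> G w != 0 -> exists2 l, l != 0 & CD J w l) ->
  G z = 0 -> CD G z g1 -> g1 != 0 -> A @ z --> A z -> A z != 0 ->
  exists w1 w2, [/\ U w1, U w2, w1 != w2 & J w1 = J w2].
Proof.
move=> /nbhsCP[dU dU0 HU] JE Jd Jd0 G0 /CDP dG g10 /cvgCPle cA A0.
pose al := A z * g1 ^+ 2; have al0 : 0 < nr al by rewrite nr_gt0 mulf_neq0 ?expf_neq0.
have ng : 0 < nr g1 by rewrite nr_gt0.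
(* [K] collects the errors made in replacing A G^2 at z + k by al k^2; then e K <= |al| / 8 leaves
   an error of at most |al| |k|^2 / 8. *)
pose K := (nr g1 + 1) ^+ 2 + nr (A z) * (2 * nr g1 + 1).
have K0 : 0 < K.
  by rewrite ltr_pwDl ?mulr_ge0 ?nr_ge0 ?exprn_gt0 //; lra.
pose e := Num.min (Num.min 1 (nr g1 / 2)) (nr al / 8 / K).
have e0 : 0 < e by rewrite !lt_min ltr01 !divr_gt0.
have e1 : e <= 1 by rewrite !ge_min lexx.
have eg : e <= nr g1 / 2 by rewrite !ge_min lexx orbT.
have eK : e * K <= nr al / 8 by rewrite -ler_pdivlMr // !ge_min lexx !orbT.
have [d1 d10 H1] := dG _ e0; have /nbhsCP[d2 d20 H2] := cA _ e0.
pose d := Num.min dU (Num.min d1 d2).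
have d0 : 0 < d by rewrite !lt_min dU0 d10 d20.
have est (k : C) : nr k < d -> [/\ U (z + k), (k != 0 -> G (z + k) != 0) &
    nr (J (z + k) - al * k ^+ 2) <= nr al / 8 * nr k ^+ 2].
  rewrite !lt_min => /and3P[kU k1 k2].
  have Uk : U (z + k) by apply: HU; rewrite addrAC subrr add0r.
  have := H1 _ k1; rewrite G0 subr0 => hG.
  have := H2 (z + k); rewrite addrAC subrr add0r => /(_ k2) hA.
  split => //.
    move=> k0; apply/eqP => Gk; move: hG; rewrite Gk sub0r nrN nrM => h.
    have kp : 0 < nr k by rewrite nr_gt0.
    by move: h; rewrite ler_pM2r //; lra.
  rewrite JE //; set a := A (z + k) in hA *; set g := G (z + k) in hG *.
  have kn := nr_ge0 k.
  have ng' : nr g <= (nr g1 + 1) * nr k.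
    have := nrD (g - g1 * k) (g1 * k); rewrite subrK nrM.
    have : e * nr k <= 1 * nr k by rewrite ler_wpM2r.
    lra.
  have -> : a * g ^+ 2 - al * k ^+ 2 = (a - A z) * g ^+ 2 + A z * ((g - g1 * k) * (g + g1 * k)).
    by rewrite /al; ring.
  apply: (le_trans (nrD _ _)).
  rewrite [nr ((a - _) * _)]nrM nrX [nr (A z * _)]nrM [nr ((_ - _) * (_ + _))]nrM.
  have t1 : nr (a - A z) * nr g ^+ 2 <= e * ((nr g1 + 1) ^+ 2 * nr k ^+ 2).
    rewrite -exprMn nrB; apply: ler_pM; rewrite ?nr_ge0 ?exprn_ge0 ?nr_ge0 //.
    by rewrite lerXn2r ?nnegrE ?nr_ge0 ?mulr_ge0 //; lra.
  have t2 : nr (g - g1 * k) * nr (g + g1 * k) <= e * nr k * ((2 * nr g1 + 1) * nr k).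
    apply: ler_pM; rewrite ?nr_ge0 //.
    by have := nrD g (g1 * k); rewrite nrM; lra.
  have t3 := ler_wpM2l (nr_ge0 (A z)) t2.
  have := ler_wpM2r (exprn_ge0 2 kn) eK.
  by move: t1 t3; rewrite /K; lra.
pose s := d / 2; have s0 : 0 < s by rewrite divr_gt0.
pose h : C := ofR s; have nh : nr h = s by rewrite nr_ofR ger0_norm // ltW.
have hd : nr h < d by rewrite nh /s; lra.
have in_ball w : nr (w - (z - h)) <= s / 2 -> nr (w - z) < d /\ s / 2 <= nr (w - z).
  move=> hw; have := nrD (w - (z - h)) (- h); have := nrD_le (- h) (w - (z - h)).
  rewrite nrN nh [- h + _]addrC (_ : w - (z - h) - h = w - z); last by ring.
  by rewrite /s in hw *; lra.
have wE w : w = z + (w - z) by rewrite addrC subrK.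
have [Uh _ Jh] := est _ hd.
have Nh : nr (- h) < d by rewrite nrN.
have [_ _ JNh] := est _ Nh.
have s20 : 0 < s / 2 by rewrite divr_gt0.
(* On this circle |J w - J(z + h)| >= |al| (3/4 - 13/32) s^2, which exceeds the bound |al| s^2 / 4
   at its centre z - h. The disc contains neither z nor z + h, so the solution found is a second
   preimage. *)
have [||| w wr Jw] := @min_zero R J (z - h) (s / 2) (J (z + h)) s20.
- move=> w /in_ball[wd _]; apply: Jd; rewrite (wE w).
  by have [] := est _ wd.
- move=> w /ltW/in_ball[wd ws]; have [Uw Gw _] := est _ wd.
  rewrite -wE in Uw Gw; apply: Jd0 => //; apply: Gw.
  by rewrite -nr_gt0; apply: lt_le_trans ws.
- move=> w wr; have [|wd ws] := in_ball w; first by rewrite wr.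
  have [_ _] := est _ wd; rewrite -wE; set k := w - z in wd ws *.
  pose x := w - (z - h); have kx : k = x - h by rewrite /k /x; ring.
  have nx : nr x = s / 2 by [].
  move=> Jk.
  have b1 : nr (J (z - h) - J (z + h)) <= nr al / 4 * s ^+ 2.
    have -> : J (z - h) - J (z + h) = (J (z - h) - al * (- h) ^+ 2) - (J (z + h) - al * h ^+ 2) by ring.
    apply: (le_trans (nrD _ _)); rewrite nrN; move: JNh Jh; rewrite nrN nh; lra.
  apply: (le_lt_trans b1).
  have b2 : nr al * (3 / 4 * s ^+ 2) <= nr (al * (k ^+ 2 - h ^+ 2)).
    rewrite nrM ler_wpM2l ?nr_ge0 // (_ : k ^+ 2 - h ^+ 2 = x * (x - 2 * h)); last by rewrite kx; ring.
    rewrite nrM nx; have : 3 / 2 * s <= nr (x - 2 * h).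
      have := nrD_le (- (2 * h)) x; rewrite [_ + x]addrC nrN nrM nr_nat nh nx; lra.
    move=> /(ler_wpM2l (ltW s20)); rewrite expr2; lra.
  have nk : nr k ^+ 2 <= 9 / 4 * s ^+ 2.
    have -> : 9 / 4 * s ^+ 2 = (3 / 2 * s) ^+ 2 by field.
    have s32 : 0 <= 3 / 2 * s by rewrite mulr_ge0 ?(ltW s0) // divr_ge0.
    rewrite lerXn2r ?nnegrE ?nr_ge0 //; have := nrD x (- h).
    by rewrite -kx nrN nh nx; lra.
  have b3 : nr (J w - al * k ^+ 2 - (J (z + h) - al * h ^+ 2)) <= nr al * (13 / 32 * s ^+ 2).
    apply: (le_trans (nrD _ _)); rewrite nrN; move: Jh; rewrite nh => Jh'.
    have := ler_wpM2l (nr_ge0 al) nk; move: Jk; lra.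
  have := nrD_le (al * (k ^+ 2 - h ^+ 2)) (J w - al * k ^+ 2 - (J (z + h) - al * h ^+ 2)).
  rewrite (_ : _ + (J w - _ - _) = J w - J (z + h)); last by ring.
  have : 0 < nr al * s ^+ 2 by rewrite mulr_gt0 // exprn_gt0.
  by move: b2 b3; lra.
have [wd _] := in_ball _ (ltW wr); have [Uw _ _] := est _ wd; rewrite -wE in Uw.
exists w, (z + h); split => //; apply/eqP => wh; move: wr.
rewrite wh (_ : z + h - (z - h) = 2 * h); last by ring.
by rewrite nrM nr_nat nh; lra.
Qed.

End local_theory.

(** * Derivative of J and the values it omits on U *)

Section hauptmodul.
Context {R : realType}.
Local Notation C := (Cx R).
Implicit Types (z w tau : C).

(** [Y] is the denominator of J, and Z = Y (J - 1) wherever Y is nonzero. *)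
Local Notation Y tau := (E4 tau - Gfun tau ^+ 2).
Local Notation Z tau := (4 * Gfun tau ^+ 2 - E4 tau).

Lemma Jfun_CD tau : upper_half_plane tau -> Y tau != 0 ->
  CD Jfun tau (twopii * (Gfun tau * (1 - Jfun tau))).
Proof.
move=> h Y0; have dG := Gfun_CD h; have dE := E4_CD h.
have H := CD_mul (CD_scale 3 (CD_exp 2 dG)) (CD_inv (CD_sub dE (CD_exp 2 dG)) Y0).
apply: (CD_eq H); rewrite /Jfun; move: Y0.
move: (E2 tau) (E4 tau) (Gfun tau) twopii => x y g p Y0.
by rewrite /= expr1; field.
Qed.

Lemma Y_CD tau : upper_half_plane tau ->
  CD (fun t => Y t) tau (twopii * (E2 tau / 3 + 2 * Gfun tau / 3) * Y tau).
Proof.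
move=> h; apply: (CD_eq (CD_sub (E4_CD h) (CD_exp 2 (Gfun_CD h)))).
move: (E2 tau) (E4 tau) (Gfun tau) twopii => x y g p.
by rewrite /= expr1; field.
Qed.

Lemma Z_CD tau : upper_half_plane tau ->
  CD (fun t => Z t) tau (twopii * (E2 tau / 3 + (- 1) * Gfun tau / 3) * Z tau).
Proof.
move=> h; apply: (CD_eq (CD_sub (CD_scale 4 (CD_exp 2 (Gfun_CD h))) (E4_CD h))).
move: (E2 tau) (E4 tau) (Gfun tau) twopii => x y g p.
by rewrite /= expr1; field.
Qed.

(** The constant c is 2 for Y and - 1 for Z. *)
Lemma first_order_near0 (X : C -> C) (c : C) tau : upper_half_plane tau ->
  (forall t, upper_half_plane t -> CD X t (twopii * (E2 t / 3 + c * Gfun t / 3) * X t)) ->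
  X tau = 0 -> \near tau, X tau = 0.
Proof.
move=> h dX X0; pose al t := twopii * (E2 t * 3^-1 + c * Gfun t * 3^-1).
have dal : exists l, CD al tau l.
  eexists; apply: CD_scale; apply: CD_add; apply: CD_mul; [exact: E2_CD | exact: CD_cst | | exact: CD_cst].
  by apply: CD_scale; exact: Gfun_CD.
have [l /CD_bounded[M [d [d0 HM]]]] := dal.
have /nbhsCP[d' d'0 Hd'] := near_H h.
apply: (@linear_ode_zero R X al tau (Num.min d d') M) => //.
- by rewrite lt_min d0.
- by move=> w; rewrite lt_min => /andP[_ wd]; exact/dX/Hd'.
- by move=> w; rewrite lt_min => /andP[wd _]; exact: HM.
Qed.

Variable U : set C.
Hypotheses (U_H : U `<=` upper_half_plane) (U_open : open U).
Hypothesis J_inj : forall z w, U z -> U w -> Jfun z = Jfun w -> z = w.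

Let nbhsU z : U z -> nbhs z U.
Proof. by move=> Uz; apply: open_nbhs_nbhs; split. Qed.

Lemma Jfun_not_near_cst z c : U z -> ~ (\near z, Jfun z = c).
Proof.
move=> Uz Jc; have : nbhs z (U `&` [set w | Jfun w = c]).
  by apply: filterI; [exact: nbhsU | exact: Jc].
move=> /nbhsCP[d d0 H].
have [Uz' Jz] : U z /\ Jfun z = c by apply: H; rewrite subrr nr0.
have nw : nr (z + ofR (d / 2) - z) = d / 2.
  by rewrite addrAC subrr add0r nr_ofR ger0_norm // divr_ge0 // ltW.
have [Uw Jw] : U (z + ofR (d / 2)) /\ Jfun (z + ofR (d / 2)) = c by apply: H; rewrite nw; lra.
have e : z + ofR (d / 2) = z by apply: J_inj; [exact: Uw | exact: Uz | rewrite Jw Jz].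
by move: nw; rewrite e subrr nr0; lra.
Qed.

Lemma Y_neq0 z : U z -> Y z != 0.
Proof.
move=> Uz; apply/eqP => Y0; apply: (@Jfun_not_near_cst z 0 Uz).
(* Division by zero returns 0, so J would be constantly 0 near z. *)
apply: filterS (first_order_near0 (U_H Uz) Y_CD Y0) => w /= Yw.
by rewrite /Jfun Yw invr0 mulr0.
Qed.

Lemma Jfun_neq1 z : U z -> Jfun z != 1.
Proof.
move=> Uz; apply/eqP => J1; apply: (@Jfun_not_near_cst z 1 Uz).
have Z0 : Z z = 0.
  have := Y_neq0 Uz; move: J1; rewrite /Jfun; move: (E4 z) (Gfun z) => y g e y0.
  have e2 : 3 * g ^+ 2 = y - g ^+ 2 by rewrite -(divfK y0 (3 * g ^+ 2)) e mul1r.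
  have -> : 4 * g ^+ 2 - y = 3 * g ^+ 2 - (y - g ^+ 2) by ring.
  by rewrite e2 subrr.
apply: filterS (filterI (nbhsU Uz) (first_order_near0 (U_H Uz) Z_CD Z0)) => w /= [Uw].
have := Y_neq0 Uw; rewrite /Jfun; move: (E4 w) (Gfun w) => y g y0 Zw.
have -> : y = 4 * g ^+ 2 by apply/esym/eqP; rewrite -subr_eq0 Zw.
have e : 4 * g ^+ 2 - g ^+ 2 = 3 * g ^+ 2 by ring.
rewrite e divff // -e.
by have -> : 4 * g ^+ 2 = y by apply/eqP; rewrite -subr_eq0 Zw.
Qed.

Lemma Gfun_neq0 z : U z -> Gfun z != 0.
Proof.
move=> Uz; apply/eqP => G0.
have dJ w : U w -> CD Jfun w (twopii * (Gfun w * (1 - Jfun w))).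
  by move=> Uw; exact: Jfun_CD (U_H Uw) (Y_neq0 Uw).
pose A w : C := 3 * (Y w)^-1.
have dA : exists l, CD A z l.
  by eexists; apply: CD_scale; apply: CD_inv (Y_CD (U_H Uz)) (Y_neq0 Uz).
have E0 : E4 z != 0 by have := Y_neq0 Uz; rewrite G0 expr0n subr0.
have [||||||||w1 [w2 [U1 U2 w12 Jw]]] := @double_zero_not_injective R Jfun Gfun A z
    (twopii * (E2 z * Gfun z / 6 + E4 z / 6 - Gfun z ^+ 2 / 3)) U (nbhsU Uz).
- by move=> w Uw; rewrite /Jfun /A mulrAC.
- by move=> w Uw; eexists; exact: dJ.
- move=> w Uw Gw; eexists; last exact: dJ.
  apply: mulf_neq0; first exact: twopii_neq0.
  by apply: mulf_neq0 => //; rewrite subr_eq0 eq_sym; exact: Jfun_neq1 Uw.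
- exact: G0.
- exact: Gfun_CD (U_H Uz).
(* At a zero of G the derivative D G is E4 / 6, and E4 = Y is nonzero there. *)
- rewrite G0 expr0n /= mulr0 !mul0r add0r subr0.
  apply: mulf_neq0; first exact: twopii_neq0.
  by apply: mulf_neq0 => //; rewrite invr_eq0 pnatr_eq0.
- by have [l /CD_cvg] := dA.
- apply: mulf_neq0; first by rewrite pnatr_eq0.
  by rewrite invr_eq0; exact: Y_neq0 Uz.
by move/eqP : w12; apply; exact: J_inj.
Qed.

Lemma Jfun_neq0 z : U z -> Jfun z != 0.
Proof.
move=> Uz; have Y0 := Y_neq0 Uz; have G0 := Gfun_neq0 Uz; rewrite /Jfun.
apply: mulf_neq0; last by rewrite invr_eq0.
by apply: mulf_neq0; [rewrite pnatr_eq0 | exact: expf_neq0].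
Qed.

End hauptmodul.

(** The substitution in pure algebra: p is 2 pi i; x, y, g are E2, E4, G; k is the weight; ep is
    eta^(-2 k0); f, f1, f2 are a component of F and its derivatives. Then [num] and [dJ] are the
    derivatives of F0 and J, and [dnum] and [ddJ] their second derivatives. *)
Lemma final_identity (K : numFieldType) (p f f1 f2 x y g J k a b c ep : K) :
  p != 0 -> g != 0 -> J != 0 -> J != 1 -> y = g ^+ 2 * (J + 3) / J ->
  p^-1 * (p^-1 * f2 - (k / 12 * (p * ((x ^+ 2 - y) / 12)) * f + k / 12 * x * f1))
  - ((k + 2) / 12 * x) * (p^-1 * f1 - k / 12 * x * f)
  + a * g * (p^-1 * f1 - k / 12 * x * f) + (b * g ^+ 2 + c * y) * f = 0 ->
  let dJ := p * (g * (1 - J)) in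
  let dg := p * (x * g / 6 + y / 6 - g ^+ 2 / 3) in
  let num := ep * (f1 - k / 12 * p * x * f) in
  let dnum := - (2 * k) * (p * x / 24) * ep * (f1 - k / 12 * p * x * f)
     + ep * (f2 - k / 12 * p * (p * ((x ^+ 2 - y) / 12) * f + x * f1)) in
  let ddJ := p * (dg * (1 - J) + g * (0 - dJ)) in
  (dnum * dJ^-1 + num * (- ddJ / dJ ^+ 2)) / dJ
  + (7 * J - 6 * a * J - 3) / (6 * J * (J - 1)) * (num * dJ^-1)
  + ((b + c) * J + 3 * c) / (J * (J - 1) ^+ 2) * (ep * f) = 0.
Proof.
move=> p0 g0 J0 J1 yE.
set A := k / 12 * _ * f + _; set B := (k + 2) / 12 * x * _; set C' := a * g * _; set D' := (_ + _) * f.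
move=> ode /=.
(* The equation is solved for f2: the added term is p^2 times its left-hand side, which is 0. *)
have -> : f2 = p * A + p ^+ 2 * (B - C' - D').
  have -> : f2 = p * A + p ^+ 2 * (B - C' - D') + p ^+ 2 * (p^-1 * (p^-1 * f2 - A) - B + C' + D').
    by field.
  by rewrite ode mulr0 addr0; field.
rewrite /A /B /C' /D' yE.
have J1' : 1 - J != 0 by rewrite subr_eq0 eq_sym.
have J1'' : J - 1 != 0 by rewrite subr_eq0.
by field; rewrite p0 g0 J0 J1' J1''.
Qed.

Lemma col_lincombP (K : pzRingType) (A B D : 'cV[K]_2) (x y : K) (a b d : 'I_2 -> K) :
  (forall i, A i 0 = a i) -> (forall i, B i 0 = b i) -> (forall i, D i 0 = d i) ->
  A + x *: B + y *: D = 0 <-> forall i, a i + x * b i + y * d i = 0.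
Proof.
move=> Aa Bb Dd; have E i : (A + x *: B + y *: D) i 0 = a i + x * b i + y * d i.
  by rewrite !mxE Aa Bb Dd.
split=> [/matrixP H i|H]; first by rewrite -E H mxE.
by apply/colP => i; rewrite E H mxE.
Qed.

Lemma Dop_coef (R : realType) k (A : Cx R -> 'cV[Cx R]_2) t i :
  Dop k A t i 0 = twopii^-1 * derive1 A t i 0 - k%:~R / 12 * E2 t * A t i 0.
Proof. by rewrite /Dop !mxE. Qed.

Theorem theorem4p2 (R : realType)
  (rho : 'M[int]_2 -> 'M[Cx R]_2)
  (rho_rep : is_representation rho)
  (rho_irr : is_irreducible rho)
  (k0 : int) (k0_least : least_weight rho k0)
  (F : Cx R -> 'cV[Cx R]_2)
  (F_mod : modular_form rho k0 F) (F_neq0 : nonzero_on_H F)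
  (a b c : Cx R)
  (F_ode : forall tau : Cx R, upper_half_plane tau ->
     Dop (k0 + 2) (Dop k0 F) tau + (a * Gfun tau) *: Dop k0 F tau
     + (b * Gfun tau ^+ 2 + c * E4 tau) *: F tau = 0)
  (tau0 : Cx R) (tau0_H : upper_half_plane tau0)
  (tau0_nell : ~ elliptic_point tau0)
  (U : set (Cx R)) (U_H : U `<=` upper_half_plane)
  (U_open : open U) (U_conn : connected U) (U_sc : simply_connected U)
  (U_tau0 : U tau0)
  (J_inj : forall z w : Cx R, U z -> U w -> Jfun z = Jfun w -> z = w)
  (H : Cx R -> 'cV[Cx R]_2)
  (H_hol : holomorphic_on (Jfun @` U) H)
  (H_J : forall tau : Cx R, U tau ->
     (eta tau ^ (2 * k0))^-1 *: F tau = H (Jfun tau)) :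
  forall tau : Cx R, U tau ->
    derive1 (derive1 H) (Jfun tau)
    + ((7 * Jfun tau - 6 * a * Jfun tau - 3)
       / (6 * Jfun tau * (Jfun tau - 1))) *: derive1 H (Jfun tau)
    + (((b + c) * Jfun tau + 3 * c)
       / (Jfun tau * (Jfun tau - 1) ^+ 2)) *: H (Jfun tau) = 0.
Proof.
move=> tau Utau; have h := U_H _ Utau.
have nbhsU z : U z -> nbhs z U by move=> Uz; apply: open_nbhs_nbhs; split.
have Y0 := Y_neq0 U_H U_open J_inj; have G0 := Gfun_neq0 U_H U_open J_inj.
have J0 := Jfun_neq0 U_H U_open J_inj; have J1 := Jfun_neq1 U_H U_open J_inj.
have dJ z : U z -> CD Jfun z (twopii * (Gfun z * (1 - Jfun z))).
  by move=> Uz; exact: Jfun_CD (U_H _ Uz) (Y0 _ Uz).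
have dJ0 z : U z -> twopii * (Gfun z * (1 - Jfun z)) != 0.
  move=> Uz; apply: mulf_neq0; first exact: twopii_neq0.
  by apply: mulf_neq0; [exact: G0 | rewrite subr_eq0 eq_sym J1].
pose k : Cx R := k0%:~R.
have reg i : exists f1 f2 : Cx R -> Cx R, forall t, upper_half_plane t ->
    CD (fun t => F t i 0) t (f1 t) /\ CD f1 t (f2 t) := modular_form_CD2 i F_mod.
have [f1_ Hf1] := choice reg; have [f2_ Hf] := choice Hf1.
pose ep t : Cx R := (eta t ^ (2 * k0))^-1.
have dep t : upper_half_plane t -> CD ep t (- (2 * k) * (twopii * E2 t / 24) * ep t).
  move=> ht; have := CD_exprz_inv (2 * k0) (eta_neq0 ht) (eta_CD ht).
  by rewrite intrM.
(* The derivative of F0, written as 2 pi i eta^(-2 k0) D_k0 F: differentiating eta^(-2 k0) produces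
   exactly the E2 term. *)
pose num j t := ep t * (f1_ j t - k / 12 * twopii * E2 t * F t j 0).
have dnum j t : upper_half_plane t -> CD (num j) t
   (- (2 * k) * (twopii * E2 t / 24) * ep t * (f1_ j t - k / 12 * twopii * E2 t * F t j 0) +
    ep t * (f2_ j t - k / 12 * twopii * (twopii * ((E2 t ^+ 2 - E4 t) / 12) * F t j 0 + E2 t * f1_ j t))).
  move=> ht; have [dF dF1] := Hf j t ht.
  apply: CD_mul (dep t ht) _; apply: CD_sub dF1 _.
  rewrite (_ : (fun x => _) = (fun x => k / 12 * twopii * (E2 x * F x j 0))); last first.
    by apply/funext => x; rewrite mulrA.
  by apply: CD_scale; apply: CD_mul (E2_CD ht) dF.
(* The chain rule for F0 = H o J and uniqueness of derivatives give H' o J = F0' / J' on U. *)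
have dH j t : U t -> derive1 H (Jfun t) j 0 = num j t * (twopii * (Gfun t * (1 - Jfun t)))^-1.
  move=> Ut; have ht := U_H _ Ut.
  have d1 : CD (fun x => H x j 0) (Jfun t) (derive1 H (Jfun t) j 0).
    by apply: derivable_col; apply: H_hol; exists t.
  have d2 := CD_comp (dJ _ Ut) d1.
  have d3 : CD (fun x => H (Jfun x) j 0) t (num j t).
    have [dF _] := Hf j t ht; have d4 := CD_mul (dep t ht) dF.
    apply: (@CD_near _ (fun x => ep x * F x j 0)).
      by apply: filterS (nbhsU _ Ut) => x Ux; rewrite -H_J // mxE.
    apply: (CD_eq d4); rewrite /num; move: (E2 t) (ep t) (f1_ j t) (F t j 0) twopii => x e y z p.
    by field.
  by rewrite -(CD_unique d2 d3) mulfK // dJ0.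
pose m j : Cx R :=
   (- (2 * k) * (twopii * E2 tau / 24) * ep tau *
      (f1_ j tau - k / 12 * twopii * E2 tau * F tau j 0) +
    ep tau * (f2_ j tau - k / 12 * twopii *
      (twopii * ((E2 tau ^+ 2 - E4 tau) / 12) * F tau j 0 + E2 tau * f1_ j tau)))
    * (twopii * (Gfun tau * (1 - Jfun tau)))^-1 + num j tau *
   (- (twopii * (twopii * (E2 tau * Gfun tau / 6 + E4 tau / 6 - Gfun tau ^+ 2 / 3) * (1 - Jfun tau) +
     Gfun tau * (0 - twopii * (Gfun tau * (1 - Jfun tau))))) /
     (twopii * (Gfun tau * (1 - Jfun tau))) ^+ 2).
(* Holomorphy of H provides one derivative; the second comes from differentiating F0' / J' = H' o J
   at tau and dividing by J'. *)
have ddH j : CD (fun v => derive1 H v j 0) (Jfun tau) (m j / (twopii * (Gfun tau * (1 - Jfun tau)))).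
  apply: (@CD_inverse R Jfun _ (fun t => num j t * (twopii * (Gfun t * (1 - Jfun t)))^-1) U tau).
  - exact: nbhsU.
  - by move=> w Uw; exists (twopii * (Gfun w * (1 - Jfun w))); [exact: dJ0 | exact: dJ].
  - by move=> w Uw; exact: dH.
  - exact: dJ.
  - exact: dJ0.
  - apply: CD_mul (dnum j tau h) _.
    apply: (@CD_inv _ (fun t => twopii * (Gfun t * (1 - Jfun t)))); last exact: dJ0.
    apply: CD_scale; apply: CD_mul (Gfun_CD h) _; apply: CD_sub (CD_cst _ _) (dJ _ Utau).
(* The definition of J solved for E4, with J, G and E4 - G^2 nonzero on U. *)
have E4E' : E4 tau = Gfun tau ^+ 2 * (Jfun tau + 3) / Jfun tau.
  have := Y0 _ Utau; have := G0 _ Utau; rewrite /Jfun.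
  by move: (E4 tau) (Gfun tau) => y g g0 y0; field; rewrite y0 g0.
have DopE t j : upper_half_plane t ->
    Dop k0 F t j 0 = twopii^-1 * f1_ j t - k / 12 * E2 t * F t j 0.
  move=> ht; rewrite Dop_coef (@derive1_col R F t (fun j => f1_ j t)) //.
  by move=> l; have [] := Hf l t ht.
have dDop j : CD (fun x => Dop k0 F x j 0) tau (twopii^-1 * f2_ j tau -
   (k / 12 * (twopii * ((E2 tau ^+ 2 - E4 tau) / 12)) * F tau j 0 + k / 12 * E2 tau * f1_ j tau)).
  have [dF dF1] := Hf j tau h.
  apply: (@CD_near _ (fun t => twopii^-1 * f1_ j t - k / 12 * E2 t * F t j 0)).
    by apply: filterS (near_H h) => t ht; rewrite DopE.
  apply: CD_sub (CD_scale _ dF1) _; apply: CD_mul _ dF.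
  by apply: CD_scale; exact: E2_CD.
have DDE j : Dop (k0 + 2) (Dop k0 F) tau j 0 = twopii^-1 * (twopii^-1 * f2_ j tau -
   (k / 12 * (twopii * ((E2 tau ^+ 2 - E4 tau) / 12)) * F tau j 0 + k / 12 * E2 tau * f1_ j tau))
   - (k + 2) / 12 * E2 tau * (twopii^-1 * f1_ j tau - k / 12 * E2 tau * F tau j 0).
  rewrite Dop_coef (derive1_col j dDop) DopE //.
  by have -> : (k0 + 2)%:~R = k + 2 :> Cx R by rewrite intrD.
have ode := iffLR (col_lincombP _ _ DDE (fun j => DopE tau j h) (fun j => erefl)) (F_ode _ h).
have HE j : H (Jfun tau) j 0 = ep tau * F tau j 0 by rewrite -H_J // mxE.
apply/(col_lincombP _ _ (fun j => derive1_col j ddH) (fun j => dH j _ Utau) HE) => i.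
exact: (final_identity _ (twopii_neq0 (R := R)) (G0 _ Utau) (J0 _ Utau) (J1 _ Utau) E4E' (ode i)).
Qed.
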